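(* Let $m,n\ge 1$, let $H\in\mathbb S_{++}^{mn}$, let $P=P_{\mathcal K}(H)$ be the unique affine-invariant nearest point of $\mathcal K_{m,n}$ to $H$, put $S=P^{-1/2}HP^{-1/2}$, and let $E_+$ and $E_-$ be the eigenspaces of $S$ for its largest and smallest eigenvalue, respectively. (i) $P$ belongs to $\operatorname*{arg\,min}_{G\in\mathcal K_{m,n}}\log\kappa(G^{-1}H)$ if and only if there exist symmetric matrices $Q_+,Q_-\succeq 0$ with $$\operatorname{tr}Q_+=\operatorname{tr}Q_-=1,\qquad \operatorname{range}(Q_+)\subseteq E_+,\qquad \operatorname{range}(Q_-)\subseteq E_-,$$ and $$\operatorname{Tr}_B(Q_--Q_+)=0,\qquad \operatorname{Tr}_A(Q_--Q_+)=0.$$ (ii) If the extreme eigenvalues of $S$ are simple, with unit eigenvectors $u_+$ and $u_-$ for the largest and smallest eigenvalue, then the condition in (i) says exactly that $$\operatorname{Tr}_B(u_+u_+^\top)=\operatorname{Tr}_B(u_-u_-^\top)\quad\text{and}\quad \operatorname{Tr}_A(u_+u_+^\top)=\operatorname{Tr}_A(u_-u_-^\top).$$ (iii) If $S$ has exactly two distinct eigenvalues, then the condition in (i) always holds, so $P$ is a global minimizer of $\kappa(G^{-1}H)$ over $G\in\mathcal K_{m,n}$. (iv) The conclusion of (iii) does not extend to arbitrary spectra: let $A=\operatorname{diag}(1,-1)$, $B=\operatorname{diag}(2,-\tfrac12,-\tfrac32)$ and $H=\exp(B\otimes A)\in\mathbb S_{++}^6$. Then $$P_{\mathcal K_{2,3}}(H)=I_6,\qquad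 \log\kappa(H)=4,$$ whereas $G=I_3\otimes\exp(\tfrac14A)\in\mathcal K_{2,3}$ satisfies $\log\kappa(G^{-1}H)=\tfrac72$. Thus the unique nearest Kronecker matrix need not minimize $\kappa(G^{-1}H)$ over the Kronecker family.
   Context: $\mathbb S^d$ denotes real symmetric $d\times d$ matrices and $\mathbb S_{++}^d$ the positive-definite ones. The affine-invariant distance is $d_{\mathrm{AI}}(G_0,G_1)=\|\log(G_0^{-1/2}G_1G_0^{-1/2})\|_F$. For $G,H\in\mathbb S_{++}^d$, $\kappa(G^{-1}H)$ is the ratio of the largest to the smallest generalized eigenvalue in $Hv=\lambda Gv$, and $\kappa(H)=\kappa(I^{-1}H)$. The Kronecker family is $\mathcal K_{m,n}=\{B\otimes A: A\in\mathbb S_{++}^m,\ B\in\mathbb S_{++}^n\}\subset\mathbb S_{++}^{mn}$. For every $M\in\mathbb S_{++}^{mn}$ there is a unique point $P_{\mathcal K}(M)=P_{\mathcal K_{m,n}}(M)=\operatorname*{arg\,min}_{G\in\mathcal K_{m,n}}d_{\mathrm{AI}}(M,G)$. For $L\in\mathbb S^{mn}$ written as $L=[L_{pq}]_{p,q=1}^n$ with $m\times m$ blocks, the partial traces are $\operatorname{Tr}_B(L)=\sum_{p=1}^nL_{pp}\in\mathbb S^m$ and $\operatorname{Tr}_A(L)=[\operatorname{tr}(L_{pq})]_{p,q=1}^n\in\mathbb S^n$. *)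

(* Defs.v *)
From mathcomp Require Import all_boot all_order all_algebra.
From mathcomp Require Export mxtens.
From mathcomp Require Import all_classical all_reals all_analysis.

Set Implicit Arguments.
Unset Strict Implicit.
Unset Printing Implicit Defensive.

Import Order.TTheory GRing.Theory Num.Theory.
Local Open Scope classical_set_scope.
Local Open Scope ring_scope.

Definition argmin (T : Type) (R : realType) (D : set T) (f : T -> R) : set T :=
  [set x | D x /\ forall y, D y -> f x <= f y].

Section SymmetricMatrices.
Variable R : realType.

Definition psdmx d (M : 'M[R]_d) : Prop :=
  M^T = M /\ forall v : 'cV[R]_d, 0 <= (v^T *m M *m v) 0 0.

Definition pdmx d (M : 'M[R]_d) : Prop :=
  M^T = M /\ forall v : 'cV[R]_d, v != 0 -> 0 < (v^T *m M *m v) 0 0.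

(* The spectral functional calculus: f(U^T diag(d) U) = U^T diag(f(d)) U for
   orthogonal U.  The right-hand side does not depend on the diagonalization
   (symfunE below); the default value 0 is only taken when the matrix is not
   orthogonally diagonalizable, i.e. not symmetric. *)
Definition symfun (f : R -> R) d (M : 'M[R]_d) : 'M[R]_d :=
  xget 0 [set N | exists U (e : 'rV[R]_d),
    [/\ U^T *m U = 1%:M, M = U^T *m diag_mx e *m U
      & N = U^T *m diag_mx (map_mx f e) *m U]].

Lemma symfunE (f : R -> R) d (U : 'M[R]_d) (e : 'rV[R]_d) :
  U^T *m U = 1%:M ->
  symfun f (U^T *m diag_mx e *m U) = U^T *m diag_mx (map_mx f e) *m U.
Proof.
move=> UU; apply: xget_unique; first by exists U, e.
move=> _ [V [g [VV EM ->]]].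
have UU' := mulmx1C UU; have VV' := mulmx1C VV.
have comm : diag_mx e *m (U *m V^T) = U *m V^T *m diag_mx g.
  have := congr1 (fun X => U *m X *m V^T) EM.
  by rewrite /= !mulmxA UU' mul1mx -!mulmxA VV' mulmx1.
have commf : diag_mx (map_mx f e) *m (U *m V^T)
    = U *m V^T *m diag_mx (map_mx f g).
  move: (U *m V^T) comm => W comm.
  apply/matrixP => i j; have := congr1 (fun X : 'M[R]_d => X i j) comm.
  rewrite /= !mul_diag_mx !mul_mx_diag !mxE.
  have [->|nz] := eqVneq (W i j) 0; first by rewrite !mulr0 !mul0r.
  by rewrite [W i j * _]mulrC => /(mulIf nz) ->; rewrite mulrC.
have := congr1 (fun X => U^T *m X *m V) commf.
rewrite /= !mulmxA UU mul1mx -!mulmxA VV mulmx1 => ->.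
by rewrite !mulmxA.
Qed.

Definition mxexp d (M : 'M[R]_d) : 'M[R]_d := symfun (@expR R) M.
Definition mxlog d (M : 'M[R]_d) : 'M[R]_d := symfun (@ln R) M.
(* M^(-1/2) *)
Definition invsqrtmx d (M : 'M[R]_d) : 'M[R]_d :=
  symfun (fun x => (Num.sqrt x)^-1) M.

Definition normF d (M : 'M[R]_d) : R :=
  Num.sqrt (\sum_i \sum_j M i j ^+ 2).

(* G^(-1/2) H G^(-1/2) *)
Definition whiten d (G H : 'M[R]_d) : 'M[R]_d :=
  invsqrtmx G *m H *m invsqrtmx G.

Definition dAI d (G0 G1 : 'M[R]_d) : R := normF (mxlog (whiten G0 G1)).

Definition geneigenvalues d (G H : 'M[R]_d) : set R :=
  [set l | exists2 v : 'cV[R]_d, v != 0 & H *m v = l *: (G *m v)].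

(* kappa G H is kappa(G^-1 H).  For G, H positive definite and 0 < d the set
   is finite and nonempty, so sup and inf are its maximum and minimum. *)
Definition kappa d (G H : 'M[R]_d) : R :=
  sup (geneigenvalues G H) / inf (geneigenvalues G H).

Definition eigmax d (S : 'M[R]_d) : R := sup [set a | eigenvalue S a].
Definition eigmin d (S : 'M[R]_d) : R := inf [set a | eigenvalue S a].

End SymmetricMatrices.

Section Kronecker.
Variable R : realType.

(* With mxtens_index (p, i) = p * m + i, entry (p, i), (q, j) of B *t A is
   B p q * A i j, i.e. block (p, q) of B *t A is B p q *: A. *)
Definition kron m n : set 'M[R]_(n * m) :=
  [set G | exists (A : 'M[R]_m) (B : 'M[R]_n),
    [/\ pdmx A, pdmx B & G = B *t A]].
Arguments kron : clear implicits.

Definition mxblk m n (L : 'M[R]_(n * m)) (p q : 'I_n) : 'M[R]_m :=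
  \matrix_(i, j) L (mxtens_index (p, i)) (mxtens_index (q, j)).

Definition ptraceB m n (L : 'M[R]_(n * m)) : 'M[R]_m := \sum_p mxblk L p p.

Definition ptraceA m n (L : 'M[R]_(n * m)) : 'M[R]_n :=
  \matrix_(p, q) \tr (mxblk L p q).

(* The set of affine-invariant nearest points of K_{m,n} to M, which is the
   singleton of the projection of M when M is positive definite. *)
Definition kron_nearest m n (M : 'M[R]_(n * m)) : set 'M[R]_(n * m) :=
  argmin (kron m n) (fun G => dAI M G).

(* The matrices eigenspace S _ and Qp, Qm are compared through row spaces;
   S, Qp and Qm being symmetric, these are the column ranges. *)
Definition trace_balanced m n (S : 'M[R]_(n * m)) : Prop :=
  exists Qp Qm : 'M[R]_(n * m),
    [/\ psdmx Qp /\ psdmx Qm,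
        \tr Qp = 1 /\ \tr Qm = 1,
        (Qp <= eigenspace S (eigmax S))%MS /\
        (Qm <= eigenspace S (eigmin S))%MS,
        ptraceB (Qm - Qp) = 0
      & ptraceA (Qm - Qp) = 0].

End Kronecker.
Arguments kron {R} m n.

(* Main.v *)
Require Import Defs.
From mathcomp Require Import all_boot all_order all_algebra.
From mathcomp Require Import fingroup perm complex.
From mathcomp Require Import all_classical all_reals all_analysis.
From mathcomp Require Import ring lra.

(** The affine-invariant distance and the condition number are both read off from
    the generalized eigenvalues of a pair of forms, hence invariant under
    congruence.  Congruence by the inverse square root of a Kronecker matrix
    preserves the Kronecker family, so the nearest point may be assumed to be the
    identity and [H] to be [S] (kron_nearest_whiten).  The tangent space of the
    family at the identity consists of the sums [B *t 1 + 1 *t A], and the partial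
    traces are the adjoints of its two embeddings; also [log G] is tangent for
    every [G] in the family (kron_log).

    Optimality, part (i).  The function [ln (kappa G S)] is geodesically convex,
    and the differences [Qm - Qp] of densities on the extreme eigenspaces are its
    subgradients at the identity; as a functional on the tangent space such a
    difference vanishes exactly when both its partial traces do.  If a balanced
    pair exists, testing the extreme eigenvalues on it and applying Jensen's
    inequality gives a global lower bound (trace_balanced_min).  If none exists,
    the compact convex set of partial traces of [Qm - Qp] avoids the origin, its
    point closest to the origin is a separating tangent direction
    (unbalanced_direction), and a first order perturbation argument shows that the
    condition number decreases along that direction (kappa_descent).

    Part (ii) holds because a simple eigenvalue carries a single density
    (simple_density).

    Part (iii) uses that the nearest point is stationary: both partial traces of
    [log S] vanish (nearest_ptrace_log).  With two eigenvalues [log S] is an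
    affine function of [S], and so are the two spectral projectors; their partial
    traces are therefore scalar, and equal once normalized
    (balanced_two_eigenvalues).  The derivative of the squared distance is never
    taken: moving along [1 + t Pi] with [Pi] a projector, a pointwise upper bound
    for the squared logarithm summed against squared overlaps of eigenbases is
    enough (projector_stationary).

    Part (iv).  The logarithm of [H] has vanishing partial traces, that is, it is
    orthogonal to [log G] for every [G] in the family.  Nonpositive curvature of
    the cone then makes the identity the only nearest point, the side of a triangle
    opposite to a right angle being the longest; the finite dimensional form of
    this fact needed here is right_angle_comparison, proved by comparing leading
    principal minors along the flag of eigenspaces of [log H].  The condition
    numbers are those of pairs of diagonal matrices. *)

Set Implicit Arguments.
Unset Strict Implicit.
Unset Printing Implicit Defensive.

Import Order.TTheory GRing.Theory Num.Theory.
Local Open Scope classical_set_scope.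
Local Open Scope ring_scope.

Local Notation qf M v := ((v^T *m M *m v) (0 : 'I_1) (0 : 'I_1)).

(** * Orthogonal diagonalization of real symmetric matrices *)

Section Spectral.
Variable R : realType.

(** Over the complex numbers the matrix is Hermitian, so its eigenvalues are
    real, and they are roots of the real characteristic polynomial. *)
Lemma sym_eigenvalue d (M : 'M[R]_d.+1) : M^T = M ->
  exists a, eigenvalue M a.
Proof.
move=> symM; pose f := real_complex R.
pose MC := map_mx f M.
have hM : MC \is hermsymmx.
  apply: realsym_hermsym.
    apply/is_hermitianmxP; rewrite expr0 scale1r map_mx_id //.
    apply/matrixP => i j; rewrite !mxE; congr (_ %:C)%C.
    by move/matrixP: symM => /(_ j i); rewrite mxE.
  by apply/mxOverP => i j; rewrite !mxE complex_real.
have /mxOverP/(_ 0 0)/complex_realP [a Ea] := hermitian_spectral_diag_real hM.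
exists a; rewrite eigenvalue_root_char -(fmorph_root f) map_char_poly.
rewrite -eigenvalue_root_char; apply/eigenvalueP.
exists (row 0 (spectralmx MC)); last first.
  by apply: contraTneq (spectral_unit MC) => /(congr1 (mulmx^~ (invmx (spectralmx MC))))
     E; apply/negP => u; move: E; rewrite mul0mx -row_mul mulmxV // => /rowP /(_ 0) /eqP;
     rewrite !mxE oner_eq0.
have /hermitian_normalmx /orthomx_spectralP E := hM.
rewrite -row_mul -/MC [X in _ *m X]E !mulmxA mulmxV ?spectral_unit // mul1mx.
by rewrite row_mul row_diag_mx -scalemxAl -rowE Ea.
Qed.

Lemma sqnormE d (v : 'cV[R]_d) : (v^T *m v) 0 0 = \sum_i v i 0 ^+ 2.
Proof. by rewrite mxE; apply: eq_bigr => i _; rewrite mxE. Qed.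

Lemma sqnorm_ge0 d (v : 'cV[R]_d) : 0 <= (v^T *m v) 0 0.
Proof. by rewrite sqnormE; apply: sumr_ge0 => i _; rewrite sqr_ge0. Qed.

Lemma sqnorm_eq0 d (v : 'cV[R]_d) : ((v^T *m v) 0 0 == 0) = (v == 0).
Proof.
apply/eqP/eqP => [|->]; last by rewrite mulmx0 mxE.
rewrite sqnormE => /eqP; rewrite psumr_eq0 => [/allP v0|i _]; last exact: sqr_ge0.
apply/colP => i; have := v0 i (mem_index_enum _).
by rewrite sqrf_eq0 mxE => /eqP.
Qed.

(** The Householder reflection that exchanges [v] with the first basis vector. *)
Lemma unit_row_orthogonal d (v : 'rV[R]_d.+1) : v *m v^T = 1%:M ->
  exists2 Q : 'M[R]_d.+1, Q^T = Q & Q *m Q = 1%:M /\ row 0 Q = v.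
Proof.
move=> vv; pose e : 'rV[R]_d.+1 := delta_mx 0 0.
have ee : e *m e^T = 1%:M by apply/matrixP => i j; rewrite trmx_delta mul_delta_mx !ord1 !mxE.
have [ve|nve] := eqVneq v e.
  exists 1%:M; rewrite ?trmx1 //; split; first by rewrite mul1mx.
  by rewrite rowE mulmx1.
have [w Ew] : exists w, w = e - v by exists (e - v).
pose c := (e *m v^T) 0 0.
have Ec : e *m v^T = c%:M by rewrite [LHS]mx11_scalar.
have Ec' : v *m e^T = c%:M by rewrite -[LHS]trmxK trmx_mul trmxK Ec tr_scalar_mx.
have ww : w *m w^T = (2 - 2 * c)%:M.
  rewrite Ew raddfB /= mulmxBl !mulmxBr ee vv Ec Ec'.
  by apply/matrixP => i j; rewrite !mxE !ord1 /=; ring.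
have nz : 2 - 2 * c != 0.
  apply: contra_neq nve => E; move: ww; rewrite E => /(congr1 (fun X : 'M[R]_1 => X 0 0)).
  rewrite [RHS]mxE mul0rn -{1}[w]trmxK => /eqP.
  by rewrite sqnorm_eq0 trmx_eq0 Ew subr_eq0 => /eqP.
pose Q := 1%:M - (2 / (2 - 2 * c)) *: (w^T *m w).
have symQ : Q^T = Q by rewrite /Q raddfB /= trmx1 linearZ /= trmx_mul trmxK.
exists Q => //; split.
  have BB : w^T *m w *m (w^T *m w) = (2 - 2 * c) *: (w^T *m w).
    by rewrite -mulmxA [w *m _]mulmxA ww mul_scalar_mx -scalemxAr.
  rewrite /Q mulmxBl mul1mx mulmxBr mulmx1 -scalemxAl -scalemxAr BB !scalerA.
  by apply/matrixP => i j; rewrite !mxE; move: (\sum_j0 _) => x; field.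
rewrite rowE /Q mulmxBr mulmx1 -scalemxAr mulmxA [in w^T]Ew raddfB /= -/e mulmxBr ee Ec.
rewrite -(raddfB (@scalar_mx R 1)) /= mul_scalar_mx scalerA.
have -> : 2 / (2 - 2 * c) * (1 - c) = 1 by field.
by rewrite scale1r Ew opprB addrC subrK.
Qed.

(** Conjugation by a reflection carrying the first basis vector to a unit
    eigenvector splits off a block of size one; induct on the other block. *)
Theorem sym_spectral d (M : 'M[R]_d) : M^T = M ->
  exists (U : 'M[R]_d) (e : 'rV[R]_d),
    U^T *m U = 1%:M /\ M = U^T *m diag_mx e *m U.
Proof.
elim: d M => [|d IH] M symM.
  by exists 1%:M, 0; split; apply/matrixP => -[].
have [a /eigenvalueP [x xM nx]] := sym_eigenvalue symM.
pose q := (x *m x^T) 0 0.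
have q_gt0 : 0 < q.
  by rewrite lt_def /q -{1 3}[x]trmxK sqnorm_eq0 sqnorm_ge0 trmx_eq0 nx.
pose v := (Num.sqrt q)^-1 *: x.
have vv : v *m v^T = 1%:M.
  rewrite /v linearZ /= -scalemxAl -scalemxAr [x *m _]mx11_scalar -/q scalerA.
  rewrite -invfM -expr2 sqr_sqrtr ?ltW // scale_scalar_mx mulVf //.
  by rewrite gt_eqF.
have vM : v *m M = a *: v by rewrite -scalemxAl xM !scalerA mulrC.
have [Q symQ [QQ rQ]] := unit_row_orthogonal vv.
have [N NE] : exists N, N = Q *m M *m Q by exists (Q *m M *m Q).
have symN : N^T = N by rewrite NE !trmx_mul symQ symM mulmxA.
have rN : row 0 N = a *: delta_mx 0 0.
  rewrite NE !row_mul rQ vM -scalemxAl -rQ -row_mul QQ.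
  by rewrite rowE mulmx1.
pose N' : 'M[R]_(1 + d) := N.
have symN' : (drsubmx N')^T = drsubmx N' by rewrite trmx_drsub; congr drsubmx.
have EN : N = block_mx a%:M 0 0 (drsubmx N') :> 'M[R]_(1 + d).
  rewrite -[LHS](submxK N'); congr block_mx.
  - apply/matrixP => i j; rewrite !mxE !ord1 /=.
    have /rowP/(_ 0) := rN; rewrite !mxE eqxx /= mulr1 => <-.
    by congr (N _ _); apply: val_inj.
  - apply/matrixP => i j; rewrite !mxE !ord1 /=.
    have /rowP/(_ (rshift 1 j)) := rN; rewrite !mxE /= mulr0 => <-.
    by congr (N _ _); apply: val_inj.
  - apply/matrixP => i j; rewrite !mxE !ord1 /=.
    have /rowP/(_ (rshift 1 i)) := rN; rewrite !mxE /= mulr0 -[in X in X -> _]symN mxE => <-.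
    by congr (N _ _); apply: val_inj.
have [U [e [UU EU]]] := IH _ symN'.
pose V : 'M[R]_(1 + d) := block_mx 1%:M 0 0 U.
have VV : V^T *m V = 1%:M.
  rewrite /V tr_block_mx mulmx_block trmx1 !trmx0 !(mul0mx, mulmx0, mul1mx).
  by rewrite !(addr0, add0r) UU -scalar_mx_block.
exists (V *m Q), (row_mx a%:M e : 'rV[R]_(1 + d)); split.
  by rewrite trmx_mul symQ mulmxA -[Q *m _ *m _]mulmxA VV mulmx1 QQ.
have -> : M = Q *m N *m Q by rewrite NE !mulmxA QQ mul1mx -mulmxA QQ mulmx1.
rewrite trmx_mul symQ !mulmxA; congr (_ *m _); rewrite -!mulmxA; congr (_ *m _).
have ED : diag_mx (row_mx a%:M e) = block_mx a%:M 0 0 (diag_mx e) :> 'M[R]_(1 + d).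
  rewrite diag_mx_row; congr block_mx.
  by apply/matrixP => i j; rewrite !mxE !ord1 !eqxx.
have EV : V^T = block_mx 1%:M 0 0 U^T.
  by rewrite /V tr_block_mx !trmx0 trmx1.
have EB : V^T *m (diag_mx (row_mx a%:M e) *m V)
    = block_mx a%:M 0 0 (drsubmx N') :> 'M[R]_(1 + d).
  rewrite EV ED /V.
  rewrite !mulmx_block !(mul0mx, mulmx0, mul1mx, mulmx1, addr0, add0r).
  by rewrite mulmxA -EU.
by rewrite [LHS]EN; exact: esym EB.
Qed.

End Spectral.

(** * Positive definite pencils *)

Section PositiveDefinite.
Variable R : realType.

Lemma qf_diag d (e : 'rV[R]_d) (v : 'cV[R]_d) :
  qf (diag_mx e) v = \sum_i e 0 i * v i 0 ^+ 2.
Proof.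
rewrite mul_mx_diag mxE; apply: eq_bigr => i _; rewrite !mxE.
by rewrite mulrAC mulrC expr2.
Qed.

Lemma qf_congr d k (M : 'M[R]_d) (W : 'M[R]_(d, k)) (v : 'cV[R]_k) :
  qf (W^T *m M *m W) v = qf M (W *m v).
Proof. by rewrite trmx_mul !mulmxA. Qed.

Lemma qf_scale d (M : 'M[R]_d) a (v : 'cV[R]_d) : qf (a *: M) v = a * qf M v.
Proof. by rewrite -scalemxAr -scalemxAl mxE. Qed.

Lemma qfD d (M N : 'M[R]_d) (v : 'cV[R]_d) : qf (M + N) v = qf M v + qf N v.
Proof. by rewrite mulmxDr mulmxDl mxE. Qed.

Lemma qf1 d (v : 'cV[R]_d) : qf 1%:M v = (v^T *m v) 0 0.
Proof. by rewrite mulmx1. Qed.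

Lemma sqnorm_gt0 d (v : 'cV[R]_d) : v != 0 -> 0 < (v^T *m v) 0 0.
Proof. by move=> nv; rewrite lt_def sqnorm_eq0 nv sqnorm_ge0. Qed.

Lemma pd_diag d (e : 'rV[R]_d) : (forall i, 0 < e 0 i) -> pdmx (diag_mx e).
Proof.
move=> e_gt0; split=> [|v nv]; first exact: tr_diag_mx.
rewrite qf_diag lt_def sumr_ge0 ?andbT => [|i _]; last first.
  by rewrite mulr_ge0 ?sqr_ge0 // ltW.
apply: contra_neq nv => /eqP; rewrite psumr_eq0 => [/allP v0|i _]; last first.
  by rewrite mulr_ge0 ?sqr_ge0 // ltW.
apply/colP => i; have := v0 i (mem_index_enum _).
by rewrite mulf_eq0 gt_eqF //= sqrf_eq0 mxE => /eqP.
Qed.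

Lemma pd1 d : pdmx (1%:M : 'M[R]_d).
Proof.
by split=> [|v nv]; rewrite ?trmx1 // qf1 sqnorm_gt0.
Qed.

Lemma psd_diag d (e : 'rV[R]_d) : (forall i, 0 <= e 0 i) -> psdmx (diag_mx e).
Proof.
move=> e_ge0; split=> [|v]; first exact: tr_diag_mx.
by rewrite qf_diag sumr_ge0 // => i _; rewrite mulr_ge0 ?sqr_ge0.
Qed.

Lemma pd_psd d (M : 'M[R]_d) : pdmx M -> psdmx M.
Proof.
case=> sM pM; split=> // v; have [->|/pM/ltW //] := eqVneq v 0.
by rewrite mulmx0 mxE.
Qed.

Lemma pd_congr d (W M : 'M[R]_d) :
  W \in unitmx -> pdmx M -> pdmx (W^T *m M *m W).
Proof.
move=> uW [sM pM]; split=> [|v nv]; first by rewrite !trmx_mul trmxK sM mulmxA.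
rewrite qf_congr; apply: pM; apply: contra_neq nv => E.
by rewrite -[v](mulKmx uW) E mulmx0.
Qed.

Lemma psd_congr d k (W : 'M[R]_(d, k)) (M : 'M[R]_d) :
  psdmx M -> psdmx (W^T *m M *m W).
Proof.
by move=> [sM pM]; split=> [|v]; rewrite ?qf_congr // !trmx_mul trmxK sM mulmxA.
Qed.

Lemma orthogonal_unit d (U : 'M[R]_d) : U^T *m U = 1%:M -> U \in unitmx.
Proof. by case/mulmx1_unit. Qed.

Lemma orthoK d (U : 'M[R]_d) : U^T *m U = 1%:M ->
  forall k (A : 'M[R]_(k, d)), A *m U *m U^T = A.
Proof. by move=> /mulmx1C UU k A; rewrite -mulmxA UU mulmx1. Qed.

Lemma orthoKT d (U : 'M[R]_d) : U^T *m U = 1%:M ->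
  forall k (A : 'M[R]_(k, d)), A *m U^T *m U = A.
Proof. by move=> UU k A; rewrite -mulmxA UU mulmx1. Qed.

Lemma spectral_qf d (U M : 'M[R]_d) (e : 'rV[R]_d) i :
  U^T *m U = 1%:M -> M = U^T *m diag_mx e *m U ->
  qf M (U^T *m (delta_mx i 0 : 'cV[R]_d)) = e 0 i.
Proof.
move=> UU ->; rewrite -qf_congr trmxK !mulmxA 2!(orthoK UU) qf_diag (bigD1 i) //= big1 => [|j ji].
  by rewrite !mxE !eqxx expr1n mulr1 addr0.
by rewrite !mxE (negPf ji) expr0n mulr0.
Qed.

Lemma orthogonal_col_neq0 d (U : 'M[R]_d) i : U^T *m U = 1%:M ->
  U^T *m (delta_mx i 0 : 'cV[R]_d) != 0.
Proof.
move=> UU; rewrite -sqnorm_eq0 trmx_mul trmxK mulmxA (orthoK UU) trmx_delta mul_delta_mx mxE !eqxx.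
exact: oner_neq0.
Qed.

Lemma pd_spectral d (M : 'M[R]_d) : pdmx M ->
  exists (U : 'M[R]_d) (e : 'rV[R]_d),
    [/\ U^T *m U = 1%:M, M = U^T *m diag_mx e *m U & forall i, 0 < e 0 i].
Proof.
move=> [sM pM]; have [U [e [UU EM]]] := sym_spectral sM.
exists U, e; split=> // i; rewrite -(spectral_qf i UU EM); apply: pM.
exact: orthogonal_col_neq0.
Qed.

Lemma psd_spectral d (M : 'M[R]_d) : psdmx M ->
  exists (U : 'M[R]_d) (e : 'rV[R]_d),
    [/\ U^T *m U = 1%:M, M = U^T *m diag_mx e *m U & forall i, 0 <= e 0 i].
Proof.
move=> [sM pM]; have [U [e [UU EM]]] := sym_spectral sM.
by exists U, e; split=> // i; rewrite -(spectral_qf i UU EM); apply: pM.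
Qed.

Lemma spectral_tr d k (U : 'M[R]_(d, k)) (e : 'rV[R]_d) :
  (U^T *m diag_mx e *m U)^T = U^T *m diag_mx e *m U.
Proof. by rewrite !trmx_mul trmxK tr_diag_mx mulmxA. Qed.

Lemma spectral_mul d (U : 'M[R]_d) (e f : 'rV[R]_d) : U^T *m U = 1%:M ->
  (U^T *m diag_mx e *m U) *m (U^T *m diag_mx f *m U)
  = U^T *m diag_mx (\row_i (e 0 i * f 0 i)) *m U.
Proof.
move=> UU; by rewrite -mulmx_diag !mulmxA (orthoK UU).
Qed.

Lemma spectral_const d (U : 'M[R]_d) (e : 'rV[R]_d) : U^T *m U = 1%:M ->
  (forall i, e 0 i = 1) -> U^T *m diag_mx e *m U = 1%:M.
Proof.
move=> UU e1; suff -> : diag_mx e = 1%:M by rewrite mulmx1.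
by apply/matrixP => i j; rewrite !mxE e1.
Qed.

Lemma invsqrtmxP d (M : 'M[R]_d) : pdmx M ->
  (invsqrtmx M)^T = invsqrtmx M /\ invsqrtmx M *m M *m invsqrtmx M = 1%:M.
Proof.
move=> /pd_spectral [U [e [UU -> e_gt0]]]; rewrite /invsqrtmx symfunE //.
split; first exact: spectral_tr.
rewrite !spectral_mul // spectral_const // => i; rewrite !mxE.
rewrite mulrAC -invfM -expr2 sqr_sqrtr ?ltW // mulVf // gt_eqF //.
Qed.

Lemma invsqrtmx_unit d (M : 'M[R]_d) : pdmx M -> invsqrtmx M \in unitmx.
Proof. by move=> /invsqrtmxP [_ /mulmx1_unit []]. Qed.

Lemma pd_unit d (M : 'M[R]_d) : pdmx M -> M \in unitmx.
Proof.
move=> /invsqrtmxP [_ /mulmx1_unit [+ _]]; by rewrite unitmx_mul => /andP[].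
Qed.

Lemma whiten_pd d (G H : 'M[R]_d) : pdmx G -> pdmx H -> pdmx (whiten G H).
Proof.
move=> pG pH; have [hT _] := invsqrtmxP pG.
by rewrite /whiten -{1}hT; apply: pd_congr => //; exact: invsqrtmx_unit.
Qed.

(** Simultaneous diagonalization of two forms; [e] lists the generalized
    eigenvalues.  Both the distance and the condition number can be read off from
    any such pair, and congruence only changes [W]. *)
Definition pencil d (G H W : 'M[R]_d) (e : 'rV[R]_d) :=
  W^T *m G *m W = 1%:M /\ W^T *m H *m W = diag_mx e.

Lemma pencil_unit d (G H W : 'M[R]_d) e : pencil G H W e -> W \in unitmx.
Proof. by case=> /mulmx1_unit []. Qed.

Lemma pencil_gt0 d (G H W : 'M[R]_d) e i :
  pdmx H -> pencil G H W e -> 0 < e 0 i.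
Proof.
move=> pH P; have uW := pencil_unit P; have [_ pD] := pd_congr uW pH.
have [_ E] := P; move: (pD); rewrite E => {}pD.
have U1 : (1%:M : 'M[R]_d)^T *m 1%:M = 1%:M by rewrite trmx1 mulmx1.
have D1 : diag_mx e = (1%:M : 'M[R]_d)^T *m diag_mx e *m 1%:M.
  by rewrite trmx1 mul1mx mulmx1.
by rewrite -(spectral_qf i U1 D1); apply: pD; exact: orthogonal_col_neq0.
Qed.

Lemma pencil_exists d (G H : 'M[R]_d) : pdmx G -> pdmx H ->
  exists W e, pencil G H W e.
Proof.
move=> pG pH; have [hT hGh] := invsqrtmxP pG; set h := invsqrtmx G in hT hGh.
have [U [e [UU E _]]] := pd_spectral (whiten_pd pG pH).
exists (h *m U^T), e; rewrite /pencil trmx_mul trmxK hT; split.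
  by rewrite !mulmxA -[U *m h *m G *m h]mulmxA -[U *m h *m (G *m h)]mulmxA
     [h *m (G *m h)]mulmxA hGh mulmx1 (mulmx1C UU).
rewrite !mulmxA -[U *m h *m H *m h]mulmxA -[U *m h *m (H *m h)]mulmxA.
rewrite [h *m (H *m h)]mulmxA -/(whiten G H) E !mulmxA (mulmx1C UU) mul1mx.
by rewrite -mulmxA (mulmx1C UU) mulmx1.
Qed.

Lemma pencil_congr d (C G H W : 'M[R]_d) e : C \in unitmx ->
  pencil G H W e -> pencil (C^T *m G *m C) (C^T *m H *m C) (invmx C *m W) e.
Proof.
move=> uC [EG EH].
have E (X : 'M[R]_d) :
    (invmx C *m W)^T *m (C^T *m X *m C) *m (invmx C *m W) = W^T *m X *m W.
  rewrite trmx_mul trmx_inv !mulmxA mulmxKV ?unitmx_tr //.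
  by rewrite -[_ *m C *m invmx C]mulmxA mulmxV // mulmx1.
by split; rewrite E.
Qed.

Lemma normF_sqr d (M : 'M[R]_d) : normF M = Num.sqrt (\tr (M^T *m M)).
Proof.
congr Num.sqrt; rewrite /mxtrace exchange_big; apply: eq_bigr => i _ /=.
by rewrite mxE; apply: eq_bigr => j _; rewrite mxE.
Qed.

Lemma normF_spectral d (U : 'M[R]_d) (e : 'rV[R]_d) : U^T *m U = 1%:M ->
  normF (U^T *m diag_mx e *m U) = Num.sqrt (\sum_i e 0 i ^+ 2).
Proof.
move=> UU; rewrite normF_sqr; congr Num.sqrt.
rewrite spectral_tr spectral_mul // mxtrace_mulC mulmxA.
by rewrite (mulmx1C UU) mul1mx mxtrace_diag; apply: eq_bigr => i _; rewrite mxE.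
Qed.

(** The matrix [W^T *m G *m invsqrtmx G] is orthogonal and diagonalizes the
    whitened matrix, with the same eigenvalues [e]. *)
Lemma dAI_pencil d (G H W : 'M[R]_d) e : pdmx G -> pencil G H W e ->
  dAI G H = Num.sqrt (\sum_i ln (e 0 i) ^+ 2).
Proof.
move=> pG P; have [EG EH] := P; have uW := pencil_unit P.
have [hT hGh] := invsqrtmxP pG; rewrite /dAI /whiten.
set h := invsqrtmx G in hT hGh *; have [sG _] := pG.
have GWW : G *m W *m W^T = 1%:M by apply: mulmx1C; rewrite mulmxA.
have WWG : W *m W^T *m G = 1%:M by rewrite -mulmxA; apply: mulmx1C.
pose U := W^T *m G *m h.
have UT : U^T = h *m G *m W by rewrite /U !trmx_mul trmxK hT sG mulmxA.
have UU : U^T *m U = 1%:M.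
  rewrite UT /U !mulmxA -[h *m G *m W *m _]mulmxA -[h *m G *m (W *m _)]mulmxA.
  by rewrite [G *m (W *m _)]mulmxA GWW mulmx1 hGh.
have -> : h *m H *m h = U^T *m diag_mx e *m U.
  rewrite -EH UT /U !mulmxA -[h *m G *m W *m _]mulmxA -[h *m G *m _]mulmxA.
  rewrite [G *m (W *m _)]mulmxA GWW mulmx1 -!mulmxA; congr (_ *m (_ *m _)).
  by rewrite !mulmxA WWG mul1mx.
rewrite /mxlog symfunE // normF_spectral //; congr Num.sqrt.
by apply: eq_bigr => i _; rewrite mxE.
Qed.

Lemma dAI_congr d (C G H : 'M[R]_d) : C \in unitmx -> pdmx G -> pdmx H ->
  dAI (C^T *m G *m C) (C^T *m H *m C) = dAI G H.
Proof.
move=> uC pG pH; have [W [e P]] := pencil_exists pG pH.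
by rewrite (dAI_pencil pG P) (dAI_pencil (pd_congr uC pG) (pencil_congr uC P)).
Qed.

(** ** Extreme generalized eigenvalues *)

Lemma geneigenvalues_pencil d (G H W : 'M[R]_d) e : pencil G H W e ->
  geneigenvalues G H = [set e 0 i | i in [set: 'I_d]].
Proof.
move=> P; have uW := pencil_unit P; have [EG EH] := P.
rewrite eqEsubset; split=> [l [v nv Hv]|_ [i _ <-]].
  have [y Ev] : exists y, v = W *m y by exists (invmx W *m v); rewrite mulKVmx.
  have ny : y != 0 by apply: contra_neq nv; rewrite Ev => ->; rewrite mulmx0.
  have := congr1 (mulmx W^T) Hv; rewrite -scalemxAr Ev !mulmxA EH EG mul1mx.
  have [i yi] : exists i, y i 0 != 0.
    apply/existsP; apply: contra_neqT ny; rewrite negb_exists => /forallP y0.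
    by apply/colP => i; have := y0 i; rewrite negbK [RHS]mxE => /eqP.
  move=> /colP/(_ i); rewrite mul_diag_mx !mxE => /(mulIf yi) El.
  by exists i.
exists (W *m delta_mx i 0).
  apply/negP => /eqP/(congr1 (mulmx (invmx W))); rewrite mulKmx // mulmx0.
  by move=> /colP/(_ i) /eqP; rewrite !mxE !eqxx oner_eq0.
apply: (can_inj (mulKmx (_ : W^T \in unitmx))); first by rewrite unitmx_tr.
rewrite -scalemxAr !mulmxA EG EH mul1mx mul_diag_mx.
apply/colP => j; rewrite !mxE; case: eqP => [->|] //=; rewrite ?mulr1 ?mulr0 //.
Qed.

Lemma geneigenvalues_congr d (C G H : 'M[R]_d) : C \in unitmx ->
  pdmx G -> pdmx H ->
  geneigenvalues (C^T *m G *m C) (C^T *m H *m C) = geneigenvalues G H.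
Proof.
move=> uC pG pH; have [W [e P]] := pencil_exists pG pH.
by rewrite (geneigenvalues_pencil P) (geneigenvalues_pencil (pencil_congr uC P)).
Qed.

Lemma kappa_congr d (C G H : 'M[R]_d) : C \in unitmx -> pdmx G -> pdmx H ->
  kappa (C^T *m G *m C) (C^T *m H *m C) = kappa G H.
Proof. by move=> uC pG pH; rewrite /kappa geneigenvalues_congr. Qed.

Lemma sup_max (A : set R) a : A a -> (forall b, A b -> b <= a) -> sup A = a.
Proof.
move=> Aa ub; apply/eqP; rewrite eq_le; apply/andP; split.
  by apply: ge_sup; [exists a | move=> b /ub].
by apply: ub_le_sup => //; exists a => b /ub.
Qed.

Lemma inf_min (A : set R) a : A a -> (forall b, A b -> a <= b) -> inf A = a.
Proof.
move=> Aa lb; apply/eqP; rewrite eq_le; apply/andP; split.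
  by apply: ge_inf => //; exists a => b /lb.
by apply: lb_le_inf; [exists a | move=> b /lb].
Qed.

(** In a pencil basis both forms are diagonal, so the extreme entries are at the
    same time generalized eigenvalues and constants in a comparison of the forms.
    Upper and lower bounds for [kappa] all go through this comparison. *)
Lemma extreme_geneigenvalues d (G H : 'M[R]_d) : (0 < d)%N ->
  pdmx G -> pdmx H ->
  [/\ geneigenvalues G H (sup (geneigenvalues G H)),
      geneigenvalues G H (inf (geneigenvalues G H)),
      0 < inf (geneigenvalues G H) &
      forall v : 'cV[R]_d, inf (geneigenvalues G H) * qf G v <= qf H v
                <= sup (geneigenvalues G H) * qf G v].
Proof.
case: d G H => // d G H _ pG pH; have [W [e P]] := pencil_exists pG pH.
have uW := pencil_unit P; have [EG EH] := P.
rewrite (geneigenvalues_pencil P).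
case: (arg_maxP (P := predT) (fun i => e 0 i) (i0 := ord0)) => // i _ maxi.
case: (arg_minP (P := predT) (fun i => e 0 i) (i0 := ord0)) => // j _ minj.
have -> : sup [set e 0 i | i in [set: 'I_d.+1]] = e 0 i.
  by apply: sup_max => [|_ [k _ <-]]; [exists i | exact: maxi].
have -> : inf [set e 0 i | i in [set: 'I_d.+1]] = e 0 j.
  by apply: inf_min => [|_ [k _ <-]]; [exists j | exact: minj].
split; [by exists i | by exists j | exact: pencil_gt0 P |move=> v].
have -> : v = W *m (invmx W *m v) by rewrite mulKVmx.
move: (invmx W *m v) => y; rewrite -!qf_congr EG EH qf_diag qf1 sqnormE !mulr_sumr.
by apply/andP; split; apply: ler_sum => k _;
  rewrite ler_wpM2r ?sqr_ge0 //; [exact: minj | exact: maxi].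
Qed.

Lemma geneigenvalue_qf d (G H : 'M[R]_d) l : geneigenvalues G H l ->
  exists2 v : 'cV[R]_d, v != 0 & qf H v = l * qf G v.
Proof.
case=> v nv E; exists v => //.
by rewrite -!mulmxA E -scalemxAr mxE !mulmxA.
Qed.

Lemma geneigenvalue_le d (G H : 'M[R]_d) l b : pdmx G ->
  (forall v : 'cV[R]_d, qf H v <= b * qf G v) -> geneigenvalues G H l -> l <= b.
Proof.
move=> [_ pG] ub /geneigenvalue_qf [v nv E].
by have := ub v; rewrite E ler_pM2r // pG.
Qed.

Lemma geneigenvalue_ge d (G H : 'M[R]_d) l a : pdmx G ->
  (forall v : 'cV[R]_d, a * qf G v <= qf H v) -> geneigenvalues G H l -> a <= l.
Proof.
move=> [_ pG] lb /geneigenvalue_qf [v nv E].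
by have := lb v; rewrite E ler_pM2r // pG.
Qed.

Lemma kappa_gt0 d (G H : 'M[R]_d) : (0 < d)%N -> pdmx G -> pdmx H ->
  0 < kappa G H.
Proof.
move=> d_gt0 pG pH; have [gs gi i0 b] := extreme_geneigenvalues d_gt0 pG pH.
apply: divr_gt0 => //; apply: lt_le_trans i0 _.
by apply: geneigenvalue_le gi => // v; have /andP[] := b v.
Qed.

Lemma eigenvalue_geneigenvalues d (S : 'M[R]_d) : S^T = S ->
  [set a | eigenvalue S a] = geneigenvalues 1%:M S.
Proof.
move=> sS; rewrite eqEsubset; split=> [a /eigenvalueP [v Ev nv]|a [v nv Ev]].
  exists v^T; first by rewrite trmx_eq0.
  by rewrite mul1mx -[in LHS]sS -trmx_mul Ev linearZ.
apply/eigenvalueP; exists v^T; last by rewrite trmx_eq0.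
by rewrite -[in LHS]sS -trmx_mul Ev mul1mx linearZ.
Qed.

End PositiveDefinite.

(** * The Kronecker family and its partial traces *)

Section KroneckerAlgebra.
Variable R : realType.

Lemma sum_mxtens n m (F : 'I_(n * m) -> R) :
  \sum_k F k = \sum_p \sum_i F (mxtens_index (p, i)).
Proof.
rewrite pair_big /= (reindex (@mxtens_index n m)) /=; last first.
  by exists (@mxtens_unindex n m) => k _; rewrite (mxtens_indexK, mxtens_unindexK).
by apply: eq_bigr => -[].
Qed.

Lemma tensmx11 n m : (1%:M : 'M[R]_n) *t (1%:M : 'M[R]_m) = 1%:M.
Proof.
apply/matrixP => k l; case: (mxtens_indexP k) => p i; case: (mxtens_indexP l) => q j.
rewrite tensmxE !mxE (can_eq (@mxtens_indexK n m)) xpair_eqE.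
by case: (p == q); case: (i == j); rewrite ?mulr1 ?mul0r ?mulr0.
Qed.

Definition tensrow n m (b : 'rV[R]_n) (a : 'rV[R]_m) : 'rV[R]_(n * m) :=
  \row_k (b 0 (mxtens_unindex k).1 * a 0 (mxtens_unindex k).2).

Lemma tensrowE n m (b : 'rV[R]_n) (a : 'rV[R]_m) p i :
  tensrow b a 0 (mxtens_index (p, i)) = b 0 p * a 0 i.
Proof. by rewrite mxE mxtens_indexK. Qed.

Lemma diag_tens n m (b : 'rV[R]_n) (a : 'rV[R]_m) :
  diag_mx b *t diag_mx a = diag_mx (tensrow b a).
Proof.
apply/matrixP => k l; case: (mxtens_indexP k) => p i; case: (mxtens_indexP l) => q j.
rewrite tensmxE [RHS]mxE tensrowE !mxE (can_eq (@mxtens_indexK n m)) xpair_eqE.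
by case: (p == q); case: (i == j); rewrite ?mulr1n ?mulr0n ?mul0r ?mulr0.
Qed.

Lemma tens_spectral n m (V : 'M[R]_n) (W : 'M[R]_m) b a :
  (V^T *m diag_mx b *m V) *t (W^T *m diag_mx a *m W)
  = (V *t W)^T *m diag_mx (tensrow b a) *m (V *t W).
Proof. by rewrite trmx_tens -diag_tens !tensmx_mul. Qed.

Lemma tens_orthogonal n m (V : 'M[R]_n) (W : 'M[R]_m) :
  V^T *m V = 1%:M -> W^T *m W = 1%:M -> (V *t W)^T *m (V *t W) = 1%:M.
Proof. by move=> VV WW; rewrite trmx_tens tensmx_mul VV WW tensmx11. Qed.

Lemma pd_tens n m (B : 'M[R]_n) (A : 'M[R]_m) :
  pdmx B -> pdmx A -> pdmx (B *t A).
Proof.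
move=> /pd_spectral [V [b [VV -> b0]]] /pd_spectral [W [a [WW -> a0]]].
rewrite tens_spectral; apply: pd_congr; first exact/orthogonal_unit/tens_orthogonal.
by apply: pd_diag => k; case: (mxtens_indexP k) => p i; rewrite tensrowE mulr_gt0.
Qed.

Lemma kron_pd m n (G : 'M[R]_(n * m)) : kron m n G -> pdmx G.
Proof. by case=> A [B [pA pB ->]]; exact: pd_tens. Qed.

Lemma kron1 m n : kron m n (1%:M : 'M[R]_(n * m)).
Proof. by exists 1%:M, 1%:M; split; [exact: pd1.. | rewrite tensmx11]. Qed.

Lemma invsqrtmx_tens n m (B : 'M[R]_n) (A : 'M[R]_m) : pdmx B -> pdmx A ->
  invsqrtmx (B *t A) = invsqrtmx B *t invsqrtmx A.
Proof.
move=> /pd_spectral [V [b [VV -> b0]]] /pd_spectral [W [a [WW -> a0]]].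
rewrite tens_spectral /invsqrtmx !symfunE //; last exact: tens_orthogonal.
rewrite tens_spectral; congr (_ *m diag_mx _ *m _); apply/rowP => k.
case: (mxtens_indexP k) => p i.
by rewrite mxE !tensrowE !mxE sqrtrM ?invfM // ltW.
Qed.

Lemma kron_congr m n (B : 'M[R]_n) (A : 'M[R]_m) (G : 'M[R]_(n * m)) :
  B \in unitmx -> A \in unitmx -> kron m n G ->
  kron m n ((B *t A)^T *m G *m (B *t A)).
Proof.
move=> uB uA [A' [B' [pA pB ->]]].
exists (A^T *m A' *m A), (B^T *m B' *m B); split; try exact: pd_congr.
by rewrite trmx_tens !tensmx_mul.
Qed.

(** Congruence by the inverse square root of a Kronecker point moves that point
    to the identity and maps the whole family onto itself. *)
Lemma kron_whiten m n (P : 'M[R]_(n * m)) : kron m n P ->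
  exists2 C : 'M[R]_(n * m), C \in unitmx &
  [/\ C^T *m P *m C = 1%:M,
      forall H, whiten P H = C^T *m H *m C,
      forall G, kron m n G -> kron m n (C^T *m G *m C) &
      forall G, kron m n G -> exists2 G', kron m n G' & G = C^T *m G' *m C].
Proof.
move=> [A [B [pA pB EP]]]; have pP : pdmx P by rewrite EP; exact: pd_tens.
have [hT hPh] := invsqrtmxP pP.
exists (invsqrtmx P); first exact: invsqrtmx_unit.
have Eh : invsqrtmx P = invsqrtmx B *t invsqrtmx A by rewrite EP invsqrtmx_tens.
have uB := invsqrtmx_unit pB; have uA := invsqrtmx_unit pA.
split; first by rewrite hT.
- by move=> H; rewrite hT.
- by move=> G kG; rewrite Eh; apply: kron_congr.
move=> G kG; pose D := invmx (invsqrtmx B) *t invmx (invsqrtmx A).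
have DC : D *m invsqrtmx P = 1%:M.
  by rewrite Eh tensmx_mul !mulVmx // tensmx11.
exists (D^T *m G *m D); first by apply: kron_congr; rewrite ?unitmx_inv.
rewrite !mulmxA -[_ *m D *m _]mulmxA DC mulmx1 -trmx_mul DC.
by rewrite trmx1 mul1mx.
Qed.

(** ** Partial traces *)

Lemma ptraceBE m n (L : 'M[R]_(n * m)) i j :
  ptraceB L i j = \sum_p L (mxtens_index (p, i)) (mxtens_index (p, j)).
Proof. by rewrite /ptraceB summxE; apply: eq_bigr => p _; rewrite mxE. Qed.

Lemma ptraceAE m n (L : 'M[R]_(n * m)) p q :
  ptraceA L p q = \sum_i L (mxtens_index (p, i)) (mxtens_index (q, i)).
Proof. by rewrite mxE; apply: eq_bigr => i _; rewrite mxE. Qed.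

Lemma ptraceB_linear m n a (L M : 'M[R]_(n * m)) :
  ptraceB (a *: L + M) = a *: ptraceB L + ptraceB M.
Proof.
apply/matrixP => i j; rewrite !mxE !ptraceBE mulr_sumr -big_split.
by apply: eq_bigr => p _; rewrite !mxE.
Qed.

Lemma ptraceA_linear m n a (L M : 'M[R]_(n * m)) :
  ptraceA (a *: L + M) = a *: ptraceA L + ptraceA M.
Proof.
apply/matrixP => i j; rewrite [RHS]mxE [X in _ = X + _]mxE !ptraceAE mulr_sumr -big_split.
by apply: eq_bigr => p _; rewrite !mxE.
Qed.

Lemma ptraceB_sub m n (L M : 'M[R]_(n * m)) :
  ptraceB (L - M) = ptraceB L - ptraceB M.
Proof. by rewrite addrC -scaleN1r ptraceB_linear scaleN1r addrC. Qed.

Lemma ptraceA_sub m n (L M : 'M[R]_(n * m)) :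
  ptraceA (L - M) = ptraceA L - ptraceA M.
Proof. by rewrite addrC -scaleN1r ptraceA_linear scaleN1r addrC. Qed.

Lemma ptraceB1 m n : ptraceB (1%:M : 'M[R]_(n * m)) = n%:R%:M.
Proof.
apply/matrixP => i j; rewrite ptraceBE !mxE.
under eq_bigr => p _ do rewrite !mxE (can_eq (@mxtens_indexK n m)) xpair_eqE eqxx /=.
by rewrite sumr_const card_ord; case: (i == j); rewrite ?mulr1n // mul0rn.
Qed.

Lemma ptraceA1 m n : ptraceA (1%:M : 'M[R]_(n * m)) = m%:R%:M.
Proof.
apply/matrixP => p q; rewrite ptraceAE !mxE.
under eq_bigr => i _ do rewrite !mxE (can_eq (@mxtens_indexK n m)) xpair_eqE eqxx andbT /=.
by rewrite sumr_const card_ord; case: (p == q); rewrite ?mulr1n // mul0rn.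
Qed.

Lemma ptraceB_tr m n (L : 'M[R]_(n * m)) : (ptraceB L)^T = ptraceB L^T.
Proof.
by apply/matrixP => i j; rewrite mxE !ptraceBE; apply: eq_bigr => p _; rewrite mxE.
Qed.

Lemma ptraceA_tr m n (L : 'M[R]_(n * m)) : (ptraceA L)^T = ptraceA L^T.
Proof.
by apply/matrixP => i j; rewrite mxE !ptraceAE; apply: eq_bigr => p _; rewrite mxE.
Qed.

Lemma mxtraceM d (X Y : 'M[R]_d) : \tr (X *m Y) = \sum_i \sum_j X i j * Y j i.
Proof. by apply: eq_bigr => i _; rewrite mxE. Qed.

(** The partial traces are the adjoints, for the trace pairing, of the two
    embeddings into the tangent space of the family at the identity. *)
Lemma ptraceB_adjoint m n (L : 'M[R]_(n * m)) (A : 'M[R]_m) :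
  \tr (ptraceB L *m A) = \tr (L *m (1%:M *t A)).
Proof.
rewrite !mxtraceM sum_mxtens.
under [RHS]eq_bigr => p _ do under eq_bigr => i _ do rewrite sum_mxtens (bigD1 p) //=.
rewrite [RHS]exchange_big; apply: eq_bigr => i _.
under [RHS]eq_bigr => p _.
  rewrite [X in _ + X]big1 ?addr0 => [|q qp]; last first.
    by rewrite big1 // => j _; rewrite tensmxE mxE (negPf qp) mul0r mulr0.
  over.
rewrite [RHS]exchange_big; apply: eq_bigr => j _.
rewrite ptraceBE mulr_suml; apply: eq_bigr => p _.
by rewrite tensmxE mxE eqxx mul1r.
Qed.

Lemma ptraceA_adjoint m n (L : 'M[R]_(n * m)) (B : 'M[R]_n) :
  \tr (ptraceA L *m B) = \tr (L *m (B *t 1%:M)).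
Proof.
rewrite !mxtraceM sum_mxtens; apply: eq_bigr => p _.
under [RHS]eq_bigr => i _ do rewrite sum_mxtens.
rewrite [RHS]exchange_big; apply: eq_bigr => q _.
rewrite ptraceAE mulr_suml; apply: eq_bigr => i _.
rewrite (bigD1 i) //= big1 ?addr0 => [|j ji]; last first.
  by rewrite tensmxE [1%:M _ _]mxE (negPf ji) !mulr0.
by rewrite tensmxE [1%:M _ _]mxE eqxx mulr1.
Qed.

Lemma ptraceB_trace m n (L : 'M[R]_(n * m)) : \tr (ptraceB L) = \tr L.
Proof. by rewrite -[LHS](congr1 _ (mulmx1 _)) ptraceB_adjoint tensmx11 mulmx1. Qed.

Lemma ptraceA_trace m n (L : 'M[R]_(n * m)) : \tr (ptraceA L) = \tr L.
Proof. by rewrite -[LHS](congr1 _ (mulmx1 _)) ptraceA_adjoint tensmx11 mulmx1. Qed.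

(** The unit vectors of a spectral basis already detect every eigenvalue. *)
Lemma sym_qf_unit_eq0 d (M : 'M[R]_d) : M^T = M ->
  (forall v : 'cV[R]_d, v^T *m v = 1%:M -> qf M v = 0) -> M = 0.
Proof.
move=> sM M0; have [U [e [UU EM]]] := sym_spectral sM.
suff e0 : e = 0 by rewrite EM e0 raddf0 mulmx0 mul0mx.
apply/rowP => i; rewrite -(spectral_qf i UU EM) [RHS]mxE M0 //.
rewrite trmx_mul trmxK mulmxA (orthoK UU) trmx_delta mul_delta_mx.
by apply/matrixP => a b; rewrite !ord1 !mxE.
Qed.

End KroneckerAlgebra.

(** * First order optimality of the nearest point *)

Section LogInequalities.
Variable R : realType.

Lemma ln_le_sub1 (x : R) : 0 < x -> ln x <= x - 1.
Proof.
move=> x0; have := @le_ln1Dx R (x - 1); rewrite addrCA subrr addr0; apply.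
by rewrite ltrBrDl subrr.
Qed.

Lemma ln_ge_1subV (x : R) : 0 < x -> 1 - x^-1 <= ln x.
Proof.
move=> x0; have := @ln_le_sub1 x^-1; rewrite invr_gt0 lnV ?posrE // => /(_ x0).
by lra.
Qed.

(** With [r] the square root of [s], both sides are compared to
    [(r - 1) ^ 2 * max 1 (1 / s)]. *)
Lemma ln_sqr_le (s : R) : 0 < s -> ln s ^+ 2 <= 4 * (s - 2 + s^-1).
Proof.
move=> s0; have [r r0 ->] : exists2 r : R, 0 < r & s = r ^+ 2.
  by exists (Num.sqrt s); rewrite ?sqrtr_gt0 // sqr_sqrtr // ltW.
have -> : ln (r ^+ 2) ^+ 2 = 4 * ln r ^+ 2 by rewrite lnXn // -mulr_natl; ring.
rewrite ler_wpM2l //.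
have u := ln_le_sub1 r0; have l := ln_ge_1subV r0.
have E : r ^+ 2 - 2 + (r ^+ 2)^-1 = (r - r^-1) ^+ 2.
  by field; rewrite gt_eqF.
rewrite E -[_ ^+ 2]real_normK ?num_real // -[leRHS]real_normK ?num_real //.
rewrite ler_sqr ?nnegrE //.
have rV : 0 < r^-1 by rewrite invr_gt0.
rewrite ler_norml; apply/andP.
have [r1|r1] := leP 1 r.
  have rV1 : r^-1 <= 1 by rewrite invf_le1.
  rewrite [`|r - _|]ger0_norm; last lra.
  by split; lra.
have rV1 : 1 <= r^-1 by rewrite invf_ge1 // ltW.
rewrite [`|r - _|]ler0_norm; last lra.
by split; lra.
Qed.

(** The squared logarithm lies below its first order expansion at [mu] plus a
    remainder that is linear in [nu] and [1 / nu], so that summing over an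
    orthonormal basis only involves diagonal entries of a matrix and of its
    inverse. *)
Lemma ln_sqr_expansion (mu nu : R) : 0 < mu -> 0 < nu ->
  ln nu ^+ 2 <= ln mu ^+ 2 + 2 * ln mu * (nu / mu - 1)
                + (4 + 2 * `|ln mu|) * (nu / mu - 2 + mu / nu).
Proof.
move=> mu0 nu0; pose s := nu / mu; have s0 : 0 < s by rewrite divr_gt0.
have -> : nu = mu * s by rewrite /s mulrC divfK // gt_eqF.
rewrite lnM ?posrE // [mu * s / mu]mulrAC divff ?gt_eqF // mul1r.
rewrite invfM mulrA divff ?gt_eqF // mul1r.
have q := ln_sqr_le s0; have u := ln_le_sub1 s0; have l := ln_ge_1subV s0.
set a := ln mu; set b := ln s in q u l *.
have E : s - 2 + s^-1 = s - 1 - (1 - s^-1) by ring.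
have d0 : 0 <= s - 1 - b <= s - 2 + s^-1 by rewrite E; apply/andP; split; lra.
have k : - (2 * a * (s - 1 - b)) <= 2 * `|a| * (s - 2 + s^-1).
  apply: (@le_trans _ _ (2 * `|a| * (s - 1 - b))).
    rewrite -mulNr ler_wpM2r ?(andP d0).1 // -mulrN ler_wpM2l // lerNl.
    by have := ler_norm (- a); rewrite normrN; lra.
  by rewrite ler_wpM2l ?(andP d0).2 // mulr_ge0.
have -> : (a + b) ^+ 2 = a ^+ 2 + 2 * a * (s - 1) - 2 * a * (s - 1 - b) + b ^+ 2 by ring.
rewrite mulrDl; lra.
Qed.

(** The factor of [b] equals [t ^ 2 / (1 + t)], so for small [t] of sign opposite
    to [a] the linear term would win. *)
Lemma stationary_of_quadratic (a b : R) :
  (forall t, -1 < t -> 0 <= 2 * t * a + b * (t - t / (1 + t))) -> a = 0.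
Proof.
move=> H; apply/eqP/negPn/negP => na.
have a0 : 0 < `|a| by rewrite normr_gt0.
pose c := `|a| + `|b| + 1; have c0 : 0 < c by rewrite /c ltr_wpDl // addr_ge0.
(* The size of [c] keeps [t] within [1 / 2] of zero, where [1 / (1 + t) <= 2],
   and makes the second order term at most half of the first order one. *)
pose t := - a / (2 * c).
have tn : `|t| <= 1 / 2.
  rewrite normrM normrN normfV normrM (gtr0_norm c0) gtr0_norm //.
  by rewrite ler_pdivrMr ?mulr_gt0 // mulrA divfK // mul1r /c -addrA lerDl addr_ge0.
have /andP[t1 t2] : - (1 / 2) <= t <= 1 / 2 by rewrite -ler_norml.
have {}H : 0 <= 2 * t * a + b * (t - t / (1 + t)) by apply: H; lra.
have t10 : 0 < 1 + t by lra.
have E : t - t / (1 + t) = t ^+ 2 / (1 + t) by field; rewrite gt_eqF.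
have i2 : (1 + t)^-1 <= 2 by rewrite invf_ple ?posrE //; lra.
have B : b * (t ^+ 2 / (1 + t)) <= 2 * `|b| * t ^+ 2.
  rewrite mulrCA [leRHS]mulrC ler_wpM2l ?sqr_ge0 //.
  apply: (@le_trans _ _ (`|b| / (1 + t))).
    by rewrite ler_wpM2r ?ler_norm // invr_ge0 ltW.
  by rewrite [leRHS]mulrC ler_wpM2l.
have A2 : 0 < a ^+ 2 by rewrite lt_def sqrf_eq0 na sqr_ge0.
have T1 : 2 * t * a = - (a ^+ 2 / c) by rewrite /t; field; rewrite gt_eqF.
have T2 : 2 * `|b| * t ^+ 2 = (a ^+ 2 / c) * (`|b| / (2 * c)).
  by rewrite /t; field; rewrite gt_eqF.
have q0 : 0 < a ^+ 2 / c by rewrite divr_gt0.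
have T3 : `|b| / (2 * c) <= 1 / 2.
  by rewrite ler_pdivrMr ?mulr_gt0 // mulrA divfK // mul1r /c; lra.
have T4 : (a ^+ 2 / c) * (`|b| / (2 * c)) <= (a ^+ 2 / c) * (1 / 2).
  by rewrite ler_wpM2l // ltW.
rewrite E in H; lra.
Qed.

End LogInequalities.

Section Stationarity.
Variable R : realType.

Lemma qf_trace d (M : 'M[R]_d) (v : 'cV[R]_d) : qf M v = \tr (M *m (v *m v^T)).
Proof. by rewrite mulmxA mxtrace_mulC mulmxA [in RHS]/mxtrace big_ord1. Qed.

Lemma congr_mul d k l (X : 'M[R]_d) (C : 'M[R]_(d, k)) (V : 'M[R]_(k, l)) :
  (C *m V)^T *m X *m (C *m V) = V^T *m (C^T *m X *m C) *m V.
Proof. by rewrite trmx_mul !mulmxA. Qed.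

(** The quadratic form is [|v|^2 + t |Pi v|^2], and [|Pi v| <= |v|]. *)
Lemma projector_pd d (Pi : 'M[R]_d) t : Pi^T = Pi -> Pi *m Pi = Pi -> -1 < t ->
  pdmx (1%:M + t *: Pi).
Proof.
move=> sPi PP t1; split=> [|v nv]; first by rewrite linearD linearZ /= trmx1 sPi.
rewrite qfD qf_scale qf1; set A := _ 0 0; set B := _ 0 0.
have A0 : 0 < A by exact: sqnorm_gt0.
have B0 : 0 <= B.
  by have := sqnorm_ge0 (Pi *m v); rewrite trmx_mul sPi mulmxA -[_ *m Pi *m Pi]mulmxA PP.
have AB : B <= A.
  have QQ : (1%:M - Pi) *m (1%:M - Pi) = 1%:M - Pi.
    by rewrite mulmxBr mulmx1 mulmxBl mul1mx PP subrr subr0.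
  have := sqnorm_ge0 ((1%:M - Pi) *m v).
  rewrite trmx_mul linearB /= trmx1 sPi mulmxA -[_ *m _ *m (_ - _)]mulmxA QQ.
  by rewrite mulmxBr mulmx1 mulmxBl [X in _ <= X]mxE [X in _ + X]mxE subr_ge0.
have [t0|t0] := leP 0 t; first by rewrite ltr_wpDr // mulr_ge0.
nra.
Qed.

(** If moving away from the identity along [1 + t Pi], for a projector [Pi],
    does not decrease the distance to [S], then [log S] is orthogonal to [Pi].
    The derivative of the distance is replaced by an upper bound: writing the
    eigenvalues of the moved pencil in terms of those of [S] through the doubly
    stochastic matrix of squared overlaps, [ln_sqr_expansion] turns the squared
    distance into diagonal entries, explicit because [1 + t Pi] has inverse
    [1 - t / (1 + t) Pi]. *)
Lemma projector_stationary d (S U Pi : 'M[R]_d) (s : 'rV[R]_d) :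
  pdmx S -> U^T *m U = 1%:M -> S = U^T *m diag_mx s *m U ->
  Pi^T = Pi -> Pi *m Pi = Pi ->
  (forall t, -1 < t -> dAI S 1%:M <= dAI S (1%:M + t *: Pi)) ->
  \tr (U^T *m diag_mx (map_mx (@ln R) s) *m U *m Pi) = 0.
Proof.
move=> pS UU ES sPi PP far.
have s_gt0 i : 0 < s 0 i.
  by rewrite -(spectral_qf i UU ES); apply: pS.2; exact: orthogonal_col_neq0.
pose r := \row_i (Num.sqrt (s 0 i))^-1 : 'rV[R]_d.
pose r' := \row_i Num.sqrt (s 0 i) : 'rV[R]_d.
pose C := U^T *m diag_mx r; pose mu := \row_i (s 0 i)^-1 : 'rV[R]_d.
have r2 i : r 0 i * r 0 i = mu 0 i.
  by rewrite !mxE -invfM -expr2 sqr_sqrtr // ltW.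
have r'2 i : r' 0 i * r' 0 i = s 0 i by rewrite !mxE -expr2 sqr_sqrtr // ltW.
have rr' i : r 0 i * r' 0 i = 1 by rewrite !mxE mulVf // gt_eqF // sqrtr_gt0.
have mu0 i : 0 < mu 0 i by rewrite mxE invr_gt0.
have CT : C^T = diag_mx r *m U by rewrite /C trmx_mul tr_diag_mx trmxK.
have CSC : C^T *m S *m C = 1%:M.
  rewrite CT ES /C !mulmxA !(orthoK UU) !mulmx_diag.
  apply/matrixP => i j; rewrite !mxE; congr (_ *+ _).
  by rewrite -{2}(r'2 i) !mxE; field; rewrite gt_eqF // sqrtr_gt0.
have uC : C \in unitmx by case/mulmx1_unit: CSC.
pose p i := (U *m Pi *m U^T) i i.
pose K i := 4 + 2 * `|ln (mu 0 i)|.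
have d1 : dAI S 1%:M = Num.sqrt (\sum_i ln (mu 0 i) ^+ 2).
  apply: (@dAI_pencil _ _ _ _ C) => //; split=> //.
  rewrite mulmx1 CT /C mulmxA (orthoK UU) mulmx_diag; congr diag_mx.
  by apply/rowP => i; rewrite mxE r2.
(* [mu] lists the eigenvalues of the pencil of [S] and the identity, [nu] those
   of the moved pencil, and [p] the diagonal of [Pi] in the eigenbasis of [S]. *)
have main t : -1 < t -> 0 <= 2 * t * (\sum_i ln (mu 0 i) * p i)
    + (\sum_i K i * p i) * (t - t / (1 + t)).
  move=> t1; have t10 : 1 + t != 0 by rewrite gt_eqF // addrC -ltrBlDr sub0r.
  have pG := projector_pd sPi PP t1; set G := 1%:M + t *: Pi in pG.
  have [V [nu [VV EN nu0]]] := pd_spectral (pd_congr uC pG).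
  have d2 : dAI S G = Num.sqrt (\sum_j ln (nu 0 j) ^+ 2).
    apply: (@dAI_pencil _ _ _ _ (C *m V^T)) => //.
    split; rewrite congr_mul trmxK; first by rewrite CSC mulmx1 (mulmx1C VV).
    by rewrite EN !mulmxA (mulmx1C VV) mul1mx (orthoK VV).
  pose M' := V^T *m diag_mx (\row_j (nu 0 j)^-1) *m V.
  pose G' := 1%:M - (t / (1 + t)) *: Pi.
  pose C' := diag_mx r' *m U *m G' *m U^T *m diag_mx r'.
  have GG' : G *m G' = 1%:M.
    rewrite /G /G' mulmxBr mulmx1 mulmxDl mul1mx -scalemxAr -scalemxAl.
    rewrite PP; apply/matrixP => i j; rewrite !mxE.
    by field.
  have NC : C^T *m G *m C *m C' = 1%:M.
    have Drr' : diag_mx r *m diag_mx r' = 1%:M.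
      rewrite mulmx_diag; apply/matrixP => i j; rewrite !mxE.
      by have := rr' i; rewrite !mxE => ->.
    rewrite CT /C /C' !mulmxA -[_ *m diag_mx r *m diag_mx r']mulmxA Drr' mulmx1.
    rewrite (orthoKT UU) -[_ *m G *m G']mulmxA GG' mulmx1.
    by rewrite (orthoK UU).
  have NM' : C^T *m G *m C *m M' = 1%:M.
    rewrite EN spectral_mul // spectral_const // => j.
    by rewrite !mxE mulfV // gt_eqF.
  have CM' : C' = M'.
    have uN : C^T *m G *m C \in unitmx by case/mulmx1_unit: NC.
    by apply: (can_inj (mulKmx uN)); rewrite NC.
  have col1 j : \sum_i V j i ^+ 2 = 1.
    have /matrixP/(_ j j) := mulmx1C VV; rewrite !mxE eqxx mulr1n => <-.
    by apply: eq_bigr => i _; rewrite mxE.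
  have row1 i : \sum_j V j i ^+ 2 = 1.
    have /matrixP/(_ i i) := VV; rewrite !mxE eqxx mulr1n => <-.
    by apply: eq_bigr => j _; rewrite mxE.
  have diagV (e : 'rV[R]_d) i : (V^T *m diag_mx e *m V) i i = \sum_j V j i ^+ 2 * e 0 j.
    rewrite mul_mx_diag mxE; apply: eq_bigr => j _; rewrite !mxE.
    by rewrite mulrAC expr2.
  (* The overlaps average [nu] and its inverse to the diagonals of [C^T *m G *m C]
     and of its inverse [C'], both of which are explicit. *)
  have Nii i : \sum_j V j i ^+ 2 * nu 0 j = mu 0 i * (1 + t * p i).
    rewrite -diagV -EN CT /C mulmxA mul_mx_diag mxE -!mulmxA mul_diag_mx mxE.
    rewrite mulrAC r2; congr (_ * _).
    rewrite mulmxA /G mulmxDr mulmx1 mulmxDl (mulmx1C UU) -scalemxAr -scalemxAl.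
    by rewrite mxE [1%:M i i]mxE eqxx mxE.
  have Mii i : \sum_j V j i ^+ 2 * (nu 0 j)^-1
      = s 0 i * (1 - t / (1 + t) * p i).
    transitivity (M' i i); first by rewrite diagV; apply: eq_bigr => j _; rewrite mxE.
    rewrite -CM' /C' mul_mx_diag mxE -!mulmxA mul_diag_mx mxE.
    rewrite mulrAC r'2; congr (_ * _).
    rewrite mulmxA /G' mulmxBr mulmx1 mulmxBl (mulmx1C UU) -scalemxAr -scalemxAl.
    by rewrite /p; move: (U *m Pi *m U^T) => X; rewrite !mxE eqxx.
  have := far t t1; rewrite d1 d2 ler_sqrt; last first.
    by apply: sumr_ge0 => j _; rewrite sqr_ge0.
  move=> le1; have le2 : \sum_j ln (nu 0 j) ^+ 2 <=
      \sum_i (ln (mu 0 i) ^+ 2 + 2 * ln (mu 0 i) * (t * p i)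
              + K i * (p i * (t - t / (1 + t)))).
    have -> : \sum_j ln (nu 0 j) ^+ 2 = \sum_i \sum_j V j i ^+ 2 * ln (nu 0 j) ^+ 2.
      rewrite exchange_big; apply: eq_bigr => j _ /=.
      by rewrite -mulr_suml col1 mul1r.
    apply: ler_sum => i _.
    apply: (@le_trans _ _ (\sum_j V j i ^+ 2 * (ln (mu 0 i) ^+ 2
        + 2 * ln (mu 0 i) * (nu 0 j / mu 0 i - 1)
        + K i * (nu 0 j / mu 0 i - 2 + mu 0 i / nu 0 j)))).
      by apply: ler_sum => j _; rewrite ler_wpM2l ?sqr_ge0 //; exact: ln_sqr_expansion.
    rewrite le_eqVlt; apply/orP; left; apply/eqP.
    set A := ln (mu 0 i).
    transitivity ((A ^+ 2 - 2 * A - 2 * K i) * (\sum_j V j i ^+ 2)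
      + ((2 * A + K i) / mu 0 i) * (\sum_j V j i ^+ 2 * nu 0 j)
      + (K i * mu 0 i) * (\sum_j V j i ^+ 2 * (nu 0 j)^-1)).
      rewrite !mulr_sumr -!big_split /=; apply: eq_bigr => j _.
      by ring.
    rewrite row1 Nii Mii [mu 0 i]mxE; field.
    by rewrite t10 gt_eqF.
  have {le1 le2} := le_trans le1 le2; rewrite !big_split /= -addrA lerDl.
  rewrite mulr_sumr mulr_suml.
  congr (0 <= _ + _); apply: eq_bigr => i _; ring.
have /stationary_of_quadratic z := main.
rewrite -!mulmxA mxtrace_mulC -!mulmxA mulmxA [in X in \tr X]mulmxA.
have -> : \tr (diag_mx (map_mx (@ln R) s) *m U *m Pi *m U^T)
    = - \sum_i ln (mu 0 i) * p i; last by rewrite z oppr0.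
rewrite -!mulmxA mul_diag_mx /mxtrace -sumrN; apply: eq_bigr => i _.
have -> : ln (mu 0 i) = - ln (s 0 i) by rewrite mxE lnV ?posrE.
by rewrite mulNr opprK mxE mulmxA [X in X * _]mxE.
Qed.

(** A rank one projector on one factor, tensored with the identity on the other,
    is a direction along which [1 + t Pi] stays in the family.  Testing against
    all of them annihilates both partial traces of [log S]. *)
Lemma nearest_ptrace_log m n (S U : 'M[R]_(n * m)) (s : 'rV[R]_(n * m)) :
  pdmx S -> U^T *m U = 1%:M -> S = U^T *m diag_mx s *m U ->
  kron_nearest S 1%:M ->
  ptraceB (U^T *m diag_mx (map_mx (@ln R) s) *m U) = 0 /\
  ptraceA (U^T *m diag_mx (map_mx (@ln R) s) *m U) = 0.
Proof.
move=> pS UU ES [_ near]; set L := U^T *m _ *m _.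
have sL : L^T = L by exact: spectral_tr.
have vvP k (v : 'cV[R]_k) : v^T *m v = 1%:M ->
    (v *m v^T)^T = v *m v^T /\ v *m v^T *m (v *m v^T) = v *m v^T.
  move=> vv; rewrite trmx_mul trmxK; split=> //.
  by rewrite mulmxA -[v *m v^T *m v]mulmxA vv mulmx1.
split; apply: sym_qf_unit_eq0; rewrite ?ptraceB_tr ?ptraceA_tr ?sL // => v vv;
  have [sv vvv] := vvP _ v vv; rewrite qf_trace ?ptraceB_adjoint ?ptraceA_adjoint.
  apply: (projector_stationary pS UU ES).
  - by rewrite trmx_tens trmx1 sv.
  - by rewrite tensmx_mul mul1mx vvv.
  move=> t t1; apply: near; exists (1%:M + t *: (v *m v^T)), 1%:M; split.
  - exact: projector_pd.
  - exact: pd1.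
  by apply/matrixP => k l; rewrite -tensmx11 !mxE mulrDr mulrCA.
apply: (projector_stationary pS UU ES).
- by rewrite trmx_tens trmx1 sv.
- by rewrite tensmx_mul mul1mx vvv.
move=> t t1; apply: near; exists 1%:M, (1%:M + t *: (v *m v^T)); split.
- exact: pd1.
- exact: projector_pd.
by apply/matrixP => k l; rewrite -tensmx11 !mxE mulrDl mulrA.
Qed.

End Stationarity.

(** * Balance implies optimality *)

Section Sufficiency.
Variable R : realType.

Lemma delta_qf d (M : 'M[R]_d) i : qf M (delta_mx i 0 : 'cV[R]_d) = M i i.
Proof. by rewrite trmx_delta -rowE -colE !mxE. Qed.

Lemma spectral_trace d (U : 'M[R]_d) (e : 'rV[R]_d) (Q : 'M[R]_d) :
  \tr (U^T *m diag_mx e *m U *m Q) = \sum_i e 0 i * (U *m Q *m U^T) i i.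
Proof.
rewrite -!mulmxA mxtrace_mulC -!mulmxA mul_diag_mx; apply: eq_bigr => i _.
by rewrite mxE mulmxA.
Qed.

Lemma psd_diag_ge0 d (U Q : 'M[R]_d) i : psdmx Q -> 0 <= (U *m Q *m U^T) i i.
Proof.
move=> pQ; have [_ /(_ (delta_mx i 0))] := psd_congr U^T pQ.
by rewrite trmxK delta_qf.
Qed.

Lemma psd_trace_mul_ge0 d (Z Q : 'M[R]_d) : psdmx Z -> psdmx Q ->
  0 <= \tr (Z *m Q).
Proof.
move=> /psd_spectral [U [e [UU -> e0]]] pQ; rewrite spectral_trace.
by apply: sumr_ge0 => i _; rewrite mulr_ge0 ?psd_diag_ge0.
Qed.

(** The concave function [ln] lies below its tangent at the mean [c]. *)
Lemma jensen_ln (I : finType) (q x : I -> R) : (forall i, 0 <= q i) ->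
  \sum_i q i = 1 -> (forall i, 0 < x i) ->
  0 < \sum_i x i * q i /\ \sum_i ln (x i) * q i <= ln (\sum_i x i * q i).
Proof.
move=> q0 q1 x0; set c := \sum_i x i * q i.
have c0 : 0 < c.
  rewrite lt_def sumr_ge0 ?andbT => [|i _]; last by rewrite mulr_ge0 // ltW.
  apply/eqP => /eqP; rewrite psumr_eq0 => [/allP c0|i _]; last by rewrite mulr_ge0 // ltW.
  have /eqP : \sum_i q i = 0.
    rewrite big1 // => i _; have := c0 i (mem_index_enum _).
    by rewrite mulf_eq0 gt_eqF //= => /eqP.
  by rewrite q1 oner_eq0.
split=> //; apply: (@le_trans _ _ (\sum_i (x i / c - 1 + ln c) * q i)).
  apply: ler_sum => i _; rewrite ler_wpM2r // -lerBlDr -ln_div ?posrE //.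
  by apply: ln_le_sub1; rewrite divr_gt0.
have -> : \sum_i (x i / c - 1 + ln c) * q i = c^-1 * c + (ln c - 1) * \sum_i q i.
  by rewrite [c^-1 * _]mulr_sumr mulr_sumr -big_split; apply: eq_bigr => i _ /=; ring.
by rewrite q1 mulVf ?gt_eqF //; lra.
Qed.

(** The diagonal entries of a density matrix [Q] in the eigenbasis of the
    operator are the weights of a probability distribution. *)
Lemma jensen_trace d (F Q : 'M[R]_d) (g : 'rV[R]_d) :
  F^T *m F = 1%:M -> (forall i, 0 < g 0 i) -> psdmx Q -> \tr Q = 1 ->
  0 < \tr (F^T *m diag_mx g *m F *m Q) /\
  \tr (F^T *m diag_mx (map_mx (@ln R) g) *m F *m Q)
    <= ln (\tr (F^T *m diag_mx g *m F *m Q)).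
Proof.
move=> FF g0 pQ tQ; rewrite !spectral_trace.
under [X in _ /\ X <= _]eq_bigr do rewrite mxE.
apply: jensen_ln => // [i|]; first exact: psd_diag_ge0.
by rewrite -/(mxtrace _) mxtrace_mulC mulmxA FF mul1mx.
Qed.

(** The logarithm of a Kronecker point is tangent to the family: it is a sum of
    one term per factor. *)
Lemma kron_log m n (G : 'M[R]_(n * m)) : kron m n G ->
  exists (F : 'M[R]_(n * m)) (g : 'rV[R]_(n * m)) (B : 'M[R]_n) (A : 'M[R]_m),
  [/\ F^T *m F = 1%:M, G = F^T *m diag_mx g *m F, forall k, 0 < g 0 k &
      F^T *m diag_mx (map_mx (@ln R) g) *m F = B *t 1%:M + 1%:M *t A].
Proof.
move=> [A [B [/pd_spectral [W [a [WW -> a0]]] /pd_spectral [V [b [VV -> b0]]] ->]]].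
exists (V *t W), (tensrow b a), (V^T *m diag_mx (map_mx (@ln R) b) *m V),
  (W^T *m diag_mx (map_mx (@ln R) a) *m W); split.
- exact: tens_orthogonal.
- exact: tens_spectral.
- by move=> k; case: (mxtens_indexP k) => p i; rewrite tensrowE mulr_gt0.
rewrite -[1%:M in X in _ = X + _](spectral_const (e := const_mx 1) WW) => [|i];
  last by rewrite mxE.
rewrite -[1%:M in X in _ = _ + X](spectral_const (e := const_mx 1) VV) => [|i];
  last by rewrite mxE.
rewrite !tens_spectral -mulmxDl -mulmxDr -raddfD /=; congr (_ *m diag_mx _ *m _).
apply/rowP => k; case: (mxtens_indexP k) => p i.
by rewrite mxE tensrowE lnM ?posrE // [RHS]mxE !tensrowE !mxE mulr1 mul1r.
Qed.

Lemma tangent_trace m n (B : 'M[R]_n) (A : 'M[R]_m) (L : 'M[R]_(n * m)) :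
  \tr ((B *t 1%:M + 1%:M *t A) *m L)
  = \tr (ptraceA L *m B) + \tr (ptraceB L *m A).
Proof.
by rewrite mulmxDl mxtraceD ptraceA_adjoint ptraceB_adjoint; congr (_ + _);
  rewrite mxtrace_mulC.
Qed.

Lemma eigmaxE d (S : 'M[R]_d) : S^T = S -> eigmax S = sup (geneigenvalues 1%:M S).
Proof. by move=> sS; rewrite /eigmax eigenvalue_geneigenvalues. Qed.

Lemma eigminE d (S : 'M[R]_d) : S^T = S -> eigmin S = inf (geneigenvalues 1%:M S).
Proof. by move=> sS; rewrite /eigmin eigenvalue_geneigenvalues. Qed.

Lemma eigmin_gt0 d (S : 'M[R]_d) : (0 < d)%N -> pdmx S -> 0 < eigmin S.
Proof.
move=> d0 pS; have [sS _] := pS; rewrite eigminE //.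
by have [] := extreme_geneigenvalues d0 (pd1 R d) pS.
Qed.

Lemma eigmax_gt0 d (S : 'M[R]_d) : (0 < d)%N -> pdmx S -> 0 < eigmax S.
Proof.
move=> d0 pS; have [sS _] := pS; rewrite eigmaxE //.
have [gs gi i0 b] := extreme_geneigenvalues d0 (pd1 R d) pS.
apply: lt_le_trans i0 _; apply: geneigenvalue_le gi; first exact: pd1.
by move=> v; have /andP[] := b v.
Qed.

(** The largest eigenvalue is tested on [K *m Qp *m K], with [K] the inverse of
    [G], and the smallest one on [Qm].  Balance makes the two Jensen lower bounds for the logarithms of
    [\tr (K *m Qp)] and [\tr (G *m Qm)] opposite, because [log G] is tangent to the family. *)
Lemma trace_balanced_min m n (S G : 'M[R]_(n * m)) : (0 < n * m)%N ->
  pdmx S -> trace_balanced S -> kron m n G -> kappa 1%:M S <= kappa G S.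
Proof.
move=> d0 pS [Qp [Qm [[pQp pQm] [tQp tQm] [EQp EQm] BB BA]]] kG.
have [sS _] := pS; have pG := kron_pd kG.
have lm0 := eigmin_gt0 d0 pS; have lM0 := eigmax_gt0 d0 pS.
rewrite {1}/kappa -eigmaxE // -eigminE //.
move: EQp EQm lm0 lM0; set lM := eigmax S; set lm := eigmin S.
move=> /eigenspaceP EQp /eigenspaceP EQm lm0 lM0.
have [gs gi] := extreme_geneigenvalues d0 pG pS; rewrite /kappa.
move: gs gi; set be := sup _; set al := inf _ => gs gi al0 bnd.
have [F [g [B [A [FF EG g0 EX]]]]] := kron_log kG.
have [z0 lz] := jensen_trace FF g0 pQm tQm.
pose g' := \row_k (g 0 k)^-1 : 'rV[R]_(n * m).
have g'0 k : 0 < g' 0 k by rewrite mxE invr_gt0.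
have [x0 lx] := jensen_trace FF g'0 pQp tQp.
rewrite -EG in z0 lz; set z := \tr (G *m Qm) in z0 lz.
pose K := F^T *m diag_mx g' *m F; rewrite -/K in x0 lx.
set x := \tr (K *m Qp) in x0 lx.
have KG : K *m G = 1%:M.
  rewrite /K EG spectral_mul // spectral_const // => k.
  by rewrite !mxE mulVf // gt_eqF.
have sK : K^T = K by exact: spectral_tr.
have sG : G^T = G by case: pG.
have balance : 0 <= ln x + ln z.
  apply: le_trans (lerD lx lz).
  have -> : map_mx (@ln R) g' = - map_mx (@ln R) g.
    by apply/rowP => k; rewrite !mxE lnV ?posrE.
  rewrite raddfN /= mulmxN !mulNmx raddfN /= EX addrC -raddfB /= -mulmxBr.
  by rewrite tangent_trace BB BA !mul0mx !raddf0 addr0.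
have Ex : \tr (K *m Qp) = x by [].
clearbody x K.
have xz : 1 <= x * z.
  by rewrite -ler_ln ?posrE ?mulr_gt0 // ln1 lnM ?posrE.
have pb : psdmx (be *: G - S).
  split=> [|v]; first by rewrite linearB linearZ /= sG sS.
  rewrite qfD -scaleN1r !qf_scale mulN1r subr_ge0.
  by have /andP[] := bnd v.
have pa : psdmx (S - al *: G).
  split=> [|v]; first by rewrite linearB linearZ /= sG sS.
  rewrite qfD -scaleNr !qf_scale mulNr subr_ge0.
  by have /andP[] := bnd v.
have az : al * z <= lm.
  have := psd_trace_mul_ge0 pa pQm.
  rewrite mulmxBl raddfB /= -scalemxAl mxtraceZ -/z [\tr (S *m _)]mxtrace_mulC.
  by rewrite EQm mxtraceZ tQm mulr1 subr_ge0.
have SQp : S *m Qp = lM *: Qp.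
  by have := congr1 trmx EQp; rewrite trmx_mul linearZ /= sS (pQp.1).
have lx' : lM * x <= be.
  have := psd_trace_mul_ge0 pb (psd_congr K pQp).
  rewrite sK mulmxBl raddfB /= -scalemxAl mxtraceZ.
  have -> : \tr (G *m (K *m Qp *m K)) = x.
    by rewrite !mulmxA (mulmx1C KG) mul1mx mxtrace_mulC.
  (* Cauchy-Schwarz in the form [0 <= \tr (S *m (K - x) *m Qp *m (K - x))], where
     [Qp] absorbs [S] into the factor [lM]. *)
  pose D := K - x%:M; have sD : D^T = D by rewrite /D linearB /= sK tr_scalar_mx.
  have := psd_trace_mul_ge0 (pd_psd pS) (psd_congr D pQp).
  rewrite sD /D mulmxBr mulmxBl mulmxBl.
  rewrite !mulmxBr !raddfB /= !mul_mx_scalar !mul_scalar_mx -!scalemxAl -!scalemxAr !mxtraceZ.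
  rewrite [S *m (K *m Qp - _)]mulmxBr raddfB /= -scalemxAr mxtraceZ.
  have -> : \tr (S *m (K *m Qp)) = lM * x.
    by rewrite mxtrace_mulC -mulmxA EQp -scalemxAr mxtraceZ Ex.
  have -> : \tr (S *m (Qp *m K)) = lM * x.
    by rewrite mulmxA SQp -scalemxAl mxtraceZ mxtrace_mulC Ex.
  rewrite SQp mxtraceZ tQp mulr1; set T := \tr _ => h1 h2.
  rewrite -(ler_pM2l x0); lra.
rewrite ler_pdivrMr // mulrAC ler_pdivlMr //.
have lxz : lM <= lM * x * z by rewrite -mulrA ler_peMr // ltW.
apply: (@le_trans _ _ (be * (al * z))); last first.
  by rewrite ler_wpM2l // (le_trans _ lx') // mulr_ge0 ?ltW.
rewrite mulrCA mulrC ler_wpM2l ?(ltW al0) // (le_trans lxz) //.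
by rewrite ler_wpM2r // ltW.
Qed.

End Sufficiency.

(** * Compactness of pairs of densities *)

Section Compactness.
Import numFieldNormedType.Exports.
Variable R : realType.

Lemma sum_continuous (T : topologicalType) (J : finType) (F : J -> T -> R) :
  (forall j, continuous (F j)) -> continuous (fun w => \sum_j F j w).
Proof.
move=> cF; elim: (index_enum J) => [|j r IH].
  rewrite (_ : (fun w => _) = fun=> 0); first exact: cst_continuous.
  by apply/funext => w; rewrite big_nil.
rewrite (_ : (fun w => _) = fun w => F j w + \sum_(i <- r) F i w).
  by move=> w; apply: continuousD; [exact: cF | exact: IH].
by apply/funext => w; rewrite big_cons.
Qed.

Lemma scalar_continuous N (l : 'rV[R]_N -> R) : scalar l -> continuous l.
Proof.
move=> ll; have l0 : l 0 = 0.
  by have := ll (-1) 0 0; rewrite scaler0 addr0 mulN1r addNr.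
have lD u v : l (u + v) = l u + l v by have := ll 1 u v; rewrite scale1r mul1r.
have lZ a u : l (a *: u) = a * l u by have := ll a u 0; rewrite addr0 l0 addr0.
rewrite (_ : l = fun w => \sum_k w 0 k * l (delta_mx 0 k)); last first.
  apply/funext => w; rewrite {1}(row_sum_delta w) (big_morph l lD l0).
  by apply: eq_bigr => k _; rewrite lZ.
apply: sum_continuous => k w.
apply: (@continuousM _ _ (fun w : 'rV[R]_N => w 0 k) (fun=> l (delta_mx 0 k))).
  exact: coord_continuous.
exact: cst_continuous.
Qed.

Lemma closed_scalar_ge N (I : Type) (l : I -> 'rV[R]_N -> R) c :
  (forall i, scalar (l i)) -> closed [set w | forall i, c <= l i w].
Proof.
move=> sl; rewrite (_ : [set w | _] = \bigcap_(i in [set: I]) (l i @^-1` [set x | c <= x])).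
  apply: closed_bigI => i _; apply: preimage_closed; last exact: closed_ge.
  by move=> w _; exact: scalar_continuous.
by apply/seteqP; split=> w /= wl i; [move=> _; exact: wl | exact: wl].
Qed.

Lemma closed_scalar_eq N (I : Type) (l : I -> 'rV[R]_N -> R) c :
  (forall i, scalar (l i)) -> closed [set w | forall i, l i w = c].
Proof.
move=> sl; rewrite (_ : [set w | _] = \bigcap_(i in [set: I]) (l i @^-1` [set x | x = c])).
  apply: closed_bigI => i _; apply: preimage_closed; last exact: closed_eq.
  by move=> w _; exact: scalar_continuous.
by apply/seteqP; split=> w /= wl i; [move=> _; exact: wl | exact: wl].
Qed.

(** Variational inequality of the projection onto a convex set: the minimizer
    exists by compactness, and the squared norm cannot decrease along a segment
    issued from it. *)
Lemma convex_nearest_origin N (K : set 'rV[R]_N) (J : finType)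
    (g : J -> 'rV[R]_N -> R) :
  (forall j, scalar (g j)) -> K !=set0 -> closed K ->
  (forall w, K w -> forall k, `|w 0 k| <= 1) ->
  (forall u v t, K u -> K v -> 0 <= t <= 1 -> K (t *: (v - u) + u)) ->
  exists2 u, K u & forall v, K v -> \sum_j g j u ^+ 2 <= \sum_j g j u * g j v.
Proof.
move=> sg K0 cK bK convK.
have kK : compact K.
  apply: bounded_closed_compact => //; exists 1; split; first exact: num_real.
  move=> M M1 w Kw; rewrite /=; have -> : `|w| = mx_norm w by [].
  rewrite mx_normrE; apply/bigmax_leP.
  split=> [|[i k] _]; first by rewrite ltW // (lt_trans ltr01).
  by rewrite /= ord1 (le_trans (bK w Kw k)) // ltW.
pose f w := \sum_j g j w ^+ 2.
have cf : continuous f.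
  apply: sum_continuous => j w.
  by apply: (@continuousM _ _ (g j) (g j)); exact: scalar_continuous.
have [u /set_mem Ku minu] := compact_EVT_min K0 kK (continuous_subspaceT cf).
exists u => // v Kv.
pose b := \sum_j g j u * g j (v - u); pose q := \sum_j g j (v - u) ^+ 2.
have gB j : g j v = g j (v - u) + g j u.
  by have := sg j 1 (v - u) u; rewrite scale1r subrK mul1r.
have q0 : 0 <= q by apply: sumr_ge0 => j _; rewrite sqr_ge0.
have step t : 0 <= t <= 1 -> 0 <= 2 * t * b + t ^+ 2 * q.
  move=> t01; have := minu _ (mem_set (convK u v t Ku Kv t01)).
  rewrite /f.
  have -> : \sum_j g j (t *: (v - u) + u) ^+ 2
      = 2 * t * b + t ^+ 2 * q + \sum_j g j u ^+ 2.
    rewrite /b /q !mulr_sumr -!big_split; apply: eq_bigr => j _ /=.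
    by rewrite sg; ring.
  by rewrite lerDr.
have b0 : 0 <= b.
  rewrite leNgt; apply/negP => bneg.
  have d0 : 0 < q - b by rewrite ltr_wpDl // oppr_gt0.
  (* The shift by [- b] in the denominator keeps the time at most [1] and covers
     the case [q = 0]. *)
  have t01 : 0 <= - b / (q - b) <= 1.
    apply/andP; split; first by rewrite divr_ge0 ?ltW // oppr_gt0.
    by rewrite ler_pdivrMr // mul1r lerDr.
  have := step _ t01.
  have -> : 2 * (- b / (q - b)) * b + (- b / (q - b)) ^+ 2 * q
      = - (b ^+ 2 * (q - 2 * b)) / (q - b) ^+ 2.
    by field; rewrite gt_eqF.
  rewrite mulNr oppr_ge0 leNgt => /negP; apply.
  rewrite divr_gt0 ?exprn_gt0 // mulr_gt0 //; first by rewrite lt_def sqrf_eq0 lt_eqF ?sqr_ge0.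
  by rewrite ltr_wpDl // oppr_gt0 nmulr_llt0 //; lra.
have -> : \sum_j g j u * g j v = b + \sum_j g j u ^+ 2.
  by rewrite /b -big_split; apply: eq_bigr => j _ /=; rewrite gB; ring.
by rewrite lerDr.
Qed.

(** Density matrices supported on an eigenspace of [S]. *)
Definition density d (S : 'M[R]_d) (a : R) (Q : 'M[R]_d) :=
  [/\ psdmx Q, \tr Q = 1 & Q *m S = a *: Q].

(** Positivity on the sum and the difference of two basis vectors. *)
Lemma density_entry_le1 d (S : 'M[R]_d) a Q i j : density S a Q -> `|Q i j| <= 1.
Proof.
move=> [[sQ pQ] tQ _].
have dg k : 0 <= Q k k by rewrite -delta_qf.
have d1 k : Q k k <= 1.
  by rewrite -tQ /mxtrace (bigD1 k) //= lerDl sumr_ge0.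
have Qji : Q j i = Q i j by rewrite -[in LHS]sQ mxE.
have E (c : R) : qf Q (delta_mx i 0 + c *: delta_mx j 0 : 'cV[R]_d)
    = Q i i + 2 * c * Q i j + c ^+ 2 * Q j j.
  rewrite [(_ + _)^T]raddfD /= [(_ *: _)^T]linearZ /= !trmx_delta.
  rewrite !mulmxDl !mulmxDr -!scalemxAl -!scalemxAr -!rowE -!colE !mxE Qji; ring.
have := pQ (delta_mx i 0 + 1 *: delta_mx j 0); have := pQ (delta_mx i 0 + (-1) *: delta_mx j 0).
rewrite !E; have := d1 i; have := d1 j => *.
by rewrite ler_norml; apply/andP; split; lra.
Qed.

(** Being a density supported on an eigenspace is a family of linear equations
    and weak linear inequalities on the entries. *)
Lemma closed_density N d (q : 'rV[R]_N -> 'M[R]_d) (S : 'M[R]_d) a :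
  linear q -> closed [set w | density S a (q w)].
Proof.
move=> lq.
have -> : [set w | density S a (q w)] =
    [set w | forall ij : 'I_d * 'I_d, q w ij.1 ij.2 - q w ij.2 ij.1 = 0] `&`
    [set w | forall v : 'cV[R]_d, 0 <= qf (q w) v] `&`
    [set w | forall i : unit, \tr (q w) = 1] `&`
    [set w | forall ij : 'I_d * 'I_d, (q w *m S) ij.1 ij.2 - a * q w ij.1 ij.2 = 0].
  apply/seteqP; split=> w /=.
    move=> [[sQ pQ] tQ EQ]; split; [split; [split|]|] => //.
      by move=> [i j] /=; rewrite -{1}sQ mxE subrr.
    by move=> [i j] /=; rewrite EQ mxE subrr.
  move=> [[[sQ pQ] tQ] EQ]; split.
  - split=> //; apply/matrixP => i j; rewrite mxE; apply/eqP; rewrite -subr_eq0.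
    exact/eqP/(sQ (j, i)).
  - exact: tQ tt.
  apply/matrixP => i j; rewrite [RHS]mxE; apply/eqP; rewrite -subr_eq0.
  exact/eqP/(EQ (i, j)).
apply: closedI; first apply: closedI; first apply: closedI.
- by apply: closed_scalar_eq => -[i j] c u v /=; rewrite lq !mxE; ring.
- by apply: closed_scalar_ge => x c u v; rewrite lq qfD qf_scale.
- by apply: closed_scalar_eq => _ c u v; rewrite lq mxtraceD mxtraceZ.
apply: closed_scalar_eq => -[i j] c u v /=.
by rewrite lq mulmxDl -scalemxAl !mxE; ring.
Qed.

Lemma psd_convex d (Q Q' : 'M[R]_d) t : psdmx Q -> psdmx Q' -> 0 <= t <= 1 ->
  psdmx (t *: (Q' - Q) + Q).
Proof.
move=> [sQ pQ] [sQ' pQ'] /andP[t0 t1]; split=> [|v].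
  by rewrite linearD linearZ /= linearB /= sQ sQ'.
rewrite qfD qf_scale qfD -scaleN1r qf_scale.
have -> : t * (qf Q' v + -1 * qf Q v) + qf Q v = t * qf Q' v + (1 - t) * qf Q v by ring.
by rewrite addr_ge0 // mulr_ge0 // subr_ge0.
Qed.

Lemma density_convex d (S : 'M[R]_d) a Q Q' t :
  density S a Q -> density S a Q' -> 0 <= t <= 1 ->
  density S a (t *: (Q' - Q) + Q).
Proof.
move=> [pQ tQ EQ] [pQ' tQ' EQ'] t01; split; first exact: psd_convex.
  by rewrite mxtraceD mxtraceZ raddfB /= tQ tQ' subrr mulr0 add0r.
rewrite mulmxDl -scalemxAl mulmxBl EQ EQ'.
by apply/matrixP => i j; rewrite !mxE; ring.
Qed.

Lemma density_unit d (S : 'M[R]_d) a (v : 'cV[R]_d) : S^T = S ->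
  v^T *m v = 1%:M -> S *m v = a *: v -> density S a (v *m v^T).
Proof.
move=> sS vv Sv; split.
- split=> [|x]; first by rewrite trmx_mul trmxK.
  rewrite mulmxA -mulmxA.
  have -> : x^T *m v = (v^T *m x)^T by rewrite trmx_mul trmxK.
  exact: sqnorm_ge0.
- by rewrite mxtrace_mulC vv mxtrace_scalar mulr1n.
by rewrite -mulmxA -[in LHS]sS -trmx_mul Sv linearZ /= scalemxAr.
Qed.

(** If no balanced pair of densities exists, projecting the origin onto the
    compact convex set of partial traces of [Qm - Qp] produces a tangent
    direction that is uniformly larger on the top eigenspace than on the bottom
    one. *)
Lemma unbalanced_direction m n (S : 'M[R]_(n * m)) a b :
  (exists Q, density S a Q) -> (exists Q, density S b Q) ->
  ~ (exists Qp Qm, [/\ density S a Qp, density S b Qm,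
       ptraceB (Qm - Qp) = 0 & ptraceA (Qm - Qp) = 0]) ->
  exists (B : 'M[R]_n) (A : 'M[R]_m) (rho : R),
    [/\ B^T = B, A^T = A, 0 < rho & forall Qp Qm, density S a Qp -> density S b Qm ->
      rho <= \tr ((B *t 1%:M + 1%:M *t A) *m (Qp - Qm))].
Proof.
move=> [Q0 dQ0] [Q1 dQ1] unb; set d := (n * m)%N in S Q0 dQ0 Q1 dQ1 unb *.
(* A pair of matrices is flattened into one row vector, so that compactness can
   be tested on coordinates. *)
pose qp (w : 'rV[R]_(d * d + d * d)) : 'M[R]_d := vec_mx (lsubmx w).
pose qm (w : 'rV[R]_(d * d + d * d)) : 'M[R]_d := vec_mx (rsubmx w).
have lqp : linear qp by move=> c u v; rewrite /qp !linearP.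
have lqm : linear qm by move=> c u v; rewrite /qm !linearP.
pose enc (P M : 'M[R]_d) := row_mx (mxvec P) (mxvec M) : 'rV[R]_(d * d + d * d).
have qpE P M : qp (enc P M) = P by rewrite /qp /enc row_mxKl mxvecK.
have qmE P M : qm (enc P M) = M by rewrite /qm /enc row_mxKr mxvecK.
pose K := [set w | density S a (qp w)] `&` [set w | density S b (qm w)].
pose J := (('I_n * 'I_n) + ('I_m * 'I_m))%type.
pose g (j : J) w : R := match j with
  | inl pq => ptraceA (qm w - qp w) pq.1 pq.2
  | inr ij => ptraceB (qm w - qp w) ij.1 ij.2 end.
have sg j : scalar (g j).
  move=> c u v; have E : qm (c *: u + v) - qp (c *: u + v)
      = c *: (qm u - qp u) + (qm v - qp v).
    by rewrite lqm lqp; apply/matrixP => k l; rewrite !mxE; ring.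
  by case: j => -[p q] /=; rewrite E ?ptraceA_linear ?ptraceB_linear mxE [X in X + _]mxE.
have K0 : K !=set0 by exists (enc Q0 Q1); split; rewrite /= ?qpE ?qmE.
have cK : closed K by apply: closedI; exact: closed_density.
have bK w : K w -> forall k, `|w 0 k| <= 1.
  move=> [Kp Km] k; rewrite -(hsubmxK w) mxE; case: splitP => k' _.
    case: (mxvec_indexP k') => i j; have := density_entry_le1 i j Kp.
    by rewrite /qp mxE.
  case: (mxvec_indexP k') => i j; have := density_entry_le1 i j Km.
  by rewrite /qm mxE.
have convK u v t : K u -> K v -> 0 <= t <= 1 -> K (t *: (v - u) + u).
  move=> [Kpu Kmu] [Kpv Kmv] t01; split=> /=.
    rewrite lqp; have -> : qp (v - u) = qp v - qp u by rewrite addrC -scaleN1r lqp scaleN1r addrC.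
    exact: density_convex.
  rewrite lqm; have -> : qm (v - u) = qm v - qm u by rewrite addrC -scaleN1r lqm scaleN1r addrC.
  exact: density_convex.
have [u [Kpu Kmu] minu] := convex_nearest_origin sg K0 cK bK convK.
set D := qm u - qp u.
have sD : D^T = D.
  by move: (Kpu) (Kmu) => /= [[sp _] _ _] [[sm _] _ _]; rewrite linearB /= sp sm.
have sA : (ptraceA D)^T = ptraceA D by rewrite ptraceA_tr sD.
have sB : (ptraceB D)^T = ptraceB D by rewrite ptraceB_tr sD.
have gE w : \sum_j g j u * g j w
    = \tr ((ptraceA D *t 1%:M + 1%:M *t ptraceB D) *m (qm w - qp w)).
  rewrite tangent_trace big_sumType /=; congr (_ + _).
    rewrite mxtraceM pair_big /=; apply: eq_bigr => -[p q] _ /=.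
    by rewrite -/D -[in X in X * _]sA mxE mulrC.
  rewrite mxtraceM pair_big /=; apply: eq_bigr => -[p q] _ /=.
  by rewrite -/D -[in X in X * _]sB mxE mulrC.
exists (- ptraceA D), (- ptraceB D), (\sum_j g j u ^+ 2); split.
- by rewrite linearN /= sA.
- by rewrite linearN /= sB.
- rewrite lt_def sumr_ge0 ?andbT => [|j _]; last exact: sqr_ge0.
  apply/eqP => /eqP; rewrite psumr_eq0 => [/allP g0|j _]; last exact: sqr_ge0.
  have {}g0 j : g j u = 0.
    by have := g0 j (mem_index_enum _); rewrite sqrf_eq0 => /eqP.
  apply: unb; exists (qp u), (qm u); split=> //; apply/matrixP => i j; rewrite [RHS]mxE.
    exact: g0 (inr (i, j)).
  exact: g0 (inl (i, j)).
move=> Qp Qm dQp dQm; have := minu (enc Qp Qm); rewrite gE qpE qmE.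
have -> : (- ptraceA D) *t 1%:M + 1%:M *t (- ptraceB D)
    = - (ptraceA D *t 1%:M + 1%:M *t ptraceB D) :> 'M[R]_(n * m).
  by apply/matrixP => k l; rewrite !mxE; ring.
by rewrite mulNmx -mulmxN opprB; apply; split; rewrite /= ?qpE ?qmE.
Qed.

End Compactness.

(** * Descent when balance fails *)

Section Necessity.
Variable R : realType.

(** Young's inequality, entry by entry; the weight [e] lets the cost be moved
    from one vector to the other. *)
Lemma bilinear_bound d (M : 'M[R]_d) : exists2 c, 0 < c &
  forall (e : R) (x y : 'cV[R]_d), 0 < e ->
  `|(x^T *m M *m y) 0 0| <= c * (e * (x^T *m x) 0 0 + e^-1 * (y^T *m y) 0 0).
Proof.
pose c := \sum_i \sum_j `|M i j| + 1.
have c1 : 0 <= \sum_i \sum_j `|M i j| by apply: sumr_ge0 => i _; apply: sumr_ge0.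
exists c; first by rewrite /c ltr_wpDl.
move=> e x y e0; have eV0 : 0 < e^-1 by rewrite invr_gt0.
set X := (x^T *m x) 0 0; set Y := (y^T *m y) 0 0.
have xX i : x i 0 ^+ 2 <= X.
  by rewrite /X sqnormE (bigD1 i) //= lerDl sumr_ge0 // => j _; rewrite sqr_ge0.
have yY i : y i 0 ^+ 2 <= Y.
  by rewrite /Y sqnormE (bigD1 i) //= lerDl sumr_ge0 // => j _; rewrite sqr_ge0.
have XY0 : 0 <= e * X + e^-1 * Y.
  by rewrite addr_ge0 // mulr_ge0 ?sqnorm_ge0 // ltW.
have xy i j : `|x i 0 * y j 0| <= e * X + e^-1 * Y.
  have h : `|x i 0 * y j 0| <= e * x i 0 ^+ 2 + e^-1 * y j 0 ^+ 2.
    have [s s0 Es] : exists2 s : R, 0 < s & e = s ^+ 2.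
      by exists (Num.sqrt e); rewrite ?sqrtr_gt0 // sqr_sqrtr // ltW.
    set p := x i 0; set q := y j 0.
    have E1 : e * p ^+ 2 + e^-1 * q ^+ 2 - 2 * (p * q) = (s * p - s^-1 * q) ^+ 2.
      by rewrite Es; field; rewrite gt_eqF.
    have E2 : e * p ^+ 2 + e^-1 * q ^+ 2 + 2 * (p * q) = (s * p + s^-1 * q) ^+ 2.
      by rewrite Es; field; rewrite gt_eqF.
    have := sqr_ge0 (s * p - s^-1 * q); have := sqr_ge0 (s * p + s^-1 * q).
    rewrite -E1 -E2 => h1 h2.
    have h3 : 0 <= e * p ^+ 2 + e^-1 * q ^+ 2.
      by rewrite addr_ge0 // mulr_ge0 ?sqr_ge0 // ltW.
    by rewrite ler_norml; apply/andP; split; lra.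
  apply: le_trans h _; apply: lerD; rewrite ler_wpM2l // ltW //.
have -> : (x^T *m M *m y) 0 0 = \sum_i \sum_j M i j * (x i 0 * y j 0).
  rewrite -mulmxA mxE; apply: eq_bigr => i _; rewrite !mxE mulr_sumr.
  by apply: eq_bigr => j _; ring.
apply: le_trans (ler_norm_sum _ _ _) _.
rewrite /c mulrDl mul1r -[leLHS]addr0; apply: lerD => //.
rewrite mulr_suml; apply: ler_sum => i _.
apply: le_trans (ler_norm_sum _ _ _) _; rewrite mulr_suml; apply: ler_sum => j _.
by rewrite normrM ler_wpM2l.
Qed.

(** Any lower bound for the nonzero eigenvalues serves as [g].  The inverse of
    one plus the sum of their inverses is such a bound, also when there are
    none. *)
Lemma psd_kernel_split d (T : 'M[R]_d) : psdmx T ->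
  exists2 g, 0 < g & forall v : 'cV[R]_d, exists v1 v2,
    [/\ v = v1 + v2, T *m v1 = 0 & g * (v2^T *m v2) 0 0 <= qf T v].
Proof.
move=> /psd_spectral [U [t [UU -> t0]]].
pose g := (\sum_(i | t 0 i != 0) (t 0 i)^-1 + 1)^-1.
have s0 : 0 <= \sum_(i | t 0 i != 0) (t 0 i)^-1.
  by apply: sumr_ge0 => i _; rewrite invr_ge0.
have g0 : 0 < g by rewrite invr_gt0 ltr_wpDl.
have gt i : t 0 i != 0 -> g <= t 0 i.
  move=> ti; have ti0 : 0 < t 0 i by rewrite lt_def ti t0.
  rewrite -[leRHS]invrK lef_pV2 ?posrE ?invr_gt0 ?ltr_wpDl //.
  rewrite (bigD1 i) //= -addrA lerDl addr_ge0 // sumr_ge0 // => j _.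
  by rewrite invr_ge0.
exists g => // v; pose y := U *m v.
pose y1 := \col_i (if t 0 i == 0 then y i 0 else 0) : 'cV[R]_d.
pose y2 := \col_i (if t 0 i == 0 then 0 else y i 0) : 'cV[R]_d.
have Ey : y = y1 + y2.
  by apply/colP => i; rewrite [RHS]mxE /y1 /y2 !mxE; case: eqP; rewrite ?addr0 ?add0r.
exists (U^T *m y1), (U^T *m y2); split.
- by rewrite -mulmxDr -Ey /y mulmxA UU mul1mx.
- rewrite -!mulmxA [U *m (U^T *m _)]mulmxA (mulmx1C UU) mul1mx mul_diag_mx.
  suff -> : \matrix_(i, j) (t 0 i * y1 i j) = 0 by rewrite mulmx0.
  apply/matrixP => i j; rewrite ord1 !mxE.
  by case: eqP => [->|_]; rewrite ?mul0r ?mulr0.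
rewrite qf_congr -/y qf_diag trmx_mul trmxK mulmxA (orthoK UU) sqnormE mulr_sumr.
apply: ler_sum => i _; rewrite [y2 i 0]mxE; case: eqP => [->|/eqP ti].
  by rewrite expr0n mulr0 mul0r.
by rewrite ler_wpM2r ?sqr_ge0 // gt.
Qed.

(** On the kernel of [T] the first order term is positive, and on its complement
    the spectral gap [g] dominates.  Young's inequality with the weight
    [de / (4 c)] charges the cross terms to the complement, except for half of
    the margin [de]. *)
Lemma psd_perturbation d (T X Y : 'M[R]_d) (de : R) :
  psdmx T -> 0 < de ->
  (forall v : 'cV[R]_d, T *m v = 0 -> de * (v^T *m v) 0 0 <= qf X v) ->
  exists2 t0, 0 < t0 & forall t, 0 < t <= t0 -> forall v : 'cV[R]_d,
    0 <= qf T v + t * qf X v + t ^+ 2 * qf Y v.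
Proof.
move=> pT de0 HX; have [g g0 split] := psd_kernel_split pT.
have [c c0 bX] := bilinear_bound X; have [c' c'0 bY] := bilinear_bound Y.
have [e e0 ce] : exists2 e, 0 < e & c * e = de / 4.
  exists (de / (4 * c)); first by rewrite divr_gt0 // mulr_gt0.
  by field; rewrite gt_eqF.
pose C := 2 * c * e^-1 + 2 * c.
have eV0 : 0 < e^-1 by rewrite invr_gt0.
have C0 : 0 < C by rewrite addr_gt0 // !mulr_gt0.
pose t1 := de / (8 * c'); pose t2 := g / (C + 4 * c').
have t10 : 0 < t1 by rewrite divr_gt0 // mulr_gt0.
have Cc0 : 0 < C + 4 * c' by rewrite addr_gt0 // mulr_gt0.
have t20 : 0 < t2 by rewrite divr_gt0.
exists (Num.min 1 (Num.min t1 t2)); first by rewrite !lt_min ltr01 t10 t20.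
move=> t /andP[tp]; rewrite !le_min => /andP[tl1 /andP[tlt1 tlt2]] v.
have [v1 [v2 [Ev Tv1 gv2]]] := split v.
have h1 := HX v1 Tv1.
have hb12 := bX e v1 v2 e0; have hb21 := bX e^-1 v2 v1 eV0.
have hb22 := bX 1 v2 v2 ltr01; have hY := bY 1 v v ltr01.
rewrite invrK in hb21; rewrite invr1 in hb22 hY.
have EX : qf X v = qf X v1 + (v1^T *m X *m v2) 0 0 + (v2^T *m X *m v1) 0 0 + qf X v2.
  rewrite Ev [(v1 + v2)^T]raddfD /= !mulmxDl !mulmxDr !mxE; ring.
have EN : (v^T *m v) 0 0 <= 2 * ((v1^T *m v1) 0 0 + (v2^T *m v2) 0 0).
  rewrite Ev !sqnormE -big_split mulr_sumr; apply: ler_sum => i _ /=.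
  rewrite mxE; have := sqr_ge0 (v1 i 0 - v2 i 0); move: (v1 i 0) (v2 i 0) => p q h.
  have -> : (p + q) ^+ 2 = 2 * (p ^+ 2 + q ^+ 2) - (p - q) ^+ 2 by ring.
  by lra.
rewrite EX; have n1 := sqnorm_ge0 v1; have n2 := sqnorm_ge0 v2.
move: h1 hb12 hb21 hb22 hY EN gv2 n1 n2; clear EX.
move: ((v^T *m v) 0 0) (qf T v) (qf X v1) (qf X v2) (qf Y v)
  ((v1^T *m X *m v2) 0 0) ((v2^T *m X *m v1) 0 0).
move: ((v1^T *m v1) 0 0) ((v2^T *m v2) 0 0) => a b n qT x1 x2 y x12 x21.
rewrite !ler_norml => h1 /andP[h12 _] /andP[h21 _] /andP[h22 _] /andP[hy _] hn hg a0 b0.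
have tc' : t * (8 * c') <= de by rewrite -ler_pdivlMr ?mulr_gt0.
have tC : t * (C + 4 * c') <= g by rewrite -ler_pdivlMr.
have l12 : - (c * (e * a + e^-1 * b)) = - (de / 4 * a) - c * e^-1 * b.
  by rewrite mulrDr !mulrA ce; ring.
have l21 : - (c * (e^-1 * b + e * a)) = - (de / 4 * a) - c * e^-1 * b.
  by rewrite mulrDr !mulrA ce; ring.
rewrite l12 in h12; rewrite l21 in h21.
have low : de / 2 * a - C * b <= x1 + x12 + x21 + x2.
  rewrite /C; lra.
have lowY : - (4 * c' * (a + b)) <= y.
  have : c' * (1 * n + 1 * n) <= 4 * c' * (a + b).
    have -> : 4 * c' * (a + b) = c' * (4 * (a + b)) by ring.
    by rewrite ler_pM2l //; lra.
  by lra.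
have s1 : t * (de / 2 * a - C * b) <= t * (x1 + x12 + x21 + x2).
  by rewrite ler_wpM2l // ltW.
have t2p : 0 < t ^+ 2 by rewrite exprn_gt0.
have s2 : t ^+ 2 * - (4 * c' * (a + b)) <= t ^+ 2 * y by rewrite ler_wpM2l // ltW.
have k1 : 0 <= t * a * (de - t * (8 * c')).
  by rewrite mulr_ge0 ?subr_ge0 // mulr_ge0 // ltW.
have t2t : t ^+ 2 <= t by rewrite expr2 ler_piMr // ltW.
have k2 : t ^+ 2 * (4 * c') * b <= t * (4 * c') * b.
  by rewrite ler_wpM2r // ler_wpM2r // mulr_ge0 // ltW.
have k3 : 0 <= b * (g - t * (C + 4 * c')) by rewrite mulr_ge0 ?subr_ge0.
have I1 : t * (de / 2 * a - C * b) + t ^+ 2 * - (4 * c' * (a + b))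
  = t * a * (de - t * (8 * c')) / 2 - t * C * b - t ^+ 2 * (4 * c') * b.
  by field.
have I3 : b * (g - t * (C + 4 * c')) = g * b - t * C * b - t * (4 * c') * b by ring.
rewrite I3 in k3; lra.
Qed.

Lemma eigen_qf d (S : 'M[R]_d) a (v : 'cV[R]_d) : S *m v = a *: v ->
  qf S v = a * (v^T *m v) 0 0.
Proof. by move=> Sv; rewrite -mulmxA Sv -scalemxAr mxE. Qed.

(** A tangent direction separating the top eigenspace from the bottom one
    strictly decreases the condition number: moving along it for a time [t]
    divides the largest generalized eigenvalue by at least [1 + t k1] and the
    smallest one by at most [1 + t k2], with [k2 < k1].  The curve
    [(1 + t B) *t (1 + t A)] stays in the family and has only one term of second
    order. *)
Lemma kappa_descent m n (S : 'M[R]_(n * m)) (B : 'M[R]_n) (A : 'M[R]_m) (c1 c2 : R) :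
  (0 < n * m)%N -> pdmx S -> B^T = B -> A^T = A -> c2 < c1 ->
  (forall v : 'cV[R]_(n * m), S *m v = eigmax S *: v ->
    c1 * (v^T *m v) 0 0 <= qf (B *t 1%:M + 1%:M *t A) v) ->
  (forall v : 'cV[R]_(n * m), S *m v = eigmin S *: v ->
    qf (B *t 1%:M + 1%:M *t A) v <= c2 * (v^T *m v) 0 0) ->
  exists2 G, kron m n G & kappa G S < kappa 1%:M S.
Proof.
move=> d0 pS sB sA c21 Hp Hm; have [sS _] := pS.
have lm0 := eigmin_gt0 d0 pS; have lM0 := eigmax_gt0 d0 pS.
have [_ _ _] := extreme_geneigenvalues d0 (pd1 R _) pS.
have -> : kappa 1%:M S = eigmax S / eigmin S by rewrite /kappa eigmaxE // eigminE.
rewrite -eigmaxE // -eigminE //.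
move: Hp Hm lm0 lM0; set lM := eigmax S; set lm := eigmin S.
set X := _ *t _ + _ => Hp Hm lm0 lM0 bS.
pose Y := B *t A.
have [k1 [k2 [k1c k2c k21]]] : exists k1 k2, [/\ k1 < c1, c2 < k2 & k2 < k1].
  by exists ((2 * c1 + c2) / 3), ((c1 + 2 * c2) / 3); split; lra.
have pT1 : psdmx (lM%:M - S).
  split=> [|v]; first by rewrite linearB /= tr_scalar_mx sS.
  rewrite qfD -scaleN1r qf_scale -scalemx1 qf_scale mulN1r subr_ge0.
  by have /andP[] := bS v.
have pT2 : psdmx (S - lm%:M).
  split=> [|v]; first by rewrite linearB /= tr_scalar_mx sS.
  rewrite qfD -scaleN1r -scalemx1 !qf_scale mulN1r subr_ge0.
  by have /andP[] := bS v.
have [| |t1 t10 P1] := @psd_perturbation _ _ (lM *: X - k1 *: S) (lM *: Y) (lM * (c1 - k1)) pT1.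
- by rewrite mulr_gt0 // subr_gt0.
- move=> v; rewrite mulmxBl mul_scalar_mx => /eqP; rewrite subr_eq0 eq_sym => /eqP Sv.
  rewrite qfD -scaleNr !qf_scale (eigen_qf Sv).
  by have := Hp v Sv; rewrite -(ler_pM2l lM0); lra.
have [| |t2 t20 P2] := @psd_perturbation _ _ (k2 *: S - lm *: X) (- lm *: Y) (lm * (k2 - c2)) pT2.
- by rewrite mulr_gt0 // subr_gt0.
- move=> v; rewrite mulmxBl mul_scalar_mx => /eqP; rewrite subr_eq0 => /eqP Sv.
  rewrite qfD -scaleNr !qf_scale (eigen_qf Sv).
  by have := Hm v Sv; rewrite -(ler_pM2l lm0); lra.
have pdt k (M : 'M[R]_k) : M^T = M ->
    exists2 t0, 0 < t0 & forall t, 0 < t <= t0 -> pdmx (1%:M + t *: M).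
  move=> sM; have h0 : 0 < 1 / 2 :> R by lra.
  have [|||t0 t00 P] := @psd_perturbation _ ((1 / 2) *: 1%:M : 'M[R]_k) M 0 1.
  + split=> [|v]; first by rewrite linearZ /= trmx1.
    by rewrite qf_scale qf1 mulr_ge0 ?sqnorm_ge0 // ltW.
  + exact: ltr01.
  + move=> v; rewrite -scalemxAl mul1mx => /eqP.
    by rewrite scaler_eq0 gt_eqF //= => /eqP ->; rewrite !mulmx0 mxE mulr0.
  exists t0 => // t tt; split=> [|v nv]; first by rewrite linearD linearZ /= trmx1 sM.
  have := P t tt v; rewrite mulmx0 mul0mx [X in _ + _ * X]mxE mulr0 addr0.
  rewrite qfD !qf_scale qf1; have := sqnorm_gt0 nv; lra.
have [t3 t30 P3] := pdt _ _ sB; have [t4 t40 P4] := pdt _ _ sA.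
pose t5 := (`|k1| + `|k2| + 1)^-1.
have w0 : 0 < `|k1| + `|k2| + 1 by rewrite ltr_wpDl // addr_ge0.
have t50 : 0 < t5 by rewrite invr_gt0.
pose t := Num.min t1 (Num.min t2 (Num.min t3 (Num.min t4 (t5 / 2)))).
have tp : 0 < t by rewrite !lt_min t10 t20 t30 t40 divr_gt0.
have : t <= t by []; rewrite {2}/t !le_min => /andP[l1 /andP[l2 /andP[l3 /andP[l4 l5]]]].
have kt (k : R) : `|k| <= `|k1| + `|k2| -> 0 < 1 + t * k.
  move=> kk; have : `|t * k| <= 1 / 2.
    rewrite normrM (gtr0_norm tp); apply: (@le_trans _ _ (t5 / 2 * (`|k1| + `|k2| + 1))).
      by apply: ler_pM => //; [exact: ltW | lra].
    by rewrite /t5 mulrAC mulVf ?gt_eqF.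
  by rewrite ler_norml => /andP[h _]; lra.
have kt1 : 0 < 1 + t * k1 by apply: kt; rewrite lerDl.
have kt2 : 0 < 1 + t * k2 by apply: kt; rewrite lerDr.
pose G := (1%:M + t *: B) *t (1%:M + t *: A).
have kG : kron m n G.
  exists (1%:M + t *: A), (1%:M + t *: B); split=> //.
    by apply: P4; rewrite tp.
  by apply: P3; rewrite tp.
have pG := kron_pd kG.
have EG : G = 1%:M + t *: X + (t ^+ 2) *: Y.
  rewrite /G /X /Y -tensmx11; apply/matrixP => i j; rewrite !mxE; ring.
clearbody G X Y.
have qG v : qf G v = (v^T *m v) 0 0 + t * qf X v + t ^+ 2 * qf Y v.
  by rewrite EG !qfD !qf_scale qf1.
exists G => //.
have [gs gi i0 _] := extreme_geneigenvalues d0 pG pS.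
have up : sup (geneigenvalues G S) <= lM / (1 + t * k1).
  apply: geneigenvalue_le gs => // v; rewrite mulrAC ler_pdivlMr //.
  have tt1 : 0 < t <= t1 by rewrite tp.
  have := P1 t tt1 v; rewrite qG !qfD -scaleNr -[- S]scaleN1r -scalemx1 !qf_scale qf1.
  by lra.
have lo : lm / (1 + t * k2) <= inf (geneigenvalues G S).
  apply: geneigenvalue_ge gi => // v; rewrite mulrAC ler_pdivrMr //.
  have tt2 : 0 < t <= t2 by rewrite tp.
  have := P2 t tt2 v; rewrite qG !qfD -!scaleNr -[- _%:M]scaleN1r -scalemx1 !qf_scale qf1.
  by lra.
have lo0 : 0 < lm / (1 + t * k2) by rewrite divr_gt0.
rewrite /kappa; apply: (@le_lt_trans _ _ (lM / (1 + t * k1) / (lm / (1 + t * k2)))).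
  apply: ler_pM => //; rewrite ?invr_ge0 ?(ltW i0) //.
    apply: ltW; apply: lt_le_trans i0 _; apply: geneigenvalue_le gi => // v.
    by have [_ _ _ /(_ v) /andP[]] := extreme_geneigenvalues d0 pG pS.
  by rewrite lef_pV2 ?posrE.
have -> : lM / (1 + t * k1) / (lm / (1 + t * k2)) = lM / lm * ((1 + t * k2) / (1 + t * k1)).
  by field; rewrite !gt_eqF.
rewrite -[ltRHS]mulr1 ltr_pM2l ?divr_gt0 // ltr_pdivrMr // mul1r ltrD2l.
by rewrite ltr_pM2l.
Qed.

End Necessity.

(** * A right-angle comparison theorem *)

Section LogComparison.
Variable R : realType.

Lemma ln_prod (I : finType) (x : I -> R) : (forall i, 0 < x i) ->
  ln (\prod_i x i) = \sum_i ln (x i).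
Proof.
move=> x0; suff [] : 0 < \prod_i x i /\ ln (\prod_i x i) = \sum_i ln (x i) by [].
elim/big_rec2: _ => [|i y z _ [z0 Ez]]; first by rewrite ln1 ltr01.
by rewrite mulr_gt0 // lnM ?posrE // Ez.
Qed.

Lemma spectral_det d (U : 'M[R]_d) (e : 'rV[R]_d) : U^T *m U = 1%:M ->
  \det (U^T *m diag_mx e *m U) = \prod_i e 0 i.
Proof.
move=> UU; rewrite !det_mulmx mulrAC -det_mulmx UU det1 mul1r.
exact: det_diag.
Qed.

Lemma ln_det_spectral d (U : 'M[R]_d) (e : 'rV[R]_d) : U^T *m U = 1%:M ->
  (forall i, 0 < e 0 i) ->
  ln (\det (U^T *m diag_mx e *m U)) = \sum_i ln (e 0 i).
Proof. by move=> UU e0; rewrite spectral_det // ln_prod. Qed.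

(** Diagonal entries of a spectral form in a frame are averages of its
    eigenvalues, weighted by squared overlaps. *)
Lemma congr_diag_entry d k (U : 'M[R]_d) (h : 'rV[R]_d) (W : 'M[R]_(d, k)) a :
  (W^T *m (U^T *m diag_mx h *m U) *m W) a a = \sum_j h 0 j * (U *m W) j a ^+ 2.
Proof.
rewrite -congr_mul mul_mx_diag mxE; apply: eq_bigr => j _; rewrite !mxE.
by rewrite mulrAC mulrC expr2.
Qed.

Lemma orthonormal_col d k (U : 'M[R]_d) (W : 'M[R]_(d, k)) a :
  U^T *m U = 1%:M -> W^T *m W = 1%:M -> \sum_j (U *m W) j a ^+ 2 = 1.
Proof.
move=> UU WW; have -> : \sum_j (U *m W) j a ^+ 2 = ((U *m W)^T *m (U *m W)) a a.
  by rewrite [RHS]mxE; apply: eq_bigr => j _; rewrite [X in X * _]mxE expr2.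
by rewrite trmx_mul mulmxA -[W^T *m U^T *m U]mulmxA UU mulmx1 WW mxE eqxx.
Qed.

(** Rotating an orthonormal frame inside its span makes the compression of [N]
    diagonal. *)
Lemma compression_frame d k (N : 'M[R]_d) (V : 'M[R]_(d, k)) :
  pdmx N -> V^T *m V = 1%:M ->
  exists (F : 'M[R]_k) (eta : 'rV[R]_k),
  [/\ F^T *m F = 1%:M, V^T *m N *m V = F^T *m diag_mx eta *m F,
      (forall a, 0 < eta 0 a),
      (V *m F^T)^T *m (V *m F^T) = 1%:M &
      (V *m F^T)^T *m N *m (V *m F^T) = diag_mx eta].
Proof.
move=> pN VV; have pK : pdmx (V^T *m N *m V).
  have [sN pos] := pN; split=> [|v nv]; first by rewrite !trmx_mul trmxK sN mulmxA.
  rewrite qf_congr; apply: pos; apply: contra_neq nv => E.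
  by rewrite -[v]mul1mx -VV -mulmxA E mulmx0.
have [F [eta [FF EK eta0]]] := pd_spectral pK.
exists F, eta; split=> //.
  by rewrite trmx_mul trmxK mulmxA -[F *m V^T *m V]mulmxA VV mulmx1 (mulmx1C FF).
by rewrite congr_mul trmxK EK !mulmxA (mulmx1C FF) mul1mx (orthoK FF).
Qed.

(** In a frame diagonalizing the compression, its eigenvalues are averages of
    those of the matrix, so the concavity of [ln] applies to each of them. *)
Lemma ln_det_compression d k (U : 'M[R]_d) (g : 'rV[R]_d) (V : 'M[R]_(d, k)) :
  U^T *m U = 1%:M -> (forall i, 0 < g 0 i) -> V^T *m V = 1%:M ->
  \tr (V^T *m (U^T *m diag_mx (map_mx (@ln R) g) *m U) *m V)
    <= ln (\det (V^T *m (U^T *m diag_mx g *m U) *m V)).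
Proof.
move=> UU g0 VV.
have pG : pdmx (U^T *m diag_mx g *m U).
  by apply: pd_congr; [exact: orthogonal_unit | exact: pd_diag].
have [F [eta [FF EK eta0 WW WGW]]] := compression_frame pG VV.
rewrite EK ln_det_spectral //; set W := V *m F^T in WW WGW.
set X := U^T *m diag_mx (map_mx _ g) *m U.
have -> : \tr (V^T *m X *m V) = \tr (W^T *m X *m W).
  by rewrite congr_mul trmxK [RHS]mxtrace_mulC [F^T *m _]mulmxA FF mul1mx.
apply: ler_sum => a _; rewrite congr_diag_entry.
under eq_bigr do rewrite mxE.
have -> : eta 0 a = \sum_j g 0 j * (U *m W) j a ^+ 2.
  by rewrite -congr_diag_entry WGW mxE eqxx.
apply: (jensen_ln _ _ g0).2 => [j|]; first exact: sqr_ge0.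
exact: orthonormal_col.
Qed.

(** The tangent of [x * ln x] at [c]. *)
Lemma xlnx_convex (x c : R) : 0 < x -> 0 < c -> x * ln c + x - c <= x * ln x.
Proof.
move=> x0 c0; have := @ln_ge_1subV R (x / c).
rewrite divr_gt0 // => /(_ isT); rewrite ln_div ?posrE // invf_div => h.
have := h; rewrite -(ler_pM2l x0) mulrBr mulrBr mulr1 mulrCA divff ?gt_eqF // mulr1.
lra.
Qed.

Section Flag.
Variables (d : nat) (N N2 : 'M[R]_d).
Hypotheses (pN : pdmx N) (sN2 : N2^T = N2) (N2_sqr : N2 *m N2 = N).

(** Orthogonal projector onto the image of the span of the first [k]
    coordinates under the square root [N2] of [N]. *)
Definition flag_proj k : 'M[R]_d :=
  let W : 'M[R]_(d, k) := pid_mx k in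
  N2 *m W *m invmx (W^T *m N *m W) *m W^T *m N2.

Lemma pid_orthonormal k : (k <= d)%N ->
  (pid_mx k : 'M[R]_(d, k))^T *m (pid_mx k : 'M[R]_(d, k)) = 1%:M.
Proof.
by move=> kd; rewrite tr_pid_mx mul_pid_mx minnn (minn_idPr kd) pid_mx_1.
Qed.

Lemma pid_sub k l : (l <= k <= d)%N ->
  (pid_mx l : 'M[R]_(d, l)) = (pid_mx k : 'M[R]_(d, k)) *m (pid_mx l : 'M[R]_(k, l)).
Proof.
by move=> /andP[lk _]; rewrite mul_pid_mx (minn_idPr lk) (minn_idPr lk).
Qed.

Lemma square_root_unit : N2 \in unitmx.
Proof. by have := pd_unit pN; rewrite -N2_sqr unitmx_mul => /andP[]. Qed.

Lemma compression_unit k : (k <= d)%N ->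
  (pid_mx k : 'M[R]_(d, k))^T *m N *m pid_mx k \in unitmx.
Proof.
move=> kd; have [F [eta [FF -> eta0 _ _]]] := compression_frame pN (pid_orthonormal kd).
by apply: pd_unit; apply: pd_congr; [exact: orthogonal_unit | exact: pd_diag].
Qed.

Lemma flag_proj_tr k : (flag_proj k)^T = flag_proj k.
Proof.
have [sN _] := pN.
by rewrite /flag_proj !trmx_mul trmx_inv !trmx_mul !trmxK sN sN2 !mulmxA.
Qed.

Lemma flag_proj_fix k : (k <= d)%N ->
  flag_proj k *m (N2 *m (pid_mx k : 'M[R]_(d, k))) = N2 *m (pid_mx k : 'M[R]_(d, k)).
Proof.
move=> kd; rewrite /flag_proj; set W := pid_mx k.
have -> : N2 *m W *m invmx (W^T *m N *m W) *m W^T *m N2 *m (N2 *m W)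
  = N2 *m W *m (invmx (W^T *m N *m W) *m (W^T *m (N2 *m N2) *m W)).
  by rewrite !mulmxA.
by rewrite N2_sqr mulVmx ?mulmx1 // compression_unit.
Qed.

Lemma flag_proj_mul k l : (l <= k <= d)%N ->
  flag_proj k *m flag_proj l = flag_proj l /\ flag_proj l *m flag_proj k = flag_proj l.
Proof.
move=> lkd; have /andP[lk kd] := lkd.
have E : flag_proj k *m flag_proj l = flag_proj l.
  have F : flag_proj k *m (N2 *m (pid_mx l : 'M[R]_(d, l))) = N2 *m pid_mx l.
    by rewrite (pid_sub lkd) [N2 *m _]mulmxA mulmxA flag_proj_fix.
  set W : 'M[R]_(d, l) := pid_mx l in F *.
  transitivity (flag_proj k *m (N2 *m W) *m (invmx (W^T *m N *m W) *m W^T *m N2)).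
    by rewrite {2}/flag_proj !mulmxA.
  by rewrite F /flag_proj !mulmxA.
by split=> //; have := congr1 trmx E; rewrite trmx_mul !flag_proj_tr.
Qed.

Lemma flag_proj_trace k : (k <= d)%N -> \tr (flag_proj k) = k%:R.
Proof.
move=> kd; rewrite /flag_proj; set W := pid_mx k.
have -> : N2 *m W *m invmx (W^T *m N *m W) *m W^T *m N2
  = (N2 *m W) *m (invmx (W^T *m N *m W) *m W^T *m N2) by rewrite !mulmxA.
rewrite mxtrace_mulC.
have -> : invmx (W^T *m N *m W) *m W^T *m N2 *m (N2 *m W)
  = invmx (W^T *m N *m W) *m (W^T *m (N2 *m N2) *m W) by rewrite !mulmxA.
by rewrite N2_sqr mulVmx ?mxtrace1 // compression_unit.
Qed.

(** The convexity of [x * ln x] turns the trace of [log N] along the flag into a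
    bound by the leading principal minors of [N]. *)
Lemma flag_proj_log k (V : 'M[R]_d) (nu : 'rV[R]_d) : (k <= d)%N ->
  V^T *m V = 1%:M -> (forall j, 0 < nu 0 j) -> N = V^T *m diag_mx nu *m V ->
  N2 = V^T *m diag_mx (map_mx (@Num.sqrt R) nu) *m V ->
  ln (\det ((pid_mx k : 'M[R]_(d, k))^T *m N *m pid_mx k))
    <= \tr (flag_proj k *m (V^T *m diag_mx (map_mx (@ln R) nu) *m V)).
Proof.
move=> kd VV nu0 EN EN2; have VVk := pid_orthonormal kd.
have [F [eta [FF EK eta0 WW WNW]]] := compression_frame pN VVk.
rewrite /flag_proj; set P := pid_mx k in EK WW WNW *; rewrite EK ln_det_spectral //.
have [W EW] : exists W, W = P *m F^T by exists (P *m F^T).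
rewrite -EW in WW WNW.
have -> : invmx (F^T *m diag_mx eta *m F)
    = F^T *m diag_mx (\row_a (eta 0 a)^-1) *m F.
  have E1 : F^T *m diag_mx eta *m F *m (F^T *m diag_mx (\row_a (eta 0 a)^-1) *m F) = 1%:M.
    by rewrite spectral_mul // spectral_const // => a; rewrite !mxE mulfV // gt_eqF.
  have [u _] := mulmx1_unit E1.
  by apply: (can_inj (mulKmx u)); rewrite mulmxV.
pose Q := V^T *m diag_mx (\row_j (nu 0 j * ln (nu 0 j))) *m V.
have [L EL] : exists L, L = V^T *m diag_mx (map_mx (@ln R) nu) *m V by eexists.
have EQ : N2 *m L *m N2 = Q.
  rewrite EN2 EL !spectral_mul //; congr (_ *m diag_mx _ *m _).
  by apply/rowP => j; rewrite !mxE mulrAC -expr2 sqr_sqrtr // ltW.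
rewrite -EL; set Di := diag_mx (\row_a (eta 0 a)^-1).
have -> : \tr (N2 *m P *m (F^T *m Di *m F) *m P^T *m N2 *m L)
    = \tr (Di *m (W^T *m Q *m W)).
  transitivity (\tr ((N2 *m P *m F^T) *m (Di *m F *m P^T *m N2 *m L))).
    by rewrite !mulmxA.
  by rewrite mxtrace_mulC -EQ EW trmx_mul trmxK !mulmxA.
rewrite mul_diag_mx; apply: ler_sum => a _; rewrite mxE congr_diag_entry mxE.
under eq_bigr do rewrite mxE.
set q := fun j => (V *m W) j a ^+ 2.
have q1 : \sum_j q j = 1 by exact: orthonormal_col.
have qe : \sum_j nu 0 j * q j = eta 0 a.
  by rewrite -congr_diag_entry -EN WNW mxE eqxx.
rewrite -(ler_pM2l (eta0 a)) mulrA divff ?gt_eqF // mul1r.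
apply: (@le_trans _ _ (\sum_j (nu 0 j * ln (eta 0 a) + nu 0 j - eta 0 a) * q j)).
  have -> : \sum_j (nu 0 j * ln (eta 0 a) + nu 0 j - eta 0 a) * q j
      = (ln (eta 0 a) + 1) * (\sum_j nu 0 j * q j) - eta 0 a * (\sum_j q j).
    by rewrite !mulr_sumr -sumrB; apply: eq_bigr => j _; ring.
  by rewrite q1 qe; lra.
apply: ler_sum => j _; rewrite ler_wpM2r ?sqr_ge0 //.
exact: xlnx_convex.
Qed.

End Flag.

Lemma telescope_flag (c : nat -> R) d i : (i <= d)%N ->
  \sum_(k < d) (c k - c k.+1) * (i < k.+1)%:R = c i - c d.
Proof.
elim: d => [|d IH]; first by rewrite leqn0 => /eqP ->; rewrite big_ord0 subrr.
rewrite leq_eqVlt big_ord_recr /= => /orP[/eqP ->|].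
  rewrite ltnn mulr0 addr0 subrr big1 // => k _.
  by rewrite ltnS leqNgt (leq_trans (ltn_ord k)) // mulr0.
by rewrite ltnS => id; rewrite IH // id mulr1; ring.
Qed.

Lemma trace_pid d k : (k <= d)%N -> \tr (pid_mx k : 'M[R]_d) = k%:R.
Proof.
move=> kd; have -> : (pid_mx k : 'M[R]_d) = (pid_mx k : 'M[R]_(d, k)) *m (pid_mx k : 'M[R]_(k, d)).
  by rewrite mul_pid_mx !minnn.
rewrite mxtrace_mulC mul_pid_mx minnn (minn_idPr kd) pid_mx_1 mxtrace1 //.
Qed.

Lemma trace_sqr_ge0 d (M : 'M[R]_d) : 0 <= \tr (M^T *m M).
Proof.
apply: sumr_ge0 => i _; rewrite mxE; apply: sumr_ge0 => j _.
by rewrite mxE -expr2 sqr_ge0.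
Qed.

Lemma trace_sqr_eq0 d (M : 'M[R]_d) : \tr (M^T *m M) = 0 -> M = 0.
Proof.
move=> /eqP; rewrite psumr_eq0 => [/allP t0|i _]; last first.
  by rewrite mxE; apply: sumr_ge0 => j _; rewrite mxE -expr2 sqr_ge0.
apply/matrixP => j i; have := t0 i (mem_index_enum _); rewrite mxE psumr_eq0 => [/allP s0|k _].
  by have := s0 j (mem_index_enum _); rewrite !mxE mulf_eq0 orbb => /eqP.
by rewrite mxE -expr2 sqr_ge0.
Qed.

(** In the eigenbasis a commuting matrix has no entry between distinct
    eigenvalues, and [f] does not separate equal ones. *)
Lemma spectral_commute (f : R -> R) d (V W : 'M[R]_d) (e : 'rV[R]_d) :
  V^T *m V = 1%:M ->
  W *m (V^T *m diag_mx e *m V) = V^T *m diag_mx e *m V *m W ->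
  W *m (V^T *m diag_mx (map_mx f e) *m V) = V^T *m diag_mx (map_mx f e) *m V *m W.
Proof.
move=> VV comm; pose Y := V *m W *m V^T.
have cY : Y *m diag_mx e = diag_mx e *m Y.
  have := congr1 (fun M => V *m M *m V^T) comm; rewrite /= !mulmxA (mulmx1C VV) mul1mx.
  by rewrite (orthoK VV) /Y.
have cfY : Y *m diag_mx (map_mx f e) = diag_mx (map_mx f e) *m Y.
  apply/matrixP => i j; have := congr1 (fun M : 'M[R]_d => M i j) cY.
  rewrite /= !mul_diag_mx !mul_mx_diag !mxE; move: (\sum_j0 _) => y.
  have [->|nz] := eqVneq y 0; first by rewrite !mulr0 !mul0r.
  by rewrite [e 0 i * y]mulrC => /(mulfI nz) ->; rewrite mulrC.
have := congr1 (fun M => V^T *m M *m V) cfY; rewrite /= /Y !mulmxA VV mul1mx.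
by rewrite (orthoKT VV).
Qed.

(** Comparison theorem in nonpositive curvature, for a logarithm orthogonal to
    that of [G]: in the triangle formed by [exp (- C)], the identity and [G] the
    angle at the identity is right, so the side opposite to it is longest.

    With [N = exp (C / 2) *m G *m exp (C / 2)], the matrix [Z] built on the flag
    projectors with the gaps of [c] as weights has the Gram matrix of [C], and
    its pairing with [log N] is bounded below level by level: the leading minors
    of [N] are those of [exp C] times those of [G].  Hence
    [|log N|^2 >= 2 <Z, log N> - |Z|^2 >= |C|^2 + 2 <C, log G>].  In the equality
    case [log N = Z] commutes with the flag, which must then be the coordinate
    flag. *)
Lemma right_angle_comparison d (c : nat -> R) (G U : 'M[R]_d.+1) (g : 'rV[R]_d.+1) :
  (forall k, (k < d)%N -> c k.+1 <= c k) ->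
  U^T *m U = 1%:M -> G = U^T *m diag_mx g *m U -> (forall i, 0 < g 0 i) ->
  \tr (diag_mx (\row_(i < d.+1) c i) *m (U^T *m diag_mx (map_mx (@ln R) g) *m U)) = 0 ->
  let H := diag_mx (\row_(i < d.+1) expR (- c i)) in
  dAI H 1%:M <= dAI H G /\ (dAI H G <= dAI H 1%:M -> G = 1%:M).
Proof.
move=> dec UU EG g0 orth H; set X := U^T *m diag_mx (map_mx _ g) *m U in orth.
set C := diag_mx _ in orth.
have pG : pdmx G by rewrite EG; apply: pd_congr; [exact: orthogonal_unit | exact: pd_diag].
have pH : pdmx H by apply: pd_diag => i; rewrite mxE expR_gt0.
pose D := diag_mx (\row_(i < d.+1) expR (c i / 2)) : 'M[R]_d.+1.
have sD : D^T = D by exact: tr_diag_mx.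
have DHD : D^T *m H *m D = 1%:M.
  rewrite sD !mulmx_diag; apply/matrixP => i j; rewrite !mxE -!expRD; congr (_ *+ _).
  by rewrite [X in expR X](_ : _ = 0) ?expR0 //; field.
have DD : D^T *m 1%:M *m D = diag_mx (\row_(i < d.+1) expR (c i)).
  rewrite mulmx1 sD mulmx_diag; congr diag_mx; apply/rowP => i; rewrite !mxE -expRD.
  by congr expR; field.
have uD : D \in unitmx by case/mulmx1_unit: DHD.
have d1 : dAI H 1%:M = Num.sqrt (\tr (C *m C)).
  rewrite (dAI_pencil pH (conj DHD DD)); congr Num.sqrt.
  rewrite /C mulmx_diag mxtrace_diag; apply: eq_bigr => i _; rewrite !mxE expRK expr2.
  by [].
have [V [nu [VV EN nu0]]] := pd_spectral (pd_congr uD pG).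
pose logN := V^T *m diag_mx (map_mx (@ln R) nu) *m V.
have slN : logN^T = logN by exact: spectral_tr.
have d2 : dAI H G = Num.sqrt (\tr (logN *m logN)).
  have P : pencil H G (D *m V^T) nu.
    rewrite /pencil !congr_mul trmxK DHD mulmx1 (mulmx1C VV) EN; split=> //.
    by rewrite !mulmxA (mulmx1C VV) mul1mx (orthoK VV).
  rewrite (dAI_pencil pH P); congr Num.sqrt; rewrite /logN spectral_mul //.
  rewrite mxtrace_mulC mulmxA (mulmx1C VV) mul1mx mxtrace_diag.
  by apply: eq_bigr => j _; rewrite !mxE expr2.
have [N EN'] : exists N, N = D^T *m G *m D by eexists.
have [N2 EN2] : exists N2, N2 = V^T *m diag_mx (map_mx (@Num.sqrt R) nu) *m V by eexists.
have pN : pdmx N by rewrite EN'; exact: pd_congr.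
have sN2 : N2^T = N2 by rewrite EN2; exact: spectral_tr.
have N22 : N2 *m N2 = N.
  rewrite EN2 EN' EN spectral_mul //; congr (_ *m diag_mx _ *m _).
  by apply/rowP => j; rewrite !mxE -expr2 sqr_sqrtr // ltW.
pose Pi k := flag_proj N N2 k; pose E k : 'M[R]_d.+1 := pid_mx k.
pose gap k := c k - c k.+1.
have CE : C = (c d)%:M + \sum_(k < d) gap k *: E k.+1.
  apply/matrixP => i j; rewrite !mxE summxE.
  have [->|ij] := eqVneq i j; last first.
    rewrite !mulr0n big1 ?addr0 // => k _; rewrite !mxE val_eqE (negPf ij) mulr0 //.
  rewrite !mulr1n; under eq_bigr do rewrite !mxE eqxx /=.
  rewrite telescope_flag; last by rewrite -ltnS.
  by rewrite addrC subrK.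
pose Z := (c d)%:M + \sum_(k < d) gap k *: Pi k.+1.
have kd1 (k : 'I_d) : (k.+1 <= d.+1)%N by rewrite ltnW // ltnS.
(* Both chains of projectors are increasing with the same ranks. *)
have gramE k l : (k <= d.+1)%N -> (l <= d.+1)%N -> \tr (Pi k *m Pi l) = \tr (E k *m E l).
  move=> kd ld; rewrite /E mul_pid_mx.
  have [lk|kl] := leqP l k.
    rewrite (minn_idPr ld) (flag_proj_mul pN sN2 N22 _).1 ?lk //.
    by rewrite flag_proj_trace // trace_pid.
  rewrite (minn_idPr kd) (flag_proj_mul pN sN2 N22 _).2 ?(ltnW kl) //.
  by rewrite flag_proj_trace // trace_pid.
have trPi k : (k <= d.+1)%N -> \tr (Pi k) = \tr (E k).
  by move=> kd; rewrite flag_proj_trace // trace_pid.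
have expand (A : nat -> 'M[R]_d.+1) (Y : 'M[R]_d.+1) :
   \tr (((c d)%:M + \sum_(k < d) gap k *: A k.+1) *m Y)
   = c d * \tr Y + \sum_(k < d) gap k * \tr (A k.+1 *m Y).
  rewrite mulmxDl mxtraceD mul_scalar_mx mxtraceZ; congr (_ + _).
  by rewrite mulmx_suml raddf_sum; apply: eq_bigr => k _ /=; rewrite -scalemxAl mxtraceZ.
have ZZ : \tr (Z *m Z) = \tr (C *m C).
  have trZ : \tr Z = \tr C.
    rewrite -[Z]mulmx1 -[C]mulmx1 CE !expand; congr (_ + _).
    by apply: eq_bigr => k _; rewrite !mulmx1 trPi.
  rewrite {1}/Z {1}CE !expand trZ; congr (_ + _); apply: eq_bigr => k _; congr (_ * _).
  rewrite mxtrace_mulC [RHS]mxtrace_mulC CE !expand trPi //; congr (_ + _).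
  by apply: eq_bigr => l _; rewrite gramE.
(* The square root of [exp C] is diagonal, hence factors out of the compression
   to the coordinate flag. *)
have minor k : (k <= d.+1)%N -> \tr (E k *m (C + X)) <= \tr (Pi k *m logN).
  move=> kd; apply: le_trans (flag_proj_log pN kd VV nu0 (etrans EN' EN) EN2).
  rewrite EN'; set W := pid_mx k : 'M[R]_(d.+1, k).
  have WW : W^T *m W = 1%:M by exact: pid_orthonormal.
  have EkW : E k = W *m W^T by rewrite /W tr_pid_mx mul_pid_mx !minnn.
  pose Dk : 'M[R]_k := diag_mx (\row_(i < k) expR (c i / 2)).
  have DW : D *m W = W *m Dk.
    rewrite mul_diag_mx mul_mx_diag; apply/matrixP => i a; rewrite !mxE.
    by case: eqP => [->|_] /=; rewrite ?mulr0 ?mul0r // mulrC.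
  have -> : W^T *m (D^T *m G *m D) *m W = Dk *m (W^T *m G *m W) *m Dk.
    have WD : W^T *m D = Dk *m W^T.
      by rewrite -[LHS]trmxK trmx_mul trmxK sD DW trmx_mul tr_diag_mx.
    by rewrite sD !mulmxA WD -!mulmxA DW !mulmxA.
  have dDk : 0 < \det Dk by rewrite det_diag prodr_gt0 // => i _; rewrite mxE expR_gt0.
  have [F [eta [FF EK eta0 _ _]]] := compression_frame pG WW.
  have dG : 0 < \det (W^T *m G *m W).
    by rewrite EK spectral_det // prodr_gt0.
  rewrite !det_mulmx !lnM ?posrE ?mulr_gt0 //.
  have -> : ln (\det Dk) = \sum_(i < k) c i / 2.
    rewrite det_diag ln_prod => [|i]; last by rewrite mxE expR_gt0.
    by apply: eq_bigr => i _; rewrite mxE expRK.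
  have := ln_det_compression UU g0 WW; rewrite -/X -EG.
  rewrite EkW -[W *m W^T *m _]mulmxA [\tr (W *m _)]mxtrace_mulC.
  rewrite mulmxDr mulmxDl mxtraceD => lX.
  have -> : \tr (W^T *m C *m W) = \sum_(i < k) c i / 2 + \sum_(i < k) c i / 2.
    have CW : C *m W = W *m diag_mx (\row_(i < k) c i).
      rewrite mul_diag_mx mul_mx_diag; apply/matrixP => i a; rewrite !mxE.
      by case: eqP => [->|_] /=; rewrite ?mulr0 ?mul0r // mulrC.
    rewrite -mulmxA CW mulmxA WW mul1mx mxtrace_diag -big_split.
    by apply: eq_bigr => i _; rewrite mxE /=; field.
  by lra.
have total : \tr logN = \tr (C + X).
  have <- : ln (\det (D^T *m G *m D)) = \tr logN.
    rewrite EN ln_det_spectral // /logN mxtrace_mulC mulmxA (mulmx1C VV) mul1mx.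
    by rewrite mxtrace_diag; apply: eq_bigr => j _; rewrite mxE.
  have dD : 0 < \det D by rewrite det_diag prodr_gt0 // => i _; rewrite mxE expR_gt0.
  have dG : 0 < \det G by rewrite EG spectral_det // prodr_gt0.
  rewrite sD !det_mulmx !lnM ?posrE ?mulr_gt0 // EG ln_det_spectral // mxtraceD.
  have -> : ln (\det D) = \sum_(i < d.+1) c i / 2.
    rewrite det_diag ln_prod => [|i]; last by rewrite mxE expR_gt0.
    by apply: eq_bigr => i _; rewrite mxE expRK.
  have -> : \tr C = \sum_(i < d.+1) c i / 2 + \sum_(i < d.+1) c i / 2.
    by rewrite mxtrace_diag -big_split; apply: eq_bigr => i _; rewrite mxE /=; field.
  have -> : \tr X = \sum_i ln (g 0 i).
    rewrite /X mxtrace_mulC mulmxA (mulmx1C UU) mul1mx.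
    by rewrite mxtrace_diag; apply: eq_bigr => j _; rewrite mxE.
  ring.
have pair : \tr (C *m C) <= \tr (Z *m logN).
  have -> : \tr (C *m C) = \tr (C *m (C + X)) by rewrite mulmxDr mxtraceD orth addr0.
  rewrite {1}CE /Z !expand // total lerD2l; apply: ler_sum => k _.
  by rewrite ler_wpM2l ?minor // subr_ge0 dec.
have sZ : Z^T = Z.
  rewrite /Z linearD /= tr_scalar_mx raddf_sum /=; congr (_ + _).
  by apply: eq_bigr => k _; rewrite linearZ /= flag_proj_tr.
have dist : \tr ((logN - Z)^T *m (logN - Z))
    = \tr (logN *m logN) - 2 * \tr (Z *m logN) + \tr (C *m C).
  rewrite [(logN - Z)^T]linearB /= slN sZ mulmxBr !mulmxBl !raddfB /= ZZ [\tr (logN *m Z)]mxtrace_mulC.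
  ring.
have dist0 := trace_sqr_ge0 (logN - Z).
have CC0 : 0 <= \tr (C *m C) by rewrite -{1}[C]tr_diag_mx; exact: trace_sqr_ge0.
split; first by rewrite d1 d2 ler_sqrt; lra.
rewrite d1 d2 ler_sqrt // => le.
have EZ : logN = Z.
  apply/eqP; rewrite -subr_eq0; apply/eqP; apply: trace_sqr_eq0.
  by apply/eqP; rewrite eq_le dist0 andbT; lra.
have commPi k : (k <= d.+1)%N -> Pi k *m logN = logN *m Pi k.
  move=> kd; rewrite EZ /Z mulmxDr mulmxDl scalar_mxC; congr (_ + _).
  rewrite mulmx_sumr mulmx_suml; apply: eq_bigr => l _.
  rewrite -scalemxAr -scalemxAl; congr (_ *: _).
  have [lk|kl] := leqP l.+1 k.
    by have [-> ->] := @flag_proj_mul _ _ _ pN sN2 N22 k l.+1 (introT andP (conj lk kd)).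
  by have [-> ->] := @flag_proj_mul _ _ _ pN sN2 N22 l.+1 k (introT andP (conj (ltnW kl) (kd1 l))).
(* [Pi k] fixes the image under [N2] of the first [k] coordinates and commutes
   with [N2], so it fixes these coordinates. *)
have PiE k : (k <= d.+1)%N -> Pi k = E k.
  move=> kd; have comm2 : Pi k *m N2 = N2 *m Pi k.
    rewrite EN2; have := spectral_commute (fun x => Num.sqrt (expR x)) VV (commPi k kd).
    suff -> : map_mx (fun x => Num.sqrt (expR x)) (map_mx (@ln R) nu) = map_mx (@Num.sqrt R) nu by [].
    by apply/rowP => j; rewrite !mxE lnK // posrE.
  have PW : Pi k *m (pid_mx k : 'M[R]_(d.+1, k)) = pid_mx k.
    apply: (can_inj (mulKmx (square_root_unit pN N22))).
    by rewrite mulmxA -comm2 -mulmxA flag_proj_fix.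
  have PE : Pi k *m E k = E k.
    have -> : E k = (pid_mx k : 'M[R]_(d.+1, k)) *m (pid_mx k : 'M[R]_(k, d.+1)).
      by rewrite mul_pid_mx !minnn.
    by rewrite mulmxA PW.
  have sE : (E k)^T = E k by exact: tr_pid_mx.
  have sP : (Pi k)^T = Pi k by exact: flag_proj_tr.
  have EP : E k *m Pi k = E k by have := congr1 trmx PE; rewrite trmx_mul sE sP.
  apply/eqP; rewrite -subr_eq0; apply/eqP; apply: trace_sqr_eq0.
  rewrite [(Pi k - E k)^T]linearB /= sE sP mulmxBr !mulmxBl PE EP !raddfB /= gramE //.
  have -> : E k *m E k = E k by rewrite /E mul_pid_mx minnn (minn_idPr kd).
  ring.
have logNC : logN = C.
  by rewrite EZ /Z CE; congr (_ + _); apply: eq_bigr => k _; rewrite PiE.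
have NC : D^T *m G *m D = D^T *m 1%:M *m D.
  have I1 : (1%:M : 'M[R]_d.+1)^T *m 1%:M = 1%:M by rewrite trmx1 mulmx1.
  have := symfunE (@expR R) (map_mx (@ln R) nu) VV; rewrite -/logN logNC.
  have := symfunE (@expR R) (\row_(i < d.+1) c i) I1; rewrite !trmx1 !mul1mx !mulmx1.
  rewrite -/C => -> E1; rewrite EN -[D^T]mulmx1 DD.
  have -> : nu = map_mx (@expR R) (map_mx (@ln R) nu).
    by apply/rowP => j; rewrite !mxE lnK // posrE.
  by rewrite -E1; congr diag_mx; apply/rowP => i; rewrite !mxE.
have uDT : D^T \in unitmx by rewrite unitmx_tr.
by apply: (can_inj (mulKmx uDT)); apply: (can_inj (mulmxK uD)).
Qed.

End LogComparison.

(** * Reduction to the identity and simple extreme eigenvalues *)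

Section NearestPoint.
Variable R : realType.

Lemma normalize d (v : 'cV[R]_d) : v != 0 ->
  exists (u : 'cV[R]_d) a, u^T *m u = 1%:M /\ v = a *: u.
Proof.
move=> nv; have q0 := sqnorm_gt0 nv; set q := (v^T *m v) 0 0 in q0.
have s0 : Num.sqrt q != 0 by rewrite gt_eqF // sqrtr_gt0.
exists ((Num.sqrt q)^-1 *: v), (Num.sqrt q); split; last first.
  by rewrite scalerA mulfV // scale1r.
rewrite [(_ *: v)^T]linearZ /= -scalemxAl -scalemxAr scalerA [v^T *m v]mx11_scalar -/q.
rewrite -invfM -expr2 sqr_sqrtr ?ltW // scale_scalar_mx mulVf // gt_eqF //.
Qed.

Lemma qf_scalev d (M : 'M[R]_d) a (u : 'cV[R]_d) :
  qf M (a *: u) = a ^+ 2 * qf M u.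
Proof.
rewrite [(a *: u)^T]linearZ /= -!scalemxAl -scalemxAr.
by rewrite 2!mxE mulrA.
Qed.

Lemma geneigenvalue_unit d (S : 'M[R]_d) l : geneigenvalues 1%:M S l ->
  exists2 u : 'cV[R]_d, u^T *m u = 1%:M & S *m u = l *: u.
Proof.
move=> [v nv]; rewrite mul1mx; have [u [a [uu Ev]]] := normalize nv => Sv.
exists u => //; have a0 : a != 0 by apply: contra_neq nv => a0; rewrite Ev a0 scale0r.
by apply: (scalerI a0); rewrite scalemxAr -Ev Sv Ev !scalerA mulrC.
Qed.

Lemma eigmax_unit d (S : 'M[R]_d) : (0 < d)%N -> pdmx S ->
  exists2 u : 'cV[R]_d, u^T *m u = 1%:M & S *m u = eigmax S *: u.
Proof.
move=> d0 pS; rewrite eigmaxE ?(pS.1) //; apply: geneigenvalue_unit.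
by have [] := extreme_geneigenvalues d0 (pd1 R d) pS.
Qed.

Lemma eigmin_unit d (S : 'M[R]_d) : (0 < d)%N -> pdmx S ->
  exists2 u : 'cV[R]_d, u^T *m u = 1%:M & S *m u = eigmin S *: u.
Proof.
move=> d0 pS; rewrite eigminE ?(pS.1) //; apply: geneigenvalue_unit.
by have [] := extreme_geneigenvalues d0 (pd1 R d) pS.
Qed.

Lemma trace_balancedE m n (S : 'M[R]_(n * m)) : trace_balanced S <->
  exists Qp Qm, [/\ density S (eigmax S) Qp, density S (eigmin S) Qm,
    ptraceB (Qm - Qp) = 0 & ptraceA (Qm - Qp) = 0].
Proof.
split=> [[Qp [Qm [[pp pm] [tp tm] [/eigenspaceP Ep /eigenspaceP Em] B0 A0]]]|].
  by exists Qp, Qm; split.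
move=> [Qp [Qm [[pp tp Ep] [pm tm Em] B0 A0]]]; exists Qp, Qm; split=> //.
by split; apply/eigenspaceP.
Qed.

(** Failure of balance gives a tangent direction whose quadratic form on unit top
    eigenvectors exceeds that on unit bottom eigenvectors by [rho].  The infimum
    of the form over unit top eigenvectors and that infimum minus [rho] are the
    two thresholds needed for a strict descent. *)
Lemma balanced_of_min m n (S : 'M[R]_(n * m)) : (0 < n * m)%N -> pdmx S ->
  (forall G, kron m n G -> kappa 1%:M S <= kappa G S) -> trace_balanced S.
Proof.
move=> d0 pS min; apply/trace_balancedE; have [sS _] := pS.
have [up uup Sup] := eigmax_unit d0 pS; have [um uum Sum] := eigmin_unit d0 pS.
have dp (u : 'cV[R]_(n * m)) : u^T *m u = 1%:M -> S *m u = eigmax S *: u ->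
    density S (eigmax S) (u *m u^T) by exact: density_unit.
have dm (u : 'cV[R]_(n * m)) : u^T *m u = 1%:M -> S *m u = eigmin S *: u ->
    density S (eigmin S) (u *m u^T) by exact: density_unit.
apply: contrapT => unb.
have exp : exists Q, density S (eigmax S) Q by exists (up *m up^T); exact: dp.
have exm : exists Q, density S (eigmin S) Q by exists (um *m um^T); exact: dm.
have [B [A [rho [sB sA rho0 sep]]]] := unbalanced_direction exp exm unb.
set X := _ *t _ + _ in sep.
have {}sep (u w : 'cV[R]_(n * m)) : u^T *m u = 1%:M -> S *m u = eigmax S *: u ->
    w^T *m w = 1%:M -> S *m w = eigmin S *: w -> qf X w + rho <= qf X u.
  move=> uu Su ww Sw; have := sep _ _ (dp u uu Su) (dm w ww Sw).
  by rewrite mulmxBr raddfB /= -!qf_trace; lra.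
pose K := [set x | exists2 u : 'cV[R]_(n * m), u^T *m u = 1%:M &
  S *m u = eigmax S *: u /\ x = qf X u].
have K0 : K !=set0 by exists (qf X up), up.
have Klb (w : 'cV[R]_(n * m)) : w^T *m w = 1%:M -> S *m w = eigmin S *: w -> lbound K (qf X w + rho).
  by move=> ww Sw _ [u uu [Su ->]]; exact: sep.
have Kinf : has_inf K by split=> //; exists (qf X um + rho); exact: Klb.
have scale (v u : 'cV[R]_(n * m)) a : u^T *m u = 1%:M -> v = a *: u ->
    (v^T *m v) 0 0 = a ^+ 2 /\ qf X v = a ^+ 2 * qf X u.
  by move=> uu ->; rewrite -qf1 !qf_scalev qf1 uu [X in _ * X]mxE eqxx mulr1.
have nonzero (v : 'cV[R]_(n * m)) l u a : u^T *m u = 1%:M -> v = a *: u -> v != 0 ->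
    S *m v = l *: v -> S *m u = l *: u.
  move=> uu Ev nv Sv.
  have a0 : a != 0 by apply: contra_neq nv => a0; rewrite Ev a0 scale0r.
  by apply: (scalerI a0); rewrite scalemxAr -Ev Sv Ev !scalerA mulrC.
have [|||G kG] := @kappa_descent _ _ _ S B A (inf K) (inf K - rho) d0 pS sB sA.
- by rewrite ltrBlDr ltrDl.
- move=> v Sv; have [->|nv] := eqVneq v 0; first by rewrite !mulmx0 mxE mulr0.
  have [u [a [uu Ev]]] := normalize nv; have Su := nonzero v _ u a uu Ev nv Sv.
  have [-> ->] := scale v u a uu Ev; rewrite mulrC ler_wpM2l ?sqr_ge0 //.
  by apply: ge_inf; [case: Kinf | exists u].
- move=> v Sv; have [->|nv] := eqVneq v 0; first by rewrite !mulmx0 mxE mulr0.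
  have [u [a [uu Ev]]] := normalize nv; have Su := nonzero v _ u a uu Ev nv Sv.
  have [-> ->] := scale v u a uu Ev; rewrite [leRHS]mulrC ler_wpM2l ?sqr_ge0 //.
  by rewrite lerBrDr; apply: lb_le_inf => //; exact: Klb.
by rewrite ltNge min.
Qed.

(** Distance and condition number are invariant under the congruence that moves
    the nearest point to the identity. *)
Lemma kron_nearest_whiten m n (H P : 'M[R]_(n * m)) :
  pdmx H -> kron_nearest H P ->
  kron_nearest (whiten P H) 1%:M /\
  forall f : R -> R, argmin (kron m n) (fun G => f (kappa G H)) P <->
    forall G, kron m n G -> f (kappa 1%:M (whiten P H)) <= f (kappa G (whiten P H)).
Proof.
move=> pH [kP minP]; have pP := kron_pd kP.
have [C uC [CPC EW kC kC']] := kron_whiten kP.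
rewrite EW; split; first split; first exact: kron1.
  move=> G /kC' [G' kG' ->]; rewrite -CPC !dAI_congr //; last exact: kron_pd kG'.
  exact: minP.
move=> f; rewrite -CPC kappa_congr //; split=> [[_ minf] G /kC' [G' kG' ->]|minf].
  by rewrite kappa_congr //; [exact: minf | exact: kron_pd kG'].
split=> // G kG; have := minf _ (kC G kG).
by rewrite kappa_congr //; exact: kron_pd kG.
Qed.

(** ** Simple extreme eigenvalues *)

(** The row space of [Q] lies on the line of [u]; symmetry and the trace leave no
    freedom. *)
Lemma simple_density d (S : 'M[R]_d) a (u : 'cV[R]_d) Q : S^T = S ->
  \rank (eigenspace S a) = 1%N -> u^T *m u = 1%:M -> S *m u = a *: u ->
  density S a Q -> Q = u *m u^T.
Proof.
move=> sS rk uu Su [[sQ _] tQ /eigenspaceP EQ].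
have uS : (u^T <= eigenspace S a)%MS.
  by apply/eigenspaceP; rewrite -[in LHS]sS -trmx_mul Su linearZ.
have ru : \rank u^T = 1%N.
  apply/eqP; rewrite eqn_leq rank_leq_row lt0n mxrank_eq0.
  apply/eqP => u0; move: uu; rewrite u0 mul0mx => /matrixP/(_ 0 0)/eqP.
  by rewrite !mxE eq_sym oner_eq0.
have Su1 : (eigenspace S a <= u^T)%MS.
  by have [_ <-] := mxrank_leqif_sup uS; rewrite ru rk.
have /submxP [D ED] := submx_trans EQ Su1.
have QD : Q *m u = D by rewrite ED -mulmxA uu mulmx1.
have E1 : Q = Q *m u *m u^T by rewrite QD.
have E2 : Q = u *m (u^T *m Q *m u) *m u^T.
  by rewrite {1}E1 -{1}sQ {1}E1 !trmx_mul trmxK sQ !mulmxA.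
have [c Ec] : exists c, u^T *m Q *m u = c%:M by exists ((u^T *m Q *m u) 0 0); exact: mx11_scalar.
rewrite Ec mul_mx_scalar -scalemxAl in E2.
move: tQ; rewrite E2 mxtraceZ mxtrace_mulC uu mxtrace1 mulr1 => ->.
exact: scale1r.
Qed.

Lemma balanced_simple m n (S : 'M[R]_(n * m)) (up um : 'cV[R]_(n * m)) : S^T = S ->
  \rank (eigenspace S (eigmax S)) = 1%N -> \rank (eigenspace S (eigmin S)) = 1%N ->
  up^T *m up = 1%:M -> S *m up = eigmax S *: up ->
  um^T *m um = 1%:M -> S *m um = eigmin S *: um ->
  (trace_balanced S <->
    ptraceB (up *m up^T) = ptraceB (um *m um^T) /\
    ptraceA (up *m up^T) = ptraceA (um *m um^T)).
Proof.
move=> sS rp rm uup Sup uum Sum; rewrite trace_balancedE; split.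
  move=> [Qp [Qm [dp dm]]].
  rewrite (simple_density sS rp uup Sup dp) (simple_density sS rm uum Sum dm).
  by rewrite ptraceB_sub ptraceA_sub => /subr0_eq -> /subr0_eq ->.
move=> [EB EA]; exists (up *m up^T), (um *m um^T).
rewrite ptraceB_sub ptraceA_sub EB EA !subrr.
by split=> //; apply: density_unit.
Qed.

End NearestPoint.

(** * Two eigenvalues *)

Section TwoEigenvalues.
Variable R : realType.

(** ** Two eigenvalues *)

Lemma scalar_mx_trace1 d (M N : 'M[R]_d) a b : (0 < d)%N ->
  M = a%:M -> N = b%:M -> \tr M = 1 -> \tr N = 1 -> M = N.
Proof.
move=> d0 -> ->; rewrite !mxtrace_scalar => ta tb; congr (_%:M).
have dn0 : d%:R != 0 :> R by rewrite pnatr_eq0 -lt0n.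
by apply: (mulIf dn0); rewrite !mulr_natr ta tb.
Qed.

(** With two eigenvalues the logarithm of [S] is an affine function of [S], so
    stationarity makes both partial traces of [S], hence of the two normalized
    spectral projectors, scalar. *)
Lemma balanced_two_eigenvalues m n (S : 'M[R]_(n * m)) a b :
  (0 < m)%N -> (0 < n)%N -> pdmx S -> kron_nearest S 1%:M -> a != b ->
  [set c | eigenvalue S c] = [set a; b] -> trace_balanced S.
Proof.
move=> m0 n0 pS near ab Eab; have d0 : (0 < n * m)%N by rewrite muln_gt0 n0.
have [sS _] := pS; have [U [s [UU ES s0]]] := pd_spectral pS.
have [LB LA] := nearest_ptrace_log pS UU ES near.
have Es : [set c | eigenvalue S c] = [set s 0 i | i in [set: 'I_(n * m)]].
  rewrite eigenvalue_geneigenvalues //; apply: (geneigenvalues_pencil (W := U^T)).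
  split; rewrite trmxK; first by rewrite mulmx1 (mulmx1C UU).
  by rewrite ES !mulmxA (mulmx1C UU) mul1mx (orthoK UU).
have [gM gm _ _] := extreme_geneigenvalues d0 (pd1 R _) pS.
have lm0 := eigmin_gt0 d0 pS.
have sM i : s 0 i <= eigmax S.
  rewrite eigmaxE //; apply: ub_le_sup; last by rewrite -eigenvalue_geneigenvalues // Es; exists i.
  exists (sup (geneigenvalues 1%:M S)) => l; apply: geneigenvalue_le; first exact: pd1.
  by move=> v; have [_ _ _ /(_ v) /andP[]] := extreme_geneigenvalues d0 (pd1 R _) pS.
have sm i : eigmin S <= s 0 i.
  rewrite eigminE //; apply: ge_inf; last by rewrite -eigenvalue_geneigenvalues // Es; exists i.
  exists (inf (geneigenvalues 1%:M S)) => l; apply: geneigenvalue_ge; first exact: pd1.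
  by move=> v; have [_ _ _ /(_ v) /andP[]] := extreme_geneigenvalues d0 (pd1 R _) pS.
rewrite -eigmaxE // -eigenvalue_geneigenvalues // in gM.
rewrite -eigminE // -eigenvalue_geneigenvalues // in gm.
apply/trace_balancedE; move: gM gm lm0 sM sm.
set M := eigmax S; set l := eigmin S => gM gm l0 sM sm.
have [iM _ EM] : [set s 0 i | i in [set: 'I_(n * m)]] M by rewrite -Es.
have [il _ El] : [set s 0 i | i in [set: 'I_(n * m)]] l by rewrite -Es.
have [ia _ Ea] : [set s 0 i | i in [set: 'I_(n * m)]] a by rewrite -Es Eab; left.
have [ib _ Eb] : [set s 0 i | i in [set: 'I_(n * m)]] b by rewrite -Es Eab; right.
have lM : l < M.
  rewrite lt_neqAle (le_trans (sm ia) (sM ia)) andbT; apply: contra_neq ab => lM.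
  apply/eqP; rewrite -Ea -Eb eq_le.
  by rewrite (le_trans (sM ia)) ?(le_trans (sM ib)) // -lM.
have two i : s 0 i = M \/ s 0 i = l.
  have : [set a; b] (s 0 i) by rewrite -Eab Es; exists i.
  have : [set a; b] M by rewrite -Eab; exact: gM.
  have : [set a; b] l by rewrite -Eab; exact: gm.
  move=> /= hl hM hs; have nlM : l <> M by move=> E; move: lM; rewrite E ltxx.
  by case: hl => hl; case: hM => hM; case: hs => hs;
    rewrite ?hs ?hl ?hM; auto; exfalso; apply: nlM; rewrite hl hM.
have M0 : 0 < M by exact: lt_trans lM.
pose be := (ln M - ln l) / (M - l); pose al := ln M - be * M.
have Ml0 : M - l != 0 by rewrite subr_eq0 gt_eqF.
have be0 : be != 0.
  by rewrite mulf_neq0 ?invr_neq0 // subr_eq0 gt_eqF // ltr_ln ?posrE.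
have EL : U^T *m diag_mx (map_mx (@ln R) s) *m U = be *: S + al *: 1%:M.
  have -> : map_mx (@ln R) s = be *: s + const_mx al.
    apply/rowP => i; rewrite !mxE; case: (two i) => ->; rewrite /al /be; field => //.
  rewrite raddfD /= mulmxDr mulmxDl; congr (_ + _).
    by rewrite linearZ /= -scalemxAr -scalemxAl -ES.
  by rewrite diag_const_mx mul_mx_scalar -scalemxAl UU.
have scal k c (T : 'M[R]_k) : be *: T + al *: c%:M = 0 -> T = (- be^-1 * (al * c))%:M.
  rewrite scale_scalar_mx => /eqP; rewrite addr_eq0 => /eqP E.
  by rewrite -[LHS](scalerK be0) E scalerN scale_scalar_mx -raddfN /= mulNr.
rewrite EL ptraceB_linear in LB; rewrite EL ptraceA_linear in LA.
have ptB c (L : 'M[R]_(n * m)) : ptraceB (c *: L) = c *: ptraceB L.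
  by rewrite -[c *: L]addr0 ptraceB_linear -[0 in LHS](subrr L) ptraceB_sub subrr addr0.
have ptA c (L : 'M[R]_(n * m)) : ptraceA (c *: L) = c *: ptraceA L.
  by rewrite -[c *: L]addr0 ptraceA_linear -[0 in LHS](subrr L) ptraceA_sub subrr addr0.
rewrite ptB ptraceB1 in LB; rewrite ptA ptraceA1 in LA.
have {LB} [cB LB] : exists c, ptraceB S = c%:M by eexists; exact: scal LB.
have {LA} [cA LA] : exists c, ptraceA S = c%:M by eexists; exact: scal LA.
pose Zp := U^T *m diag_mx (s - const_mx l) *m U.
pose Zm := U^T *m diag_mx (const_mx M - s) *m U.
have EZp : Zp = 1 *: S + (- l) *: 1%:M.
  rewrite /Zp raddfB /= mulmxBr mulmxBl -ES diag_const_mx mul_mx_scalar -scalemxAl UU.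
  by apply/matrixP => i j; rewrite !mxE; ring.
have EZm : Zm = (-1) *: S + M *: 1%:M.
  rewrite /Zm raddfB /= mulmxBr mulmxBl -ES diag_const_mx mul_mx_scalar -scalemxAl UU.
  by apply/matrixP => i j; rewrite !mxE; ring.
have traceE e : \tr (U^T *m diag_mx e *m U) = \sum_i e 0 i.
  by rewrite mxtrace_mulC mulmxA (mulmx1C UU) mul1mx mxtrace_diag.
have tp0 : 0 < \tr Zp.
  rewrite traceE (bigD1 iM) //= !mxE EM ltr_pwDl ?subr_gt0 //.
  by apply: sumr_ge0 => i _; rewrite !mxE subr_ge0.
have tm0 : 0 < \tr Zm.
  rewrite traceE (bigD1 il) //= !mxE El ltr_pwDl ?subr_gt0 //.
  by apply: sumr_ge0 => i _; rewrite !mxE subr_ge0.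
have dens Z c e : Z = U^T *m diag_mx e *m U -> (forall i, 0 <= e 0 i) ->
    (forall i, e 0 i * s 0 i = c * e 0 i) -> 0 < \tr Z -> density S c ((\tr Z)^-1 *: Z).
  move=> EZ e0 es tZ; split.
  - have [sZ pZ] : psdmx Z by rewrite EZ; apply: psd_congr; exact: psd_diag.
    split=> [|v]; first by rewrite linearZ /= sZ.
    by rewrite qf_scale mulr_ge0 // invr_ge0 ltW.
  - by rewrite mxtraceZ mulVf // gt_eqF.
  rewrite -scalemxAl scalerA mulrC -scalerA; congr (_ *: _).
  rewrite EZ ES spectral_mul //.
  have -> : \row_i (e 0 i * s 0 i) = c *: e by apply/rowP => i; rewrite !mxE.
  by rewrite linearZ /= -scalemxAr -scalemxAl.
have dp : density S M ((\tr Zp)^-1 *: Zp).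
  apply: (dens Zp M (s - const_mx l)) => // i; rewrite !mxE ?subr_ge0 //.
  by case: (two i) => ->; rewrite ?subrr ?mulr0 ?mul0r // mulrC.
have dm : density S l ((\tr Zm)^-1 *: Zm).
  apply: (dens Zm l (const_mx M - s)) => // i; rewrite !mxE ?subr_ge0 //.
  by case: (two i) => ->; rewrite ?subrr ?mulr0 ?mul0r // mulrC.
exists ((\tr Zp)^-1 *: Zp), ((\tr Zm)^-1 *: Zm); split=> //.
  rewrite ptraceB_sub; apply/eqP; rewrite subr_eq0; apply/eqP.
  apply: (scalar_mx_trace1 m0); last 2 first.
  - by rewrite ptraceB_trace; case: dm.
  - by rewrite ptraceB_trace; case: dp.
  - rewrite ptB EZm ptraceB_linear ptB ptraceB1 LB.
    by rewrite !scale_scalar_mx -raddfD /= scale_scalar_mx; reflexivity.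
  rewrite ptB EZp ptraceB_linear ptB ptraceB1 LB.
  by rewrite !scale_scalar_mx -raddfD /= scale_scalar_mx; reflexivity.
rewrite ptraceA_sub; apply/eqP; rewrite subr_eq0; apply/eqP.
apply: (scalar_mx_trace1 n0); last 2 first.
- by rewrite ptraceA_trace; case: dm.
- by rewrite ptraceA_trace; case: dp.
- rewrite ptA EZm ptraceA_linear ptA ptraceA1 LA.
  by rewrite !scale_scalar_mx -raddfD /= scale_scalar_mx; reflexivity.
rewrite ptA EZp ptraceA_linear ptA ptraceA1 LA.
by rewrite !scale_scalar_mx -raddfD /= scale_scalar_mx; reflexivity.
Qed.

End TwoEigenvalues.

(** * The counterexample *)

Section Example.
Variable R : realType.

Lemma ptraceA_tens m n (B : 'M[R]_n) (A : 'M[R]_m) :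
  ptraceA (B *t A) = \tr A *: B.
Proof.
apply/matrixP => p q; rewrite ptraceAE mxE mulr_suml.
by apply: eq_bigr => i _; rewrite tensmxE mulrC.
Qed.

Lemma ptraceB_tens m n (B : 'M[R]_n) (A : 'M[R]_m) :
  ptraceB (B *t A) = \tr B *: A.
Proof.
apply/matrixP => i j; rewrite ptraceBE mxE mulr_suml.
by apply: eq_bigr => p _; rewrite tensmxE.
Qed.

Lemma symfun_diag (f : R -> R) d (e : 'rV[R]_d) :
  symfun f (diag_mx e) = diag_mx (map_mx f e).
Proof.
have := @symfunE R f d 1%:M e; rewrite trmx1 !mul1mx !mulmx1.
exact.
Qed.

Lemma kappa_diag d (g h : 'rV[R]_d) i j :
  (forall k, 0 < g 0 k) ->
  (forall k, h 0 j / g 0 j <= h 0 k / g 0 k <= h 0 i / g 0 i) ->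
  kappa (diag_mx g) (diag_mx h) = (h 0 i / g 0 i) / (h 0 j / g 0 j).
Proof.
move=> g0 b; pose w := diag_mx (\row_k (Num.sqrt (g 0 k))^-1) : 'M[R]_d.
have wT : w^T = w by exact: tr_diag_mx.
have ww k : (Num.sqrt (g 0 k))^-1 * (Num.sqrt (g 0 k))^-1 = (g 0 k)^-1.
  by rewrite -invfM -expr2 sqr_sqrtr // ltW.
have P : pencil (diag_mx g) (diag_mx h) w (\row_k (h 0 k / g 0 k)).
  rewrite /pencil wT !mulmx_diag; split.
    apply/matrixP => k l; rewrite !mxE mulrAC ww mulVf //.
    by rewrite gt_eqF.
  congr diag_mx; apply/rowP => k; rewrite !mxE mulrAC ww mulrC //.
rewrite /kappa (geneigenvalues_pencil P); congr (_ / _).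
  apply: sup_max; first by exists i; rewrite ?mxE.
  by move=> _ [k _ <-]; rewrite mxE; have /andP[] := b k.
apply: inf_min; first by exists j; rewrite ?mxE.
by move=> _ [k _ <-]; rewrite mxE; have /andP[] := b k.
Qed.

(** The comparison theorem is invariant under orthogonal congruence. *)
Lemma right_angle_comparison_basis d (c : nat -> R) (T G U : 'M[R]_d.+1)
    (g : 'rV[R]_d.+1) :
  (forall k, (k < d)%N -> c k.+1 <= c k) -> T^T *m T = 1%:M ->
  U^T *m U = 1%:M -> G = U^T *m diag_mx g *m U -> (forall i, 0 < g 0 i) ->
  \tr (T^T *m diag_mx (\row_(i < d.+1) c i) *m T *m
       (U^T *m diag_mx (map_mx (@ln R) g) *m U)) = 0 ->
  let H := T^T *m diag_mx (\row_(i < d.+1) expR (- c i)) *m T in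
  dAI H 1%:M <= dAI H G /\ (dAI H G <= dAI H 1%:M -> G = 1%:M).
Proof.
move=> dec TT UU EG g0 orth H; have TT' := mulmx1C TT.
have uT : T \in unitmx by exact: orthogonal_unit.
have UU' : (U *m T^T)^T *m (U *m T^T) = 1%:M.
  by rewrite trmx_mul trmxK mulmxA -[T *m U^T *m U]mulmxA UU mulmx1.
have conj e : T *m (U^T *m diag_mx e *m U) *m T^T
    = (U *m T^T)^T *m diag_mx e *m (U *m T^T).
  by rewrite trmx_mul trmxK !mulmxA.
have EG' : T *m G *m T^T = (U *m T^T)^T *m diag_mx g *m (U *m T^T) by rewrite EG conj.
have [|le eq] := right_angle_comparison dec UU' EG' g0.
  rewrite -conj -[RHS]orth [RHS]mxtrace_mulC [LHS]mxtrace_mulC !mulmxA.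
  by rewrite [RHS]mxtrace_mulC !mulmxA.
have pG : pdmx G by rewrite EG; apply: pd_congr; [exact: orthogonal_unit | exact: pd_diag].
have pD : pdmx (diag_mx (\row_(i < d.+1) expR (- c i))).
  by apply: pd_diag => i; rewrite mxE expR_gt0.
have G1 : T^T *m (T *m G *m T^T) *m T = G.
  by rewrite !mulmxA TT mul1mx -mulmxA TT mulmx1.
have pG' : pdmx (T *m G *m T^T).
  by rewrite -{1}[T]trmxK; apply: pd_congr => //; rewrite unitmx_tr.
have E1 : dAI H 1%:M = dAI (diag_mx (\row_(i < d.+1) expR (- c i))) 1%:M.
  by rewrite -(dAI_congr uT pD (pd1 R _)) mulmx1 TT.
have E2 : dAI H G = dAI (diag_mx (\row_(i < d.+1) expR (- c i))) (T *m G *m T^T).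
  by rewrite -(dAI_congr uT pD pG') G1.
rewrite E1 E2; split=> // /eq E; by rewrite -G1 E mulmx1 TT.
Qed.

Let a : 'rV[R]_2 := \row_i [:: 1; -1]`_i.
Let b : 'rV[R]_3 := \row_i [:: 2; - (1 / 2); - (3 / 2)]`_i.
Let l : 'rV[R]_(3 * 2) := tensrow b a.
Let k0 : 'I_(3 * 2) := @Ordinal 6 0 isT.
Let k1 : 'I_(3 * 2) := @Ordinal 6 1 isT.
Let k2 : 'I_(3 * 2) := @Ordinal 6 2 isT.
Let k3 : 'I_(3 * 2) := @Ordinal 6 3 isT.
Let k4 : 'I_(3 * 2) := @Ordinal 6 4 isT.
Let k5 : 'I_(3 * 2) := @Ordinal 6 5 isT.

Lemma ord6P (P : 'I_(3 * 2) -> Prop) :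
  P k0 -> P k1 -> P k2 -> P k3 -> P k4 -> P k5 -> forall k, P k.
Proof.
move=> p0 p1 p2 p3 p4 p5 [k kP]; have kP' : (k < 6)%N by exact: kP.
case: k kP kP' => [|[|[|[|[|[|//]]]]]] kP _.
- by rewrite (_ : Ordinal kP = k0) //; exact: val_inj.
- by rewrite (_ : Ordinal kP = k1) //; exact: val_inj.
- by rewrite (_ : Ordinal kP = k2) //; exact: val_inj.
- by rewrite (_ : Ordinal kP = k3) //; exact: val_inj.
- by rewrite (_ : Ordinal kP = k4) //; exact: val_inj.
- by rewrite (_ : Ordinal kP = k5) //; exact: val_inj.
Qed.

Lemma tensrow_val (b' : 'rV[R]_3) (a' : 'rV[R]_2) :
  [/\ tensrow b' a' 0 k0 = b' 0 (@Ordinal 3 0 isT) * a' 0 (@Ordinal 2 0 isT),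
      tensrow b' a' 0 k1 = b' 0 (@Ordinal 3 0 isT) * a' 0 (@Ordinal 2 1 isT)
    & tensrow b' a' 0 k2 = b' 0 (@Ordinal 3 1 isT) * a' 0 (@Ordinal 2 0 isT)] /\
  [/\ tensrow b' a' 0 k3 = b' 0 (@Ordinal 3 1 isT) * a' 0 (@Ordinal 2 1 isT),
      tensrow b' a' 0 k4 = b' 0 (@Ordinal 3 2 isT) * a' 0 (@Ordinal 2 0 isT)
    & tensrow b' a' 0 k5 = b' 0 (@Ordinal 3 2 isT) * a' 0 (@Ordinal 2 1 isT)].
Proof.
by split; split; rewrite mxE; congr (b' _ _ * a' _ _); exact: val_inj.
Qed.

Lemma log_values : [/\ l 0 k0 = 2, l 0 k1 = -2 & l 0 k2 = - (1 / 2)] /\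
  [/\ l 0 k3 = 1 / 2, l 0 k4 = - (3 / 2) & l 0 k5 = 3 / 2].
Proof.
have [[E0 E1 E2] [E3 E4 E5]] := tensrow_val b a.
rewrite /l E0 E1 E2 E3 E4 E5 !mxE /=.
by split; split; lra.
Qed.

Lemma example_log : diag_mx b *t diag_mx a = diag_mx l.
Proof. exact: diag_tens. Qed.

Lemma example_mxexp : mxexp (diag_mx b *t diag_mx a) = diag_mx (map_mx (@expR R) l).
Proof. by rewrite example_log /mxexp symfun_diag. Qed.

Lemma example_kappa1 :
  ln (kappa 1%:M (mxexp (diag_mx b *t diag_mx a))) = 4.
Proof.
have [[E0 E1 E2] [E3 E4 E5]] := log_values.
rewrite example_mxexp -diag_const_mx (@kappa_diag _ _ _ k0 k1) => [|k|k].
- rewrite ![const_mx _ _ _]mxE !divr1 ![map_mx _ _ _ _]mxE E0 E1 -expRN -expRD expRK.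
  by lra.
- by rewrite mxE.
rewrite ![const_mx _ _ _]mxE !divr1 ![map_mx _ _ _ _]mxE !ler_expR E0 E1.
move: k; apply: ord6P; rewrite ?(E0, E1, E2, E3, E4, E5); lra.
Qed.

Let g : 'rV[R]_(3 * 2) := tensrow (const_mx 1) (map_mx (@expR R) ((1 / 4) *: a)).

Lemma example_pointE :
  (1%:M : 'M[R]_3) *t mxexp ((1 / 4) *: diag_mx a) = diag_mx g.
Proof.
rewrite -[(1 / 4) *: diag_mx a]linearZ /mxexp symfun_diag.
by rewrite -[1%:M]diag_const_mx diag_tens.
Qed.

Lemma example_point_values :
  [/\ g 0 k0 = expR (1 / 4), g 0 k1 = expR (- (1 / 4)) & g 0 k2 = expR (1 / 4)] /\
  [/\ g 0 k3 = expR (- (1 / 4)), g 0 k4 = expR (1 / 4) & g 0 k5 = expR (- (1 / 4))].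
Proof.
have [[E0 E1 E2] [E3 E4 E5]] := tensrow_val (const_mx 1) (map_mx (@expR R) ((1 / 4) *: a)).
rewrite /g E0 E1 E2 E3 E4 E5 !mxE /= !mul1r.
by split; split; congr expR; lra.
Qed.

Lemma example_kappa2 :
  ln (kappa ((1%:M : 'M[R]_3) *t mxexp ((1 / 4) *: diag_mx a))
            (mxexp (diag_mx b *t diag_mx a))) = 7 / 2.
Proof.
have [[E0 E1 E2] [E3 E4 E5]] := log_values.
have [[F0 F1 F2] [F3 F4 F5]] := example_point_values.
rewrite example_mxexp example_pointE (@kappa_diag _ _ _ k0 k1) => [|k|k].
- rewrite F0 F1 ![map_mx _ _ _ _]mxE E0 E1 -!expRN -!expRD -expRN -expRD expRK; lra.
- by move: k; apply: ord6P; rewrite ?(F0, F1, F2, F3, F4, F5) expR_gt0.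
rewrite F0 F1 ![map_mx _ _ _ _]mxE E0 E1.
by move: k; apply: ord6P; rewrite ?(F0, F1, F2, F3, F4, F5, E0, E1, E2, E3, E4, E5)
  -!expRN -!expRD !ler_expR; lra.
Qed.

Lemma example_pd : pdmx (mxexp (diag_mx b *t diag_mx a)).
Proof. by rewrite example_mxexp; apply: pd_diag => k; rewrite mxE expR_gt0. Qed.

Lemma example_kron : kron 2 3 ((1%:M : 'M[R]_3) *t mxexp ((1 / 4) *: diag_mx a)).
Proof.
exists (mxexp ((1 / 4) *: diag_mx a)), 1%:M; split=> //; last exact: pd1.
rewrite -[(1 / 4) *: diag_mx a]linearZ /mxexp symfun_diag.
by apply: pd_diag => k; rewrite mxE expR_gt0.
Qed.

(** The entries of the logarithm with opposite sign, in decreasing order, and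
    their positions. *)
Let c (k : nat) : R := [:: 2; 3 / 2; 1 / 2; - (1 / 2); - (3 / 2); -2]`_k.
Let sfun (k : 'I_(3 * 2)) : 'I_(3 * 2) := nth k0 [:: k1; k4; k2; k3; k5; k0] k.

(** The logarithm is a tensor product of traceless factors, so both its partial
    traces vanish and it is orthogonal to every [log G] of the family. *)
Lemma example_nearest :
  kron_nearest (mxexp (diag_mx b *t diag_mx a)) = [set (1%:M : 'M[R]_(3 * 2))].
Proof.
have [[E0 E1 E2] [E3 E4 E5]] := log_values.
have sinj : injective sfun.
  have can : cancel sfun (fun k => nth k0 [:: k5; k0; k2; k3; k1; k4] k) by exact: ord6P.
  exact: can_inj can.
pose T : 'M[R]_6 := perm_mx (perm sinj).
have TT : T^T *m T = 1%:M by rewrite tr_perm_mx -perm_mxM mulVg perm_mx1.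
have lc k : l 0 (sfun k) = - c k.
  by move: k; apply: ord6P; rewrite /sfun /c /= ?(E0, E1, E2, E3, E4, E5) ?opprK.
have conj (x y : 'rV[R]_6) : (forall k, y 0 (sfun k) = x 0 k) ->
    T^T *m diag_mx x *m T = diag_mx y.
  move=> xy; have -> : T^T *m diag_mx x *m T = T^T *m (T *m diag_mx y).
    rewrite -mulmxA; congr (_ *m _); rewrite mul_diag_mx mul_mx_diag.
    apply/matrixP => i j; rewrite !mxE permE.
    by case: eqP => [<-|_]; rewrite ?xy ?mulr1 ?mul1r ?mulr0 ?mul0r.
  by rewrite mulmxA TT mul1mx.
have dec k : (k < 5)%N -> c k.+1 <= c k.
  by case: k => [|[|[|[|[|//]]]]] _; rewrite /c /=; lra.
have EH : mxexp (diag_mx b *t diag_mx a)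
    = T^T *m diag_mx (\row_(i < 6) expR (- c i)) *m T.
  by rewrite example_mxexp; apply/esym/conj => k; rewrite [LHS]mxE lc [RHS]mxE.
have EL : T^T *m diag_mx (\row_(i < 6) c i) *m T = - (diag_mx b *t diag_mx a).
  by rewrite example_log -raddfN; apply: conj => k; rewrite [LHS]mxE lc opprK [RHS]mxE.
have tra : \tr (diag_mx a) = 0.
  by rewrite mxtrace_diag !big_ord_recr big_ord0 /= !mxE /=; lra.
have trb : \tr (diag_mx b) = 0.
  by rewrite mxtrace_diag !big_ord_recr big_ord0 /= !mxE /=; lra.
have main (G : 'M[R]_(3 * 2)) : kron 2 3 G ->
    dAI (mxexp (diag_mx b *t diag_mx a)) 1%:M <= dAI (mxexp (diag_mx b *t diag_mx a)) G /\
    (dAI (mxexp (diag_mx b *t diag_mx a)) G <= dAI (mxexp (diag_mx b *t diag_mx a)) 1%:M ->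
     G = 1%:M).
  move=> kG; have [F [gam [B' [A' [FF EG g0 EX]]]]] := kron_log kG.
  have orth : \tr ((diag_mx b *t diag_mx a) *m (B' *t 1%:M + 1%:M *t A')) = 0.
    rewrite mxtrace_mulC tangent_trace ptraceA_tens ptraceB_tens tra trb.
    by rewrite !scale0r !mul0mx !mxtrace0 addr0.
  rewrite EH; apply: (@right_angle_comparison_basis 5 c T G F gam) => //.
  rewrite EL EX mulNmx raddfN /=; apply/eqP; rewrite oppr_eq0; apply/eqP; exact: orth.
apply/seteqP; split=> [G [kG minG]|_ ->].
  by apply: (main G kG).2; apply: minG; exact: kron1.
by split=> [|G kG]; [exact: kron1 | exact: (main G kG).1].
Qed.

End Example.

Theorem theorem5p10 (R : realType) :
  (forall (m n : nat) (H P : 'M[R]_(n * m)),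
    (0 < m)%N -> (0 < n)%N -> pdmx H -> kron_nearest H P ->
    let S := whiten P H in
    [/\ (* (i) *)
        argmin (kron m n) (fun G => ln (kappa G H)) P <-> trace_balanced S,
        (* (ii) *)
        (\rank (eigenspace S (eigmax S)) = 1%N ->
         \rank (eigenspace S (eigmin S)) = 1%N ->
         forall up um : 'cV[R]_(n * m),
           up^T *m up = 1%:M -> S *m up = eigmax S *: up ->
           um^T *m um = 1%:M -> S *m um = eigmin S *: um ->
           (trace_balanced S <->
            ptraceB (up *m up^T) = ptraceB (um *m um^T) /\
            ptraceA (up *m up^T) = ptraceA (um *m um^T)))
      & (* (iii) *)
        ((exists a b : R, a != b /\ [set c | eigenvalue S c] = [set a; b]) ->
         trace_balanced S /\ argmin (kron m n) (fun G => kappa G H) P)]) /\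
  (* (iv) *)
  (let A : 'M[R]_2 := diag_mx (\row_i [:: 1; -1]`_i) in
   let B : 'M[R]_3 := diag_mx (\row_i [:: 2; - (1 / 2); - (3 / 2)]`_i) in
   let H : 'M[R]_(3 * 2) := mxexp (B *t A) in
   let G : 'M[R]_(3 * 2) := 1%:M *t mxexp ((1 / 4) *: A) in
   [/\ pdmx H,
       kron_nearest H = [set 1%:M],
       ln (kappa 1%:M H) = 4,
       kron 2 3 G /\ ln (kappa G H) = 7 / 2
     & ~ argmin (kron 2 3) (fun G' => kappa G' H) 1%:M]).
Proof.
split.
  move=> m n H P m0 n0 pH near S.
  have d0 : (0 < n * m)%N by rewrite muln_gt0 n0.
  have pS : pdmx S by apply: whiten_pd => //; case: near => /kron_pd.
  have [near1 redu] := kron_nearest_whiten pH near; rewrite -/S in near1 redu.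
  have balanced_min : trace_balanced S ->
      forall G, kron m n G -> kappa 1%:M S <= kappa G S.
    by move=> bal G kG; exact: trace_balanced_min.
  have k0 G : kron m n G -> 0 < kappa G S.
    by move=> kG; apply: kappa_gt0 => //; exact: kron_pd kG.
  split.
  - rewrite (redu (@ln R)); split=> [min|bal G kG]; last first.
      by rewrite ler_ln ?posrE ?k0 ?balanced_min //; exact: kron1.
    apply: balanced_of_min => // G kG; have := min G kG.
    by rewrite ler_ln ?posrE ?k0 //; exact: kron1.
  - move=> rp rm up um uup Sup uum Sum.
    by apply: balanced_simple => //; case: pS.
  move=> [x [y [xy Exy]]].
  have bal : trace_balanced S by exact: (balanced_two_eigenvalues m0 n0 pS near1 xy Exy).
  by split=> //; apply/(redu id) => G; exact: balanced_min.
move=> A B H G; split.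
- exact: example_pd.
- exact: example_nearest.
- exact: example_kappa1.
- by split; [exact: example_kron | exact: example_kappa2].
move=> [_ /(_ G (example_kron R))]; rewrite leNgt => /negP; apply.
have pos G' : kron 2 3 G' -> 0 < kappa G' H.
  by move=> kG'; apply: kappa_gt0 => //; [exact: kron_pd kG' | exact: example_pd].
rewrite -ltr_ln ?posrE ?pos //; [|exact: example_kron|exact: kron1].
have -> : ln (kappa G H) = 7 / 2 by exact: example_kappa2.
have -> : ln (kappa 1%:M H) = 4 by exact: example_kappa1.
lra.
Qed.
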